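(* Suppose that the choice functions $C_f$, $f\in F$, satisfy the gapless condition (C). When $x^{\min}$ is available (given as part of the input, along with $G$, $b$, $q$, the linear orders $>_w$ and oracles for $C_f$), the set $\mathcal R$ of rotations $L$ along with their maximal feasible weights $\tau_L$, and the minimal generating graph $H=(\mathcal R,\mathcal E)$ for the poset $(\mathcal R,\lessdot)$, can be constructed in weakly polynomial time, namely in time $\log b^{\max}$ times a polynomial in $|V|,|E|$.
   Context: Setting. $G=(V,E)$ is a finite connected bipartite graph without multiple edges, $V$ partitioned into independent sets $W$ (workers) and $F$ (firms). $E_v$ is the set of edges incident to $v$; $wf$ denotes the edge joining $w\in W$, $f\in F$. There are capacities $b:E\to\mathbb Z_+$ and quotas $q:W\to\mathbb Z_+$. $\mathcal B=\{x\in\mathbb Z_+^E: x\le b\}$; $\mathcal B_v$ is the set of restrictions of members of $\mathcal B$ to $E_v$; $x_v$ is the restriction of $x$ to $E_v$. For $z\ge 0$, $|z|=\sum_e z(e)$. $\wedge,\vee$ are coordinatewise min and max; $\mathbf 1^e$ is the unit vector of $e$; $\mathrm{supp}(z)=\{e: z(e)\neq 0\}$. Choice functions $C_v:\mathcal B_v\to\mathcal B_v$. Each $w\in W$ has a strict linear order $>_w$ on $E_w$ ($e>_w e'$: $e$ is preferred to $e'$), and $C_w(z)=z$ if $|z|\le q(w)$; if $|z|>q(w)$, number $E_w$ as $e_1>_we_2>_w\cdots$, take the maximal $j$ with $r:=\sum_{i\le j}z(e_i)\le q(w)$ and let $C_w(z)=(z(e_1),\ldots,z(e_j),q(w)-r,0,\ldots,0)$.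 Each $f\in F$ has a $C_f$ with $C_f(z)\le z$ such that for all $z\ge z'$ in $\mathcal B_f$: (A1) $z'\ge C_f(z)$ implies $C_f(z')=C_f(z)$; (A2) $C_f(z)\wedge z'\le C_f(z')$; (A3) $|C_f(z)|\ge|C_f(z')|$. $\mathcal A_v=\{z\in\mathcal B_v: C_v(z)=z\}$ (acceptable). For distinct $z,z'\in\mathcal A_v$: $z'\prec_v z$ iff $C_v(z\vee z')=z$. A g-allocation is $x\in\mathcal B$ with $x_v\in\mathcal A_v$ for all $v\in V$. For distinct g-allocations, $x\prec_F y$ iff $x_f\preceq_f y_f$ for all $f\in F$. For $z\in\mathcal A_v$, $e\in E_v$ is interesting for $v$ under $z$ if there is $z'\in\mathcal B_v$ with $z'(e)>z(e)$, $z'(e')=z(e')$ for $e'\ne e$, and $C_v(z')(e)>z(e)$; ''interesting for $v$ under $x$'' means under $x_v$. An edge $wf$ blocks $x$ if it is interesting under $x$ for both $w$ and $f$. A g-allocation is stable if no edge blocks it; $\mathcal S$ is the set of stable g-allocations. It is known that $(\mathcal S,\prec_F)$ is a nonempty distributive lattice (with minimal and maximal elements $x^{\min},x^{\max}$), that $x\prec_F y$ in $\mathcal S$ implies $C_w(x_w\vee y_w)=x_w$ for all $w\in W$, and that $|x_v|$ is the same for all $x\in\mathcal S$, for each $v\in V$. Rotations. Let $x\in\mathcal S$ and $W^==\{w\in W:|x_w|=q(w)\}$. For $w\in W^=$ let $\ell_w(x)$ be the least preferred edge (under $>_w$) of $\mathrm{supp}(x_w)$. The most preferred edge (if any) among the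 edges $e=wf\in E_w$ with $e\le_w\ell_w(x)$ and $e$ interesting for $f$ under $x$ is called $W$-admissible and denoted $a_w(x)$ (there is none if $x_w=0$). For a $W$-admissible $a=wf$, $C_f(x_f+\mathbf 1^a)$ equals $x_f+\mathbf 1^a$ or $x_f+\mathbf 1^a-\mathbf 1^c$ for some $c\in E_f\setminus\{a\}$; in the latter case $c$ is called $F$-admissible, associated with $a$, and $(a,c)$ is a tandem for $x$ passing $f$. $D(x)$ is the directed graph on $V$ whose edges are the $W$-admissible edges directed from $W$ to $F$ and the $F$-admissible edges directed from $F$ to $W$. Cleaning: while some $w\in W$ has a leaving edge $a=(w,f)$ but no entering edge, delete $a$, and also delete the edge $c$ associated with $a$ (if exists) when $c$ is in no other tandem passing $f$ in the current graph; remove isolated vertices. The final graph is the active graph $\Gamma(x)$. In it each vertex of $W$ has exactly one entering and one leaving edge, and at each vertex $f\in F$ the tandems passing $f$ are edge-disjoint and partition the edges of $\Gamma(x)$ at $f$. Hence $\Gamma(x)$ decomposes uniquely into edge-disjoint directed edge-simple cycles in which consecutive edges at each $f\in F$ form a tandem; these cycles are the rotations generated by (applicable to) $x$, and $\mathcal L(x)$ is their set. Rotations for different $x$ are compared as directed cycles (cyclic edge sequences). For a rotation $L$, $L^+$ (resp. $L^-$) is the set of its edges directed from $W$ to $F$ (resp. from $F$ to $W$), identified with the underlying edges of $G$. $\chi^A\in\mathbb R^E$ is the 0/1 incidence vector of $A\subseteq E$. Weights and routes. $\lambda\in\mathbb Z_{>0}$ is feasible for $L\in\mathcal L(x)$ if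 $\lambda\le x(e)$ for all $e\in L^-$, $\lambda\le b(e)-x(e)$ for all $e\in L^+$, and $C_f(x_f+\lambda\mathbf 1^a)=x_f+\lambda\mathbf 1^a-\lambda\mathbf 1^c$ for each $f\in F$ and each tandem $(a,c)$ in $L$ passing $f$. A full route is a sequence $x^{\min}=x^1,x^2,\ldots,x^N=x^{\max}$ in $\mathcal S$ where $x^{i+1}=x^i+\lambda_i(\chi^{L^{i+}}-\chi^{L^{i-}})$ for some $L^i\in\mathcal L(x^i)$ and $\lambda_i$ is the maximal feasible weight for $L^i$ at $x^i$; the rotations $L^i$ are used in it with weights $\lambda_i$. Gapless condition (C). For $f\in F$ and $z\in\mathcal A_f$, a pair $(a,c)$ in $E_f$ is an (abstract) tandem for $z$ if $z(a)<b(a)$, $z(c)>0$ and $C_f(z+\mathbf 1^a)=z+\mathbf 1^a-\mathbf 1^c$. Condition (C): for each $f\in F$, if $z^1,z^2,z^3\in\mathcal A_f$ and $a,c^1,c^2,c^3\in E_f$ are such that $z^1\prec_f z^2\prec_f z^3$, $(a,c^i)$ is a tandem for $z^i$ ($i=1,2,3$), and $c^1=c^3$, then $c^1=c^2$. Poset of rotations (under (C)). Under (C) each rotation is used at most once in a full route, and the set of pairs (rotation, weight) used is the same for all full routes. $\mathcal R$ is the set of rotations used in a full route, $\tau_L$ is the weight with which $L\in\mathcal R$ is used, and $L\lessdot L'$ iff in all full routes $L$ is used earlier than $L'$. $H=(\mathcal R,\mathcal E)$ is the Hasse diagram of $(\mathcal R,\lessdot)$: $\mathcal E$ is the set of pairs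 $(L,L')$ such that $L\lessdot L'$ and no $L''\in\mathcal R$ satisfies $L\lessdot L''\lessdot L'$. Computation model. $b^{\max}=\max_{e\in E}b(e)$. Each $C_f$ is given by an oracle which, asked of $z\in\mathcal B_f$, outputs $C_f(z)$; one oracle call takes time $O(1)$. Time counts standard logical and arithmetical operations with numbers of binary size $O(\log(|E|b^{\max}))$ and oracle calls. $\log b^{\max}$ is understood as at least 1. *)

(* Defs.v *)
From mathcomp Require Import all_boot.

Set Implicit Arguments.
Unset Strict Implicit.
Unset Printing Implicit Defensive.

(* * Markets *)

Record market := Market {
  worker : finType;
  firm : finType;
  edge : finType;
  wend : edge -> worker;
  fend : edge -> firm;
  cap : edge -> nat;
  quota : worker -> nat;
  (* [pref w e e'] is [e >_w e'], meaningful on the edges at [w] only *)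
  pref : worker -> rel edge;
  fchoice : firm -> {ffun edge -> nat} -> {ffun edge -> nat}
}.

Definition vertex (M : market) : finType := (worker M + firm M)%type.

Definition incident (M : market) (v : vertex M) (e : edge M) : bool :=
  match v with inl w => wend e == w | inr f => fend e == f end.

Definition adjacent (M : market) : rel (vertex M) := fun u v =>
  [exists e, [&& u != v, incident u e & incident v e]].

(* A vector on [E_v] is encoded as a vector on [E] that vanishes outside
   [E_v]; [inB v] singles out these encodings of the members of [B_v]. *)
Definition vec (M : market) := {ffun edge M -> nat}.

Definition restr (M : market) (v : vertex M) (x : vec M) : vec M :=
  [ffun e => if incident v e then x e else 0].

Definition inB (M : market) (v : vertex M) (z : vec M) : bool :=
  [forall e, z e <= (if incident v e then cap e else 0)].

Definition vle (M : market) (z z' : vec M) : bool := [forall e, z e <= z' e].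

Definition vmin (M : market) (z z' : vec M) : vec M :=
  [ffun e => minn (z e) (z' e)].

Definition vmax (M : market) (z z' : vec M) : vec M :=
  [ffun e => maxn (z e) (z' e)].

Definition vnorm (M : market) (z : vec M) : nat := \sum_e z e.

(* z + k 1^e *)
Definition vadd (M : market) (z : vec M) (e : edge M) (k : nat) : vec M :=
  [ffun e' => if e' == e then z e' + k else z e'].

(* The edges of [E_w] up to [e] in decreasing preference are
   [e_1, ..., e_i = e]; thus [i <= j] iff [z e_1 + ... + z e_i <= q w], and
   [i = j + 1] iff this fails while [r = z e_1 + ... + z e_(i-1) <= q w]. *)
Definition wchoice (M : market) (w : worker M) (z : vec M) : vec M :=
  let before e := \sum_(e' | (wend e' == w) && pref w e' e) z e' in
  let upto e := \sum_(e' | (wend e' == w) && ((e' == e) || pref w e' e)) z e' in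
  if vnorm z <= quota w then z
  else [ffun e =>
          if wend e != w then 0
          else if upto e <= quota w then z e
          else if before e <= quota w then quota w - before e
          else 0].

Definition choice (M : market) (v : vertex M) : vec M -> vec M :=
  match v with inl w => wchoice w | inr f => fchoice f end.

Record market_axioms (M : market) : Prop := MarketAxioms {
  no_multiple_edges : injective (fun e : edge M => (wend e, fend e));
  connected : forall u v : vertex M, connect (@adjacent M) u v;
  pref_irr : forall (w : worker M) (e : edge M), wend e = w -> ~~ pref w e e;
  pref_trans : forall (w : worker M) (e e' e'' : edge M),
    wend e = w -> wend e' = w -> wend e'' = w ->
    pref w e e' -> pref w e' e'' -> pref w e e'';
  pref_total : forall (w : worker M) (e e' : edge M),
    wend e = w -> wend e' = w -> e != e' -> pref w e e' || pref w e' e;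
  fchoice_le : forall (f : firm M) (z : vec M),
    inB (inr f) z -> vle (fchoice f z) z;
  fchoice_A1 : forall (f : firm M) (z z' : vec M),
    inB (inr f) z -> inB (inr f) z' -> vle z' z ->
    vle (fchoice f z) z' -> fchoice f z' = fchoice f z;
  fchoice_A2 : forall (f : firm M) (z z' : vec M),
    inB (inr f) z -> inB (inr f) z' -> vle z' z ->
    vle (vmin (fchoice f z) z') (fchoice f z');
  fchoice_A3 : forall (f : firm M) (z z' : vec M),
    inB (inr f) z -> inB (inr f) z' -> vle z' z ->
    vnorm (fchoice f z') <= vnorm (fchoice f z)
}.

(* * Stable g-allocations *)

Definition acceptable (M : market) (v : vertex M) (z : vec M) : bool :=
  inB v z && (choice v z == z).

Definition vprec (M : market) (v : vertex M) (z' z : vec M) : bool :=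
  [&& acceptable v z', acceptable v z, z' != z & choice v (vmax z z') == z].

Definition g_alloc (M : market) (x : vec M) : bool :=
  [forall e, x e <= cap e] && [forall v : vertex M, acceptable v (restr v x)].

Definition fprec (M : market) (x y : vec M) : bool :=
  [&& g_alloc x, g_alloc y, x != y &
   [forall f : firm M, (restr (inr f) x == restr (inr f) y)
      || vprec (inr f) (restr (inr f) x) (restr (inr f) y)]].

(* The vector z' in the definition is determined by its value at [e], which
   ranges over [0, ..., cap e]. *)
Definition interesting (M : market) (v : vertex M) (z : vec M) (e : edge M) :
    bool :=
  incident v e &&
  [exists k : 'I_(cap e).+1,
     let z' := [ffun e' => if e' == e then nat_of_ord k else z e'] : vec M in
     [&& inB v z', z e < z' e & z e < choice v z' e]].

Definition blocks (M : market) (x : vec M) (e : edge M) : bool :=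
  interesting (inl (wend e)) (restr (inl (wend e)) x) e &&
  interesting (inr (fend e)) (restr (inr (fend e)) x) e.

Definition stable (M : market) (x : vec M) : bool :=
  g_alloc x && [forall e, ~~ blocks x e].

Definition is_min_stable (M : market) (x : vec M) : Prop :=
  stable x /\ forall y : vec M, stable y -> x = y \/ fprec x y.

Definition is_max_stable (M : market) (x : vec M) : Prop :=
  stable x /\ forall y : vec M, stable y -> y = x \/ fprec y x.

(* * Rotations *)

Definition is_last (M : market) (x : vec M) (w : worker M) (l : edge M) :
    bool :=
  [&& wend l == w, x l != 0 &
   [forall e, [&& wend e == w, x e != 0 & e != l] ==> pref w e l]].

Definition W_candidate (M : market) (x : vec M) (w : worker M) (e : edge M) :
    bool :=
  [&& wend e == w,
      vnorm (restr (inl w) x) == quota w,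
      [exists l, is_last x w l && ((e == l) || pref w l e)] &
      interesting (inr (fend e)) (restr (inr (fend e)) x) e].

Definition W_admissible (M : market) (x : vec M) (a : edge M) : bool :=
  W_candidate x (wend a) a &&
  [forall e, W_candidate x (wend a) e && (e != a) ==> pref (wend a) a e].

(* The equation C_f(x_f + 1^a) = x_f + 1^a - 1^c is stated with 1^c moved to
   the left-hand side, because subtraction on nat is truncated.  The same is
   done in [feasible] and [abstract_tandem]. *)
Definition tandem (M : market) (x : vec M) (a c : edge M) : bool :=
  let f := fend a in
  let z := vadd (restr (inr f) x) a 1 in
  [&& W_admissible x a, fend c == f, c != a &
      vadd (fchoice f z) c 1 == z].

(* A directed graph on V is given by its edges directed from W to F and its
   edges directed from F to W; isolated vertices play no role. *)
Definition dgraph (M : market) : finType :=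
  ({set edge M} * {set edge M})%type.

Definition D_graph (M : market) (x : vec M) : dgraph M :=
  ([set a | W_admissible x a], [set c | [exists a, tandem x a c]]).

Definition clean_step (M : market) (x : vec M) : rel (dgraph M) := fun G G' =>
  [exists a, [&& a \in G.1,
                 [forall c in G.2, wend c != wend a] &
                 G' == (G.1 :\ a,
                        G.2 :\: [set c | tandem x a c &&
                           ~~ [exists a' in G.1, (a' != a) && tandem x a' c]])]].

Definition is_active_graph (M : market) (x : vec M) (G : dgraph M) : bool :=
  connect (clean_step x) (D_graph x) G && ~~ [exists G', clean_step x G G'].

(* A directed cycle a_1, c_1, ..., a_k, c_k with a_i directed from W to F and
   c_i from F to W is written as the sequence of the pairs (a_i, c_i), up to
   cyclic shifts. *)
Definition dcycle (M : market) := seq (edge M * edge M).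

Definition same_cycle (M : market) (L L' : dcycle M) : Prop :=
  exists n, L' = rot n L.

Definition plus_edges (M : market) (L : dcycle M) : seq (edge M) :=
  [seq p.1 | p <- L].

Definition minus_edges (M : market) (L : dcycle M) : seq (edge M) :=
  [seq p.2 | p <- L].

Definition tandem_cycle (M : market) (x : vec M) (L : dcycle M) : bool :=
  [&& L != [::], all (fun p => tandem x p.1 p.2) L &
      cycle (fun p p' => wend p.2 == wend p'.1) L].

Definition decomposes (M : market) (x : vec M) (G : dgraph M)
    (Ls : seq (dcycle M)) : bool :=
  [&& all (tandem_cycle x) Ls,
      perm_eq (flatten (map (@plus_edges M) Ls)) (enum G.1) &
      perm_eq (flatten (map (@minus_edges M) Ls)) (enum G.2)].

Definition rotation_at (M : market) (x : vec M) (L : dcycle M) : Prop :=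
  exists (G : dgraph M) (Ls : seq (dcycle M)),
    [/\ is_active_graph x G, decomposes x G Ls & L \in Ls].

Definition feasible (M : market) (x : vec M) (L : dcycle M) (t : nat) : bool :=
  [&& 0 < t,
      all (fun e => t <= x e) (minus_edges L),
      all (fun e => t <= cap e - x e) (plus_edges L) &
      all (fun p => let f := fend p.1 in
                    let z := vadd (restr (inr f) x) p.1 t in
                    vadd (fchoice f z) p.2 t == z) L].

Definition max_feasible (M : market) (x : vec M) (L : dcycle M) (t : nat) :
    Prop :=
  feasible x L t /\ forall t', feasible x L t' -> t' <= t.

Definition shift (M : market) (x : vec M) (L : dcycle M) (t : nat) : vec M :=
  [ffun e => x e + t * (e \in plus_edges L) - t * (e \in minus_edges L)].

(* * Full routes and the poset of rotations *)

Inductive route (M : market) :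
    vec M -> seq (dcycle M * nat) -> vec M -> Prop :=
| route_nil x : stable x -> route x [::] x
| route_cons x L t s y :
    stable x -> rotation_at x L -> max_feasible x L t ->
    route (shift x L t) s y -> route x ((L, t) :: s) y.

Definition full_route (M : market) (s : seq (dcycle M * nat)) : Prop :=
  exists x y : vec M, [/\ is_min_stable x, is_max_stable y & route x s y].

Definition used_in (M : market) (L : dcycle M) (t : nat)
    (s : seq (dcycle M * nat)) : Prop :=
  exists2 p, p \in s & same_cycle L p.1 /\ t = p.2.

(* L is in R and tau_L = t *)
Definition rotation_weight (M : market) (L : dcycle M) (t : nat) : Prop :=
  exists2 s, full_route s & used_in L t s.

Definition in_R (M : market) (L : dcycle M) : Prop :=
  exists t, rotation_weight L t.

Definition earlier (M : market) (L L' : dcycle M)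
    (s : seq (dcycle M * nat)) : Prop :=
  exists i j, [/\ i < j < size s,
    same_cycle L (nth ([::], 0) s i).1 & same_cycle L' (nth ([::], 0) s j).1].

Definition rot_lt (M : market) (L L' : dcycle M) : Prop :=
  [/\ in_R L, in_R L' & forall s, full_route s -> earlier L L' s].

Definition hasse (M : market) (L L' : dcycle M) : Prop :=
  rot_lt L L' /\ ~ (exists L'', rot_lt L L'' /\ rot_lt L'' L').

(* * The gapless condition *)

Definition abstract_tandem (M : market) (f : firm M) (z : vec M)
    (a c : edge M) : bool :=
  [&& fend a == f, fend c == f, z a < cap a, 0 < z c &
      vadd (fchoice f (vadd z a 1)) c 1 == vadd z a 1].

Definition gapless (M : market) : Prop :=
  forall (f : firm M) (z1 z2 z3 : vec M) (a c1 c2 c3 : edge M),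
    acceptable (inr f) z1 -> acceptable (inr f) z2 -> acceptable (inr f) z3 ->
    vprec (inr f) z1 z2 -> vprec (inr f) z2 z3 ->
    abstract_tandem f z1 a c1 -> abstract_tandem f z2 a c2 ->
    abstract_tandem f z3 a c3 ->
    c1 = c3 -> c1 = c2.

(* * Oracle programs

   A unit-cost random access machine with a structured control flow.  The
   memory consists of arrays numbered by nat; [s a i] is the content of cell
   [i] of array [a].  An execution gets stuck as soon as an arithmetic or
   logical operation yields a value not smaller than [bnd], which is how the
   size of the numbers is controlled. *)

Definition state := nat -> nat -> nat.

Inductive binop := Add | Sub | Mul | Div | Mod | Eq | Lt | And | Or.

Definition apply_op (o : binop) (m n : nat) : nat :=
  match o with
  | Add => m + n
  | Sub => m - n
  | Mul => m * n
  | Div => m %/ n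
  | Mod => m %% n
  | Eq => m == n
  | Lt => m < n
  | And => (m != 0) && (n != 0)
  | Or => (m != 0) || (n != 0)
  end.

Inductive expr :=
| Const of nat
| Get of nat & expr
| Op of binop & expr & expr.

Fixpoint eval (s : state) (e : expr) : nat :=
  match e with
  | Const n => n
  | Get a i => s a (eval s i)
  | Op o e1 e2 => apply_op o (eval s e1) (eval s e2)
  end.

Fixpoint fits (bnd : nat) (s : state) (e : expr) : bool :=
  match e with
  | Const _ => true
  | Get _ i => fits bnd s i
  | Op o e1 e2 => [&& fits bnd s e1, fits bnd s e2 & eval s e < bnd]
  end.

Fixpoint cost (e : expr) : nat :=
  match e with
  | Const _ => 1
  | Get _ i => (cost i).+1
  | Op _ e1 e2 => (cost e1 + cost e2).+1
  end.

(* [Put a i e] stores [e] in cell [i] of array [a]; [Ask f a r] calls the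
   oracle of the firm numbered [f] on the vector held by array [a] and lets it
   write its answer in array [r]. *)
Inductive cmd :=
| Skip
| Put of nat & expr & expr
| Seq of cmd & cmd
| If of expr & cmd & cmd
| While of expr & cmd
| Ask of expr & nat & nat.

Definition set_array (s : state) (a : nat) (A : nat -> nat) : state :=
  fun a' => if a' == a then A else s a'.

Definition set_cell (s : state) (a i n : nat) : state :=
  set_array s a (fun i' => if i' == i then n else s a i').

(* An oracle takes the number of a firm, the query array and the array to be
   updated, and returns the updated array; [None] is an illegal query. *)
Definition oracle := nat -> (nat -> nat) -> (nat -> nat) -> option (nat -> nat).

(* [exec O bnd c s s' t]: started in [s], [c] stops in [s'] after time [t]. *)
Inductive exec (O : oracle) (bnd : nat) : cmd -> state -> state -> nat -> Prop :=
| exec_skip s : exec O bnd Skip s s 1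
| exec_put a i e s :
    fits bnd s i -> fits bnd s e ->
    exec O bnd (Put a i e) s (set_cell s a (eval s i) (eval s e))
      (cost i + cost e).+1
| exec_seq c1 c2 s s1 s2 t1 t2 :
    exec O bnd c1 s s1 t1 -> exec O bnd c2 s1 s2 t2 ->
    exec O bnd (Seq c1 c2) s s2 (t1 + t2)
| exec_if e c1 c2 s s' t :
    fits bnd s e ->
    exec O bnd (if eval s e != 0 then c1 else c2) s s' t ->
    exec O bnd (If e c1 c2) s s' (cost e + t).+1
| exec_while_stop e c s :
    fits bnd s e -> eval s e = 0 ->
    exec O bnd (While e c) s s (cost e).+1
| exec_while_loop e c s s1 s2 t1 t2 :
    fits bnd s e -> eval s e != 0 ->
    exec O bnd c s s1 t1 -> exec O bnd (While e c) s1 s2 t2 ->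
    exec O bnd (While e c) s s2 (cost e + t1 + t2).+1
| exec_ask e a r s A :
    fits bnd s e -> O (eval s e) (s a) (s r) = Some A ->
    exec O bnd (Ask e a r) s (set_array s r A) (cost e).+1.

(* * Encoding of the input and the output

   Workers, firms and edges are numbered by their position in [enum]. *)

Definition num (T : finType) (u : T) : nat := enum_rank u.

(* Only the cells of the edges of [E_f] are read and written. *)
Definition market_oracle (M : market) : oracle := fun k A R =>
  if onth (enum (firm M)) k is Some f then
    let z := [ffun e => if fend e == f then A (num e) else 0] : vec M in
    if inB (inr f) z then
      Some (fun i =>
        if onth (enum (edge M)) i is Some e then
          if fend e == f then fchoice f z e else R i
        else R i)
    else None
  else None.

(* The order >_w is given by the positions of the edges of [E_w] in it. *)
Definition pref_position (M : market) (e : edge M) : nat :=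
  #|[set e' | (wend e' == wend e) && pref (wend e) e' e]|.

Definition input (M : market) (x : vec M) : state := fun a i =>
  nth 0 (nth [::]
    [:: [:: #|worker M|; #|firm M|; #|edge M|];
        [seq num (wend e) | e <- enum (edge M)];
        [seq num (fend e) | e <- enum (edge M)];
        [seq cap e | e <- enum (edge M)];
        [seq quota w | w <- enum (worker M)];
        [seq pref_position e | e <- enum (edge M)];
        [seq x e | e <- enum (edge M)]] a) i.

(* The number n of rotations is in cell 0 of array 7.  For k < n, the length
   of the k-th rotation (counted in tandems) and its weight are in cell k of
   arrays 8 and 9, its edges a_i and c_i are in cell k |E| + i of arrays 10 and
   11, and cell k n + l of array 12 tells whether (k, l) is an edge of H. *)
Definition stored_rotation (M : market) (s : state) (k : nat)
    (L : dcycle M) : Prop :=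
  s 8 k = size L /\
  forall i p, onth L i = Some p ->
    s 10 (k * #|edge M| + i) = num p.1 /\ s 11 (k * #|edge M| + i) = num p.2.

Definition correct_output (M : market) (s : state) : Prop :=
  exists rots : seq (dcycle M),
  let n := size rots in
  let L k := nth [::] rots k in
  [/\ s 7 0 = n,
      forall k, k < n -> stored_rotation s k (L k),
      forall k l, k < n -> l < n -> same_cycle (L k) (L l) -> k = l,
      forall L' t, rotation_weight L' t <->
        exists2 k, k < n & same_cycle L' (L k) /\ t = s 9 k &
      forall k l, k < n -> l < n ->
        (s 12 (k * n + l) != 0 <-> hasse (L k) (L l))].

(* * Size parameters *)

Definition log_bmax (M : market) : nat :=
  maxn 1 (trunc_log 2 (\max_(e : edge M) cap e)).

Definition poly_bound (K : nat) (M : market) : nat :=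
  K * (#|vertex M| + #|edge M|).+1 ^ K.

(* The least number whose binary size exceeds K (log |E| + log b^max). *)
Definition size_bound (K : nat) (M : market) : nat :=
  2 ^ (K * (trunc_log 2 #|edge M| + log_bmax M)).

(* Main.v *)
Require Import Defs.
From mathcomp Require Import all_boot zify.
From Stdlib Require Import Classical.

(** A g-allocation can be improved for the firms along a cycle of tandems.
    Every worker [w] has at most one admissible edge [a], and [a] determines the
    edge [c] that the firm gives up for it, so the tandems form the graph of a
    partial function on workers and the active graph is the union of its simple
    cycles ([rotation_atP]).

    The behaviour of a firm is governed by the relation [better], which the
    axioms (A1) and (A2) make a partial order on acceptable vectors, and by
    [good_comb]: improvements that keep the total of the firm and change
    disjoint sets of edges can be added.  A rotation is a set of such
    improvements, hence shifting along it is an improvement for all firms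
    ([shift_good]); it preserves stability because every worker receives its
    best candidate ([shift_stable]).  Conversely, if [x] is stable and some
    stable [y] offers the firms more, the workers that gain and lose in the join
    of [x] and [y] can be followed along tandems, so that there is a rotation
    ([rotation_of_improvement]).  Thus a stable [x] without rotations is
    maximal, and full routes are exactly the maximal sequences of shifts.

    Condition (C) enters twice, both times through [gapless_extend].  After the
    use of a rotation with maximal weight one of its tandems never occurs again
    ([max_feasible_dead]): the interest of a firm in an edge, once lost, is not
    regained, and (C) excludes that a firm returns to an exchange that it has
    replaced by another one.  So a rotation is used at most once and a route
    has at most [|E|^2] steps.  Moreover two rotations applicable at the same
    [x] commute and do not affect each other's maximal weight
    ([max_feasible_after]).  This diamond property makes all maximal routes use
    the same rotations with the same weights ([route_in_confluent]), even when
    only the rotations of a given class are admitted.  Therefore [K] precedes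
    [L] in all full routes iff [L] is not used on a route that avoids [K] as
    long as possible ([rot_ltP]), and the order is decided by following one such
    route for each [K].

    The program does just this.  It computes the tandems by asking the oracles,
    finds a cycle of the successor function by iterating it, determines the
    maximal weight by bisection, which is where the factor [log b^max] comes
    from, and repeats this [|E|^2 + 1] times.  Programs are written in a
    language with counted loops, whose running time [duration] is a syntactic
    function of bounds on the number of rounds and is polynomial by
    [duration_poly]; the rules for [runs] establish termination, the time bound
    and the result together. *)

Set Implicit Arguments.
Unset Strict Implicit.
Unset Printing Implicit Defensive.

#[local] Notation xf f x := (restr (inr f) x).
#[local] Notation xw w x := (restr (inl w) x).

(** * Vectors on the edges *)

Section Vectors.

Variable M : market.
Implicit Types (e a c : edge M) (u v y z : vec M).

Lemma vleP u v : reflect (forall e, u e <= v e) (vle u v).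
Proof. exact: forallP. Qed.

Lemma vaddE z a k e : vadd z a k e = if e == a then z e + k else z e.
Proof. exact: ffunE. Qed.

Lemma vmaxE u v e : vmax u v e = maxn (u e) (v e).
Proof. exact: ffunE. Qed.

Lemma vle_vadd z a k : vle z (vadd z a k).
Proof. by apply/vleP => e; rewrite vaddE; case: eqP; lia. Qed.

Lemma vle_vadd2 u v a k : vle u v -> vle (vadd u a k) (vadd v a k).
Proof.
by move/vleP => uv; apply/vleP => e; rewrite !vaddE; case: eqP; rewrite ?leq_add2r.
Qed.

Lemma vle_maxl u v : vle u (vmax u v).
Proof. by apply/vleP => e; rewrite vmaxE leq_maxl. Qed.

Lemma vle_maxr u v : vle v (vmax u v).
Proof. by apply/vleP => e; rewrite vmaxE leq_maxr. Qed.

Lemma vle_vadd1_max z y a : z a < y a -> vle (vadd z a 1) (vmax z y).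
Proof.
by move=> lt_a; apply/vleP => e; rewrite vaddE vmaxE; case: eqP => [->|]; lia.
Qed.

Lemma vadd1_max z y a : y a <= z a ->
  vadd (vmax z y) a 1 = vmax (vadd z a 1) y.
Proof.
move=> le_a; apply/ffunP => e; rewrite vaddE !vmaxE vaddE.
by case: eqP => [->|_]; lia.
Qed.

Lemma vle_norm u v : vle u v -> vnorm u <= vnorm v.
Proof. by move/vleP=> uv; apply: leq_sum => e _. Qed.

Lemma vle_norm_eq u v : vle u v -> vnorm v <= vnorm u -> u = v.
Proof.
move=> /vleP uv nvu; apply/ffunP => e; apply/eqP; rewrite eqn_leq uv leqNgt.
apply/negP => lt_uv; move: nvu; apply/negP; rewrite -ltnNge /vnorm.
rewrite (bigD1 e) //= [X in _ < X](bigD1 e) //=.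
by rewrite -addSn leq_add // leq_sum.
Qed.

Lemma vnorm_vadd z e k : vnorm (vadd z e k) = vnorm z + k.
Proof.
rewrite /vnorm (bigD1 e) //= [in RHS](bigD1 e) //= ffunE eqxx.
rewrite addnAC; congr (_ + _ + _).
by apply: eq_bigr => e' /negbTE ne; rewrite ffunE ne.
Qed.

Lemma vnorm_lt u v : vnorm u < vnorm v -> exists e, u e < v e.
Proof.
move=> lt_uv; have [/forallP le_vu|] := boolP [forall e, v e <= u e].
  by move: lt_uv; rewrite ltnNge vle_norm //; apply/vleP.
by rewrite negb_forall => /existsP[e]; rewrite -ltnNge; exists e.
Qed.

Lemma vle_norm_succ u v : vle u v -> vnorm v = (vnorm u).+1 ->
  exists c, vadd u c 1 = v.
Proof.
move=> /vleP uv nv; have [c uc] : exists c, u c < v c.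
  by apply: vnorm_lt; rewrite nv.
exists c; apply: vle_norm_eq; last by rewrite vnorm_vadd nv addn1.
by apply/vleP => e; rewrite ffunE; case: eqP => [->|]; rewrite ?addn1.
Qed.

End Vectors.

(** * The choice functions of the firms *)

Section FirmChoice.

Variables (M : market) (ax : market_axioms M) (f : firm M).
Implicit Types (e a c : edge M) (u v x y z : vec M).

Notation C := (fchoice f).
Notation B := (@inB M (inr f)).

Lemma inB_vle u v : B v -> vle u v -> B u.
Proof.
move=> /forallP Bv /vleP uv; apply/forallP => e.
exact: leq_trans (uv e) (Bv e).
Qed.

Lemma inB_vmax u v : B u -> B v -> B (vmax u v).
Proof.
move=> /forallP Bu /forallP Bv; apply/forallP => e.
by rewrite ffunE geq_max Bu Bv.
Qed.

Lemma inB_vadd z a k : B z -> fend a = f -> z a + k <= cap a ->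
  B (vadd z a k).
Proof.
move=> /forallP Bz fa le_cap; apply/forallP => e; rewrite ffunE.
by case: eqP => [->|_]; [rewrite /= fa eqxx | exact: Bz].
Qed.

Lemma inB_out z e : B z -> fend e != f -> z e = 0.
Proof.
by move=> /forallP/(_ e) /=; case: eqP => // _; rewrite leqn0 => /eqP.
Qed.

Lemma C_le z : B z -> vle (C z) z. Proof. exact: fchoice_le. Qed.

Lemma C_leE z e : B z -> C z e <= z e.
Proof. by move/C_le/vleP. Qed.

Lemma inB_C z : B z -> B (C z).
Proof. by move=> Bz; apply: inB_vle (C_le Bz). Qed.

Lemma C_cons z z' : B z -> vle z' z -> vle (C z) z' -> C z' = C z.
Proof. by move=> Bz z'z; apply: (fchoice_A1 ax) => //; apply: inB_vle z'z. Qed.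

Lemma C_subst z z' e : B z -> vle z' z -> minn (C z e) (z' e) <= C z' e.
Proof.
move=> Bz z'z.
have := fchoice_A2 ax Bz (inB_vle Bz z'z) z'z.
by move/vleP/(_ e); rewrite ffunE.
Qed.

Lemma C_size z z' : B z -> vle z' z -> vnorm (C z') <= vnorm (C z).
Proof. by move=> Bz z'z; apply: (fchoice_A3 ax) => //; apply: inB_vle z'z. Qed.

Lemma C_idem z : B z -> C (C z) = C z.
Proof. by move=> Bz; apply: C_cons => //; [apply: C_le | apply/vleP]. Qed.

(** Between acceptable vectors this is the reflexive closure of [vprec]. *)
Definition better z v := [/\ B z, B v & C (vmax z v) = v].

Lemma better_acc z v : better z v -> C v = v.
Proof. by case=> Bz Bv E; rewrite -{1}E C_idem // inB_vmax. Qed.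

Lemma better_refl z : B z -> C z = z -> better z z.
Proof.
move=> Bz Cz; split=> //; rewrite -[RHS]Cz; congr (fchoice f _).
by apply/ffunP => e; rewrite ffunE maxnn.
Qed.

Lemma better_anti z v : better z v -> better v z -> z = v.
Proof.
move=> [_ _ E1] [_ _ E2]; have E : vmax z v = vmax v z.
  by apply/ffunP => e; rewrite !ffunE maxnC.
by rewrite -[LHS]E2 -E E1.
Qed.

(** By (A1), what is chosen from a bigger offer [u] is chosen from anything
    between that choice and [u]. *)
Lemma better_of u z v : B u -> vle z u -> C u = v -> better z v.
Proof.
move=> Bu zu Cu; have Bv : B v by rewrite -Cu inB_C.
split=> //; first exact: inB_vle zu.
have vu : vle v u by rewrite -Cu; apply: C_le.
rewrite -[RHS]Cu; apply: C_cons => //; last by rewrite Cu vle_maxr.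
apply/vleP => e; rewrite ffunE geq_max.
by rewrite (vleP _ _ zu) (vleP _ _ vu).
Qed.

(** Offered [x], [y] and [z] at once, the firm takes no more of [x] than it takes
    in the presence of [y], by (A2), that is, nothing beyond [y]; so by (A1) its
    choice is that from [y] and [z]. *)
Lemma better_trans y x z : better x y -> better y z -> better x z.
Proof.
move=> [Bx By Exy] [_ Bz Eyz].
have Bu : B (vmax (vmax x y) z) by rewrite !inB_vmax.
apply: (better_of Bu).
  by apply/vleP => e; rewrite !ffunE; lia.
have E : C (vmax y z) = C (vmax (vmax x y) z).
  apply: C_cons => //; first by apply/vleP => e; rewrite !ffunE; lia.
  apply/vleP => e; have := C_subst e Bu (vle_maxl (vmax x y) z).
  have := C_leE e Bu; rewrite Exy !ffunE; lia.
by rewrite -E.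
Qed.

(** Why [z] is attracted by what attracts the better vector [y].  From the offer
    [u] above [z + 1^e] the firm takes more than [z e] units of [e], and (A2)
    brings this down to [z + 1^e].  If [y] has more of [e] than [z], then [u] is
    the join of [z] and [y]; otherwise it is this join with one more unit.  The
    last clause gives the size of what is taken. *)
Lemma better_offer z y e : better z y -> z e <= y e -> B (vadd y e 1) ->
    y e < C (vadd y e 1) e ->
  exists u, [/\ B u, vle (vadd z e 1) u, z e < C u e &
    C u = y \/ C u = C (vadd y e 1)].
Proof.
move=> [Bz By E] zy By1 int.
have [lt_zy|ge_zy] := ltnP (z e) (y e).
  exists (vmax z y); split; [exact: inB_vmax| |by rewrite E|by left].
  by apply/vleP => e'; rewrite !ffunE; case: eqP => [->|]; lia.
have eq_zy : z e = y e by apply/eqP; rewrite eqn_leq zy.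
pose u := vadd (vmax z y) e 1.
have Bu : B u.
  suff -> : u = vmax (vadd y e 1) (vmax z y) by rewrite !inB_vmax.
  by apply/ffunP => e'; rewrite !ffunE; case: eqP => [->|]; lia.
have Cu : C u = C (vadd y e 1).
  symmetry; apply: C_cons => //.
    by apply/vleP => e'; rewrite !ffunE; case: eqP => [->|]; lia.
  apply/vleP => e'; have le1 : vle (vmax z y) u.
    by apply/vleP => e''; rewrite !ffunE; case: eqP => [->|]; lia.
  have := C_subst e' Bu le1; have := C_leE e' Bu.
  by rewrite E !ffunE; case: eqP => [->|_]; lia.
exists u; split=> //; last by right.
  by apply/vleP => e'; rewrite !ffunE; case: eqP => [->|]; lia.
by rewrite Cu eq_zy.
Qed.

Lemma better_keep z y e : better z y -> z e <= y e -> B (vadd y e 1) ->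
  y e < C (vadd y e 1) e -> z e < C (vadd z e 1) e.
Proof.
move=> zy le_e By1 int; have [u [Bu zu ut _]] := better_offer zy le_e By1 int.
by have := C_subst e Bu zu; rewrite ffunE eqxx; lia.
Qed.

(** By (A3) the total of the firm does not fall either, so the choice lacks
    exactly one unit of the offer. *)
Lemma exchange z a : B z -> C z = z -> B (vadd z a 1) ->
    vnorm (C (vadd z a 1)) <= vnorm z -> z a < C (vadd z a 1) a ->
  exists c, [/\ fend c = f, c != a & vadd (C (vadd z a 1)) c 1 = vadd z a 1].
Proof.
move=> Bz Cz Bza size_le keep.
have size_ge : vnorm z <= vnorm (C (vadd z a 1)).
  rewrite -{1}Cz; apply: C_size => //.
  by apply/vleP => e; rewrite ffunE; case: eqP; lia.
have [|c Ec] := vle_norm_succ (C_le Bza).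
  by rewrite vnorm_vadd addn1; congr _.+1; apply/eqP; rewrite eqn_leq size_ge.
exists c; split=> //.
  apply/eqP; apply: contraT => fc.
  by move: (inB_out Bza fc); rewrite -Ec ffunE eqxx addn1.
apply/eqP => ca; move: (congr1 (fun v : vec M => v a) Ec).
by rewrite !ffunE ca eqxx; lia.
Qed.

(** Totals of firms are constant along routes, and under equal totals the
    inequalities supplied by (A2) become equalities. *)
Definition good z v := better z v /\ vnorm v = vnorm z.

Lemma good_refl z : B z -> C z = z -> good z z.
Proof. by move=> Bz Cz; split=> //; apply: better_refl. Qed.

Lemma good_trans y x z : good x y -> good y z -> good x z.
Proof.
move=> [xy nxy] [yz nyz]; split; first exact: better_trans yz.
by rewrite nyz.
Qed.

(** By (A3) the firm takes no more in total from [z + 1^a] than from the offer [u]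
    of [better_offer], and this total is that of [z].  The edge given up for [a]
    may differ from [c]; it is condition (C) that restricts this. *)
Lemma good_exchange z y a c : good z y -> C z = z -> z a <= y a ->
    B (vadd y a 1) -> c != a -> vadd (C (vadd y a 1)) c 1 = vadd y a 1 ->
  exists c', [/\ fend c' = f, c' != a & vadd (C (vadd z a 1)) c' 1 = vadd z a 1].
Proof.
move=> [zy nzy] Cz le_a By1 ca Ec.
have sz : vnorm (C (vadd y a 1)) = vnorm y.
  by move: (congr1 (@vnorm M) Ec); rewrite !vnorm_vadd => /addIn.
have keep : y a < C (vadd y a 1) a.
  move: (congr1 (fun v : vec M => v a) Ec).
  by rewrite !ffunE eqxx eq_sym (negbTE ca); lia.
have [u [Bu zu ut uE]] := better_offer zy le_a By1 keep.
apply: exchange => //; first by case: zy.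
- exact: inB_vle zu.
- by apply: leq_trans (C_size Bu zu) _; case: uE => ->; rewrite ?sz nzy.
by have := C_subst a Bu zu; rewrite ffunE eqxx; lia.
Qed.

(** By substitutability everything that one of the two improvements gives up is
    also given up when both are offered, and by the size axiom nothing else is.
    As they change disjoint sets of edges, the choice is their sum. *)
Lemma good_comb z v1 v2 : good z v1 -> good z v2 ->
    (forall e, v1 e = z e \/ v2 e = z e) -> C z = z ->
  let v : vec M := [ffun e => v1 e + v2 e - z e] in
  good z v /\ good v1 v.
Proof.
move=> [[Bz B1 E1] n1] [[_ B2 E2] n2] disj Cz v.
pose u := vmax (vmax z v1) v2.
have Bu : B u by rewrite !inB_vmax.
have nv : vnorm v = vnorm z.
  have : vnorm v + vnorm z = vnorm v1 + vnorm v2.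
    rewrite /vnorm -!big_split; apply: eq_bigr => e _ /=.
    by rewrite ffunE; case: (disj e) => ->; lia.
  by rewrite n1 n2 => /addIn.
have zv1u : vle (vmax z v1) u by apply: vle_maxl.
have zv2u : vle (vmax z v2) u by apply/vleP => e; rewrite !ffunE; lia.
have zu : vle z u by apply/vleP => e; rewrite !ffunE; lia.
have Cu : C u = v.
  apply: vle_norm_eq; last by rewrite nv -{1}Cz C_size.
  apply/vleP => e; have := C_subst e Bu zv1u; have := C_subst e Bu zv2u.
  have := C_leE e Bu; rewrite E1 E2 !ffunE; case: (disj e) => ->; lia.
have v1u : vle v1 u by apply/vleP => e; rewrite !ffunE; lia.
split; split; rewrite ?nv //; exact: better_of Cu.
Qed.

(** Outside [c] nothing is refused from the smaller offer, by (A2), and what is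
    refused altogether is [t'], by (A3). *)
Lemma C_exchange_downward z a c t t' : B z -> C z = z -> B (vadd z a t) ->
    fend a = f -> c != a -> vadd (C (vadd z a t)) c t = vadd z a t -> t' <= t ->
  vadd (C (vadd z a t')) c t' = vadd z a t'.
Proof.
move=> Bz Cz Bt fa ca Et le_t.
have le_v : vle (vadd z a t') (vadd z a t).
  by apply/vleP => e; rewrite !ffunE; case: eqP; lia.
have Bt' := inB_vle Bt le_v.
have nt : vnorm (C (vadd z a t)) = vnorm z.
  by move: (congr1 (@vnorm M) Et); rewrite !vnorm_vadd => /addIn.
have off_c e : e != c -> C (vadd z a t') e = vadd z a t' e.
  move=> ec; have := C_subst e Bt le_v; have := C_leE e Bt'.
  move: (congr1 (fun v : vec M => v e) Et).
  rewrite !ffunE (negbTE ec); case: eqP; lia.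
have nt' : vnorm (C (vadd z a t')) = vnorm z.
  by apply/eqP; rewrite eqn_leq -{1}nt C_size //= -{1}Cz C_size //;
    apply/vleP => e; rewrite !ffunE; case: eqP; lia.
have := vnorm_vadd z a t'; rewrite -nt' /vnorm.
rewrite (bigD1 c) //= [in RHS](bigD1 c) //= (eq_bigr _ off_c) => Ec.
apply/ffunP => e; rewrite [in LHS]ffunE.
by have [->|/off_c//] := eqVneq e c; lia.
Qed.

End FirmChoice.

(** * The choice functions of the workers *)

Section Alloc.

Variables (M : market) (ax : market_axioms M).
Implicit Types (e a c l : edge M) (u v x y z : vec M) (w : worker M).

Lemma vnorm_restr_w w x : vnorm (xw w x) = \sum_(e | wend e == w) x e.
Proof.
by rewrite [RHS]big_mkcond; apply: eq_bigr => e _; rewrite ffunE.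
Qed.

Lemma vnorm_restr_f f x : vnorm (xf f x) = \sum_(e | fend e == f) x e.
Proof.
by rewrite [RHS]big_mkcond; apply: eq_bigr => e _; rewrite ffunE.
Qed.

Lemma restr_inB (d : vertex M) x :
  (forall e, x e <= cap e) -> inB d (restr d x).
Proof.
by move=> le_x; apply/forallP => e; rewrite ffunE; case: ifP.
Qed.

Lemma restr_f_edge e x : xf (fend e) x e = x e.
Proof. by rewrite ffunE /= eqxx. Qed.

Section Pref.

Variable w : worker M.

Lemma pref_position_lt e e' : wend e = w -> wend e' = w ->
  pref w e' e = (pref_position e' < pref_position e).
Proof.
have aux d d' : wend d = w -> wend d' = w -> pref w d' d ->
    pref_position d' < pref_position d.
  move=> wd wd' pd; apply: proper_card; apply/properP; split.
    apply/subsetP => d''; rewrite !inE wd wd' => /andP[/eqP wd'' p].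
    by rewrite wd'' eqxx /= (pref_trans ax wd'' wd' wd p pd).
  exists d'; first by rewrite inE wd wd' eqxx.
  by rewrite inE wd' eqxx /= pref_irr.
move=> we we'; apply/idP/idP => [|lt_p]; first exact: aux.
have [E|ne] := eqVneq e' e; first by rewrite E ltnn in lt_p.
have [//|/(aux _ _ we' we)] := orP (pref_total ax we' we ne).
by move/(ltn_trans lt_p); rewrite ltnn.
Qed.

Lemma weak_pref_position e e' : wend e = w -> wend e' = w ->
  (e' == e) || pref w e' e = (pref_position e' <= pref_position e).
Proof.
move=> we we'; have [->|ne] := eqVneq e' e; first by rewrite leqnn.
rewrite /= pref_position_lt // [RHS]leq_eqVlt; case: eqP => // E.
by have := pref_total ax we' we ne; rewrite !pref_position_lt // E ltnn.
Qed.

Definition supp_upto z e :=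
  forall e', wend e' = w -> z e' != 0 -> (e' == e) || pref w e' e.

Lemma exists_last z e : wend e = w -> z e != 0 ->
  exists2 l, is_last z w l & supp_upto z l.
Proof.
move=> we ze; pose P d := (wend d == w) && (z d != 0).
have Pe : P e by rewrite /P we eqxx.
case: (arg_maxnP (fun d => pref_position d) Pe) => l /andP[/eqP wl zl] lmax.
have up : supp_upto z l.
  move=> e' we' ze'; rewrite weak_pref_position //.
  by apply: lmax; rewrite /P we' eqxx.
exists l => //; rewrite /is_last wl eqxx zl /=.
apply/forallP => e'; apply/implyP => /and3P[/eqP we' ze' ne].
by have := up e' we' ze'; rewrite (negbTE ne).
Qed.

Lemma upto_split z e : wend e = w ->
  \sum_(e' | (wend e' == w) && ((e' == e) || pref w e' e)) z e' =
  z e + \sum_(e' | (wend e' == w) && pref w e' e) z e'.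
Proof.
move=> we; rewrite (bigD1 e) /=; last by rewrite we !eqxx.
congr (_ + _); apply: eq_bigl => e'; have [->|_] := eqVneq e' e.
  by rewrite andbF (negbTE (pref_irr ax we)) andbF.
by rewrite andbT.
Qed.

Lemma supp_upto_sum z e : supp_upto z e -> (forall e', wend e' != w -> z e' = 0) ->
  \sum_(e' | (wend e' == w) && ((e' == e) || pref w e' e)) z e' = vnorm z.
Proof.
move=> up out; rewrite [LHS]big_mkcond /=; apply: eq_bigr => e' _.
case: ifPn => //; rewrite negb_and => /orP[/out-> //|np].
have [//|ze'] := eqVneq (z e') 0; have [we'|/out //] := eqVneq (wend e') w.
by move: np; rewrite up.
Qed.

Lemma wchoice_below_quota z : vnorm z <= quota w -> wchoice w z = z.
Proof. by rewrite /wchoice => ->. Qed.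

Lemma wchoice_fixed_norm z : (forall e', wend e' != w -> z e' = 0) ->
  wchoice w z = z -> vnorm z <= quota w.
Proof.
move=> out; rewrite leqNgt => Ez; apply/negP => gt_q.
have [e ze] : exists e, z e != 0.
  apply/existsP; move: gt_q; apply: contraTT; rewrite negb_exists => /forallP z0.
  by rewrite -leqNgt /vnorm big1 // => e _; apply/eqP; rewrite -[_ == _]negbK.
have we : wend e = w by apply/eqP; apply: contraNT ze => /out ->.
have [l /and3P[/eqP wl zl _] up] := exists_last we ze.
have Es := supp_upto_sum up out.
move: (congr1 (fun v : vec M => v l) Ez) (upto_split z wl).
rewrite /wchoice leqNgt gt_q /= ffunE wl eqxx /= Es leqNgt gt_q /=.
case: leqP; move: gt_q zl; lia.
Qed.

(** A unit of [e] can only be refused when it exceeds the quota.  If it exceeds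
    the quota by one and some edge of the support is ranked below [e], then a
    unit of an edge below [e] is refused instead. *)
Lemma not_interesting_w x e : wend e = w -> x e < cap e ->
    (forall e', x e' <= cap e') -> ~~ interesting (inl w) (xw w x) e ->
  quota w <= vnorm (xw w x) /\
  (vnorm (xw w x) <= quota w -> supp_upto x e).
Proof.
move=> we lt_cap le_x; rewrite /interesting /= we eqxx negb_exists => /forallP.
have lt_k : (x e).+1 < (cap e).+1 by [].
move=> /(_ (Ordinal lt_k)); set z' := finfun _ => /=.
have z'E : z' = vadd (xw w x) e 1.
  apply/ffunP => e'; rewrite !ffunE /=; case: eqP => // ->.
  by rewrite we eqxx addn1.
have -> /= : @inB M (inl w) z'.
  apply/forallP => e'; rewrite z'E !ffunE /=; case: eqP => [->|_].
    by rewrite we eqxx addn1.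
  by case: ifP.
have xe : xw w x e = x e by rewrite ffunE /= we eqxx.
have z'e : z' e = (x e).+1 by rewrite ffunE eqxx.
have nz' : vnorm z' = (vnorm (xw w x)).+1 by rewrite z'E vnorm_vadd addn1.
rewrite z'e xe leqnn /= => ni.
have gt_q : quota w < vnorm z'.
  rewrite ltnNge; apply: contra ni => le_q.
  by rewrite wchoice_below_quota // z'e.
split; first by rewrite -ltnS -nz'.
move=> le_q e' we' xe'; apply: contraT => np.
have eq_q : vnorm z' = (quota w).+1.
  by apply/eqP; rewrite eqn_leq gt_q nz' ltnS le_q.
move: ni; rewrite /wchoice [vnorm _ <= _]leqNgt gt_q /= ffunE we eqxx /= ifT ?z'e ?leqnn //.
rewrite -ltnS -eq_q /vnorm [X in _ < X](bigD1 e') //= [X in X < _]big_mkcond /=.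
rewrite [X in X < _](bigD1 e') //= (negbTE np) andbF add0n.
have ne : e' != e by move: np; case: eqP.
rewrite -[X in X < _]add0n -addSn leq_add //.
  by rewrite z'E !ffunE (negbTE ne) /= we' eqxx lt0n.
by apply: leq_sum => d _; case: ifP.
Qed.

Lemma interesting_w_full x e : vnorm (xw w x) = quota w ->
  supp_upto x e -> ~~ interesting (inl w) (xw w x) e.
Proof.
move=> full up; rewrite /interesting /=; case: eqP => //= we.
rewrite negb_exists; apply/forallP => k; rewrite !negb_and.
set z' := finfun _.
have xe : xw w x e = x e by rewrite ffunE /= we eqxx.
rewrite xe -implybE; apply/implyP => _; rewrite -implybE; apply/implyP => lt_x.
have out e' : wend e' != w -> z' e' = 0.
  move=> ne; rewrite !ffunE /= (negbTE ne); case: eqP => // ee.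
  by move: ne; rewrite ee we eqxx.
have up' : supp_upto z' e.
  move=> e' we'; rewrite !ffunE /= we' eqxx; have [//|ne /= xe'] := eqVneq e' e.
  by have := up e' we' xe'; rewrite (negbTE ne).
have Es := supp_upto_sum up' out.
have up2 : supp_upto (xw w x) e.
  by move=> e' we'; rewrite ffunE /= we' eqxx => /(up e' we').
have out2 e' : wend e' != w -> xw w x e' = 0.
  by move=> ne; rewrite ffunE /= (negbTE ne).
have Es2 := supp_upto_sum up2 out2.
have Eb : \sum_(e' | (wend e' == w) && pref w e' e) z' e' =
          \sum_(e' | (wend e' == w) && pref w e' e) xw w x e'.
  apply: eq_bigr => e' /andP[_ p]; rewrite [LHS]ffunE; case: eqP => // ee.
  by move: p; rewrite ee (negbTE (pref_irr ax we)).
move: (upto_split z' we) (upto_split (xw w x) we).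
rewrite Es Es2 Eb full xe => n1 n2.
rewrite /wchoice.
have gt_q : quota w < vnorm z' by move: lt_x; rewrite n1 n2; lia.
rewrite [vnorm _ <= _]leqNgt gt_q /= [in X in _ < X]ffunE we eqxx /= Es [vnorm _ <= _]leqNgt gt_q /= Eb.
move: n2; move: (\sum_(_ | _) _) => b n2.
by rewrite -leqNgt n2 leq_addl addnK.
Qed.

End Pref.

(** * Interest of the firms *)

Definition inter x e := interesting (inr (fend e)) (xf (fend e) x) e.

Section GAlloc.

Variable x : vec M.
Hypothesis gx : g_alloc x.

Lemma galloc_cap e : x e <= cap e.
Proof. by case/andP: gx => /forallP. Qed.

Lemma galloc_inB (d : vertex M) : inB d (restr d x).
Proof. exact/restr_inB/galloc_cap. Qed.

Lemma galloc_firm f : fchoice f (xf f x) = xf f x.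
Proof. by case/andP: gx => _ /forallP/(_ (inr f))/andP[_ /eqP]. Qed.

Lemma galloc_quota w : vnorm (xw w x) <= quota w.
Proof.
apply: wchoice_fixed_norm.
  by move=> e' ne; rewrite ffunE /= (negbTE ne).
by case/andP: gx => _ /forallP/(_ (inl w))/andP[_ /eqP].
Qed.

Lemma inB_offer e : x e < cap e -> inB (inr (fend e)) (vadd (xf (fend e) x) e 1).
Proof.
move=> lt_x; apply: inB_vadd => //; first exact: galloc_inB.
by rewrite restr_f_edge addn1.
Qed.

(** By (A2) it suffices to offer a single unit. *)
Lemma interP e : reflect
  (x e < cap e /\ x e < fchoice (fend e) (vadd (xf (fend e) x) e 1) e)
  (inter x e).
Proof.
apply: (iffP andP) => [[_ /existsP[k]]|[lt_cap keep]].
  set z' := finfun _; rewrite restr_f_edge => /and3P[Bz' lt_k keep].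
  have z'e : z' e = k by rewrite ffunE eqxx.
  have lt_cap : x e < cap e.
    by rewrite (leq_trans _ (ltn_ord k : k <= cap e)) // -z'e.
  split=> //; have le_z' : vle (vadd (xf (fend e) x) e 1) z'.
    apply/vleP => e'; rewrite !ffunE /=; case: eqP => [->|] //.
    by rewrite eqxx addn1 -z'e.
  have := C_subst ax e Bz' le_z'; rewrite !ffunE /= !eqxx addn1.
  by move/(leq_trans _); apply; rewrite leq_min keep ltnSn.
split; first exact: eqxx.
have lt_k : (x e).+1 < (cap e).+1 by [].
apply/existsP; exists (Ordinal lt_k); set z' := finfun _.
have -> : z' = vadd (xf (fend e) x) e 1.
  by apply/ffunP => e'; rewrite !ffunE /=; case: eqP => // ->; rewrite eqxx addn1.
by rewrite /= inB_offer // restr_f_edge keep ffunE eqxx restr_f_edge addn1 ltnSn.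
Qed.

End GAlloc.

Lemma inter_cap x e : inter x e -> x e < cap e.
Proof.
case/andP => _ /existsP[k]; set z' := finfun _.
rewrite restr_f_edge => /and3P[Bz' lt_k _].
by move: lt_k; rewrite ffunE eqxx; move/leq_trans; apply; rewrite -ltnS.
Qed.

Lemma stable_g x : stable x -> g_alloc x.
Proof. by case/andP. Qed.

(** The edge attracts the firm and does not block, so it does not attract the
    worker. *)
Lemma stable_inter x e : stable x -> inter x e ->
  vnorm (xw (wend e) x) = quota (wend e) /\ supp_upto (wend e) x e.
Proof.
move=> sx ie; have gx := stable_g sx.
have ni : ~~ interesting (inl (wend e)) (xw (wend e) x) e.
  by case/andP: sx => _ /forallP/(_ e); rewrite /blocks negb_and => /orP[//|/negP[]].
have [ge_q up] := not_interesting_w erefl (inter_cap ie) (galloc_cap gx) ni.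
have le_q := galloc_quota gx (wend e).
by split; [apply/eqP; rewrite eqn_leq le_q | exact: up].
Qed.

End Alloc.

(** * Directed cycles *)

Section Cycles.

Lemma cycle_of_period (T : eqType) (f : T -> T) (x : T) d : 0 < d ->
    iter d f x = x -> (forall k, 0 < k < d -> iter k f x != x) ->
  uniq (traject f x d) /\ fcycle f (traject f x d).
Proof.
case: d => // d _ per min; split; last first.
  rewrite /= -[X in rcons _ X]per iterSr -trajectSr; exact: fpath_traject.
rewrite looping_uniq; apply/negP => /trajectP[k lt_kd E].
by have := min k.+1; rewrite !ltnS lt_kd -[X in _ != X]per !iterS E eqxx => /(_ isT).
Qed.

Lemma cycle_map_perm (T : Type) (U : eqType) (g h : T -> U) (s : seq T) :
  cycle (fun p q => g p == h q) s -> perm_eq (map g s) (map h s).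
Proof.
case: s => // p s.
suff E t q : path (fun p q => g p == h q) q t -> map g (belast q t) = map h t.
  by move=> /E; rewrite belast_rcons => ->; rewrite map_rcons perm_rcons.
by elim: t q => //= r t IH q /andP[/eqP -> /IH ->].
Qed.

Variable M : market.
Implicit Types (L : dcycle M).

Lemma same_cycle_refl L : same_cycle L L.
Proof. by exists 0; rewrite rot0. Qed.

Lemma same_cycle_sym L L' : same_cycle L L' -> same_cycle L' L.
Proof. by case=> n ->; exists (size (rot n L) - n); rewrite -[LHS](rotK n). Qed.

Lemma same_cycle_trans L L' L'' :
  same_cycle L L' -> same_cycle L' L'' -> same_cycle L L''.
Proof.
have aux n (K : dcycle M) : exists2 m, m <= size K & rot n K = rot m K.
  have [le_n|/ltnW le_n] := leqP n (size K); first by exists n.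
  by exists 0; rewrite ?rot0 ?rot_oversize.
case=> n -> [m ->]; have [n' le_n ->] := aux n L.
have [m' le_m ->] := aux m (rot n' L); rewrite size_rot in le_m.
by rewrite rot_add_mod //; eexists.
Qed.

Lemma same_cycle_mem L L' : same_cycle L L' -> L =i L'.
Proof. by case=> n -> p; rewrite mem_rot. Qed.

Lemma same_cycle_plus L L' : same_cycle L L' -> plus_edges L =i plus_edges L'.
Proof. by case=> n ->; rewrite /plus_edges map_rot => e; rewrite mem_rot. Qed.

Lemma same_cycle_minus L L' : same_cycle L L' -> minus_edges L =i minus_edges L'.
Proof. by case=> n ->; rewrite /minus_edges map_rot => e; rewrite mem_rot. Qed.

Lemma same_cycle_shift L L' x t : same_cycle L L' -> shift x L t = shift x L' t.
Proof.
move=> sc; apply/ffunP => e.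
by rewrite !ffunE (same_cycle_plus sc) (same_cycle_minus sc).
Qed.

Lemma same_cycle_feasible L L' x t : same_cycle L L' ->
  feasible x L t = feasible x L' t.
Proof.
move=> sc; rewrite /feasible.
rewrite (eq_all_r (same_cycle_plus sc)) (eq_all_r (same_cycle_minus sc)).
by rewrite (eq_all_r (same_cycle_mem sc)).
Qed.

Lemma same_cycle_max_feasible L L' x t : same_cycle L L' ->
  max_feasible x L t -> max_feasible x L' t.
Proof.
move=> sc [ft mt]; split; first by rewrite -(same_cycle_feasible _ _ sc).
by move=> t'; rewrite -(same_cycle_feasible _ _ sc); apply: mt.
Qed.

Lemma max_feasible_uniq L x t t' :
  max_feasible x L t -> max_feasible x L t' -> t = t'.
Proof.
move=> [ft mt] [ft' mt']; apply/eqP.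
by rewrite eqn_leq (mt' _ ft) (mt _ ft').
Qed.

End Cycles.

(** * Tandems *)

Section Tandems.

Variables (M : market) (ax : market_axioms M).
Implicit Types (e a c l : edge M) (u v x y z : vec M) (w : worker M).
Implicit Types (L : dcycle M).

Lemma pref_anti e e' : wend e = wend e' -> pref (wend e) e e' ->
  pref (wend e) e' e -> False.
Proof.
move=> E p p'; have := pref_trans ax erefl (esym E) erefl p p'.
by apply/negP/pref_irr.
Qed.

Lemma W_candidateP x e : reflect
  [/\ vnorm (xw (wend e) x) = quota (wend e),
      exists2 e', wend e' = wend e & x e' != 0,
      supp_upto (wend e) x e & inter x e]
  (W_candidate x (wend e) e).
Proof.
rewrite /W_candidate eqxx /=; apply: (iffP and3P).
  case=> /eqP full /existsP[l /andP[/and3P[/eqP wl xl /forallP up] el]] ie.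
  split=> //; first by exists l.
  move=> e' we' xe'; have [<-//|ne] := eqVneq e' e.
  have [El|ne_l] := eqVneq e' l.
    case/orP: el => [/eqP ee|]; last by rewrite El.
    by rewrite El -ee eqxx in ne.
  have := up e'; rewrite we' eqxx xe' ne_l /= => p.
  case/orP: el => [/eqP el|pl]; first by rewrite [X in pref _ _ X]el.
  by rewrite (pref_trans ax we' wl erefl p pl).
case=> full [e' we' xe'] up ie; rewrite full eqxx; split=> //.
have [l ll _] := exists_last ax we' xe'.
apply/existsP; exists l; rewrite ll /=; case/and3P: ll => /eqP wl xl _.
by have := up l wl xl; rewrite eq_sym.
Qed.

Lemma W_admissible_inter x a : W_admissible x a -> inter x a.
Proof. by case/andP => /W_candidateP[]. Qed.

Lemma W_admissible_uniq x a a' : wend a = wend a' ->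
  W_admissible x a -> W_admissible x a' -> a = a'.
Proof.
move=> E /andP[ca /forallP ma] /andP[ca' /forallP ma'].
rewrite -E in ca' ma'; apply: contraTeq isT => ne.
have := ma a'; have := ma' a; rewrite ca ca' ne eq_sym ne /= => p p'.
by case: (pref_anti E p' p).
Qed.

Lemma W_admissible_exists x e : W_candidate x (wend e) e ->
  exists2 a, W_admissible x a & wend a = wend e /\ ((a == e) || pref (wend e) a e).
Proof.
move=> ce.
case: (arg_minnP (fun d => pref_position d) ce) => a ca amin.
have wa : wend a = wend e by case/and4P: ca => /eqP.
exists a; last by split=> //; rewrite weak_pref_position // amin.
rewrite /W_admissible wa ca /=; apply/forallP => d; apply/implyP => /andP[cd ne].
have wd : wend d = wend e by case/and4P: cd => /eqP.
have := amin d cd; rewrite -(weak_pref_position ax wd wa).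
by rewrite eq_sym (negbTE ne).
Qed.

Section Tandem.

Variable x : vec M.

Lemma tandem_firm a c : tandem x a c -> fend c = fend a.
Proof. by case/and4P=> _ /eqP. Qed.

Lemma tandem_neq a c : tandem x a c -> c != a.
Proof. by case/and4P. Qed.

Lemma tandem_adm a c : tandem x a c -> W_admissible x a.
Proof. by case/and4P. Qed.

Lemma tandemE a c : tandem x a c -> let z := xf (fend a) x in
  vadd (fchoice (fend a) (vadd z a 1)) c 1 = vadd z a 1.
Proof. by case/and4P=> _ _ _ /eqP. Qed.

Lemma tandem_lt_cap a c : tandem x a c -> x a < cap a.
Proof. by move/tandem_adm/W_admissible_inter/inter_cap. Qed.

Lemma tandem_pos a c : tandem x a c -> 0 < x c.
Proof.
move=> t; move: (congr1 (fun v : vec M => v c) (tandemE t)).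
rewrite !ffunE eqxx (negbTE (tandem_neq t)) /= (tandem_firm t) eqxx; lia.
Qed.

Lemma tandem_uniq a c c' : tandem x a c -> tandem x a c' -> c = c'.
Proof.
move=> t t'; have := etrans (tandemE t) (esym (tandemE t')).
move/(congr1 (fun v : vec M => v c)); rewrite /= !ffunE eqxx.
by case: eqP => // _; lia.
Qed.

Hypothesis gx : g_alloc x.

(** If [a] could be both received and given up, then with [a'] and [a] offered
    together the firm would keep the unit of [c] that it gives up for [a]
    alone, against substitutability. *)
Lemma tandem_disjoint a c a' c' : tandem x a c -> tandem x a' c' -> a != c'.
Proof.
move=> t t'; apply/eqP => E; rewrite -{}E in t'.
have Ef := tandem_firm t'; have nea := tandem_neq t'.
move: (tandemE t) (tandemE t') (tandem_pos t) (tandem_pos t') (tandem_neq t).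
rewrite /= -Ef; set f := fend a; set z := xf f x => Et Et' xc xa neca.
have Ba' : inB (inr f) (vadd z a' 1).
  by rewrite /z /f Ef; apply: inB_offer (tandem_lt_cap t').
have Ba : inB (inr f) (vadd z a 1) by apply: inB_offer (tandem_lt_cap t).
pose u := vadd (vadd z a' 1) a 1.
have Bu : inB (inr f) u.
  suff -> : u = vmax (vadd z a' 1) (vadd z a 1) by apply: inB_vmax.
  apply/ffunP => e; rewrite !ffunE; have [->|n1] := eqVneq e a.
    by rewrite (negbTE nea); lia.
  by case: eqP; lia.
have le1 : vle (vadd z a' 1) u.
  by apply/vleP => e; rewrite [in X in _ <= X]ffunE; case: eqP; lia.
have le2 : vle (vadd z a 1) u.
  by apply/vleP => e; rewrite !ffunE; do 2 case: eqP; lia.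
have za : z a = x a by rewrite ffunE /= eqxx.
have Cu : fchoice f (vadd z a' 1) = fchoice f u.
  apply: (C_cons ax Bu le1); apply/vleP => e.
  have [->|ne] := eqVneq e a; last first.
    by have := C_leE ax e Bu; rewrite [u e]ffunE (negbTE ne).
  have := C_subst ax a Bu le1.
  move: (congr1 (fun v : vec M => v a) Et').
  rewrite !ffunE eqxx (negbTE nea) /=; lia.
have := C_subst ax c Bu le2; rewrite -Cu.
move: (congr1 (fun v : vec M => v c) Et) (congr1 (fun v : vec M => v c) Et').
rewrite /= [LHS]ffunE eqxx [RHS]ffunE (negbTE neca) => E1.
rewrite [LHS]ffunE (negbTE neca) [RHS]ffunE => ->.
rewrite [X in minn _ X]ffunE (negbTE neca).
by case: eqP; lia.
Qed.

End Tandem.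

End Tandems.

(** * Rotations and the active graph *)

Section ActiveGraph.

Variables (M : market) (ax : market_axioms M) (x : vec M).
Hypothesis gx : g_alloc x.
Implicit Types (e a c l : edge M) (w : worker M) (p q : edge M * edge M).
Implicit Types (L : dcycle M) (A : {set edge M}).

(** The cleaning process leaves exactly the edges on simple cycles of tandems,
    so rotations can be described without it; see [rotation_atP]. *)
Definition rotation L := tandem_cycle x L && uniq (plus_edges L).

Lemma rotation_tandem L p : rotation L -> p \in L -> tandem x p.1 p.2.
Proof. by case/andP=> /and3P[_ /allP aL _] _ /aL. Qed.

Lemma rotation_plus L a : rotation L -> a \in plus_edges L ->
  exists2 c, tandem x a c & (a, c) \in L.
Proof.
move=> rL /mapP[[a' c] pL /= ->]; exists c => //.
exact: (rotation_tandem rL pL).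
Qed.

Lemma rotation_minus L c : rotation L -> c \in minus_edges L ->
  exists2 a, tandem x a c & (a, c) \in L.
Proof.
move=> rL /mapP[[a c'] pL /= ->]; exists a => //.
exact: (rotation_tandem rL pL).
Qed.

(** A worker has at most one admissible edge and this edge at most one partner;
    hence following tandems is a partial function. *)
Lemma tandem_wend_inj p q : tandem x p.1 p.2 -> tandem x q.1 q.2 ->
  wend p.1 = wend q.1 -> p = q.
Proof.
case: p q => [a c] [a' c'] /= t t' E.
have Ea := W_admissible_uniq ax E (tandem_adm t) (tandem_adm t').
by rewrite -Ea in t' *; rewrite (tandem_uniq t t').
Qed.

Definition next_tandem p :=
  odflt p [pick q : edge M * edge M | tandem x q.1 q.2 & wend p.2 == wend q.1].

Lemma next_tandemE p q : tandem x q.1 q.2 -> wend p.2 = wend q.1 ->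
  next_tandem p = q.
Proof.
move=> tq E; rewrite /next_tandem; case: pickP => [r /andP[tr /eqP Er]|].
  by apply: tandem_wend_inj => //; rewrite -E.
by move/(_ q); rewrite tq E eqxx.
Qed.

Lemma rotation_fcycle L : rotation L -> fcycle next_tandem L /\ uniq L.
Proof.
case/andP=> /and3P[_ aL cL] uL; split; last exact: map_uniq uL.
apply: (sub_in_cycle _ aL cL) => p q _ tq /eqP E; apply/eqP.
exact: next_tandemE.
Qed.

Lemma rotation_same L L' p : rotation L -> rotation L' -> p \in L -> p \in L' ->
  same_cycle L L'.
Proof.
move=> /rotation_fcycle[cL uL] /rotation_fcycle[cL' uL'] pL pL'.
have [i Ei] := orbit_rot_cycle cL uL pL.
have [j Ej] := orbit_rot_cycle cL' uL' pL'.
apply: same_cycle_trans (same_cycle_sym _ ); first by exists i; apply: Ei.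
by exists j.
Qed.

Lemma rotation_same_plus L L' a : rotation L -> rotation L' ->
  a \in plus_edges L -> a \in plus_edges L' -> same_cycle L L'.
Proof.
move=> rL rL' /(rotation_plus rL)[c t pL] /(rotation_plus rL')[c' t' pL'].
by rewrite (tandem_uniq t' t) in pL'; apply: rotation_same pL pL'.
Qed.

Lemma rotation_wends L : rotation L ->
  perm_eq [seq wend p.2 | p <- L] [seq wend p.1 | p <- L].
Proof. by case/andP=> /and3P[_ _ /cycle_map_perm]. Qed.

Lemma rotation_next L p : rotation L -> p \in L ->
  exists2 q, q \in L & wend p.2 = wend q.1.
Proof.
move=> rL pL; have := map_f (fun p => wend p.2) pL.
by rewrite (perm_mem (rotation_wends rL)) => /mapP[q qL ->]; exists q.
Qed.

Lemma rotation_prev L q : rotation L -> q \in L ->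
  exists2 p, p \in L & wend p.2 = wend q.1.
Proof.
move=> rL pL; have := map_f (fun p => wend p.1) pL.
by rewrite -(perm_mem (rotation_wends rL)) => /mapP[p qL ->]; exists p.
Qed.

Lemma rotation_same_minus L L' c : rotation L -> rotation L' ->
  c \in minus_edges L -> c \in minus_edges L' -> same_cycle L L'.
Proof.
move=> rL rL' /(rotation_minus rL)[a t pL] /(rotation_minus rL')[a' t' pL'].
have [q qL /= Eq] := rotation_next rL pL.
have [q' qL' /= Eq'] := rotation_next rL' pL'.
have E : q = q'.
  apply: tandem_wend_inj; rewrite -?Eq -?Eq' //.
    exact: rotation_tandem qL.
  exact: rotation_tandem qL'.
by rewrite -E in qL'; apply: rotation_same qL qL'.
Qed.

Lemma rotation_uniq_wend L : rotation L -> uniq [seq wend p.1 | p <- L].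
Proof.
move=> rL; have [_ uL] := rotation_fcycle rL.
rewrite map_inj_in_uniq // => p q /(rotation_tandem rL) tp.
by move=> /(rotation_tandem rL) tq; apply: tandem_wend_inj.
Qed.

Lemma rotation_uniq_minus L : rotation L -> uniq (minus_edges L).
Proof.
move=> rL; have := rotation_uniq_wend rL.
rewrite -(perm_uniq (rotation_wends rL)) (map_comp (@wend M) snd).
exact: map_uniq.
Qed.

Lemma rotation_disjoint L L' e : rotation L -> rotation L' ->
  e \in plus_edges L -> e \in minus_edges L' -> False.
Proof.
move=> rL rL' /(rotation_plus rL)[c t _] /(rotation_minus rL')[a t' _].
by have := tandem_disjoint ax gx t t'; rewrite eqxx.
Qed.

Lemma rotation_same_cycle L L' : same_cycle L L' -> rotation L -> rotation L'.
Proof.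
case=> n -> /andP[/and3P[L0 aL cL] uL].
apply/andP; split; last by rewrite /plus_edges map_rot rot_uniq.
apply/and3P; split; last by rewrite rot_cycle.
  by rewrite -size_eq0 size_rot size_eq0.
by rewrite (eq_all_r (mem_rot n L)).
Qed.

(** Following tandems is a function, so it runs into a cycle; the least period
    makes this cycle simple. *)
Lemma rotation_within A a0 : a0 \in A ->
    (forall a, a \in A -> exists2 c, tandem x a c &
      exists2 a', a' \in A & wend a' = wend c) ->
  exists2 L, rotation L & {subset plus_edges L <= A}.
Proof.
move=> a0A step; pose Q p := (p.1 \in A) && tandem x p.1 p.2.
have stepQ p : Q p -> Q (next_tandem p) /\ wend p.2 = wend (next_tandem p).1.
  case/andP => pA tp; have [c tc [a' a'A Ea']] := step _ pA.
  have [c' tc' _] := step _ a'A.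
  rewrite (tandem_uniq tc tp) in Ea'.
  by rewrite (@next_tandemE p (a', c')) //= /Q /= a'A tc'.
have [c0 t0 _] := step _ a0A; pose p0 := (a0, c0).
have Q0 : Q p0 by rewrite /Q /= a0A.
have Qi i : Q (iter i next_tandem p0) by elim: i => //= i /stepQ[].
have [d0 [q [d0_gt0 Qq per0]]] : exists d q,
    [/\ 0 < d, Q q & iter d next_tandem q = q].
  have := looping_order next_tandem p0; rewrite /looping.
  case/trajectP=> k lt_k Ek; exists (order next_tandem p0 - k).
  exists (iter k next_tandem p0); split; rewrite ?subn_gt0 //.
  by rewrite -iterD subnK // ltnW.
have exd : exists d, (0 < d) && (iter d next_tandem q == q).
  by exists d0; rewrite d0_gt0 per0 eqxx.
case: (ex_minnP exd) => d /andP[d_gt0 /eqP per] dmin.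
have [|uL cL] := cycle_of_period d_gt0 per.
  move=> k /andP[k_gt0 lt_kd]; apply: contraTneq lt_kd => Ek.
  by rewrite -leqNgt dmin // k_gt0 Ek eqxx.
have Qqi i : Q (iter i next_tandem q) by elim: i => //= i /stepQ[].
have QL : all Q (traject next_tandem q d).
  by apply/allP => p /trajectP[i _ ->].
exists (traject next_tandem q d).
  apply/andP; split; last first.
    rewrite map_inj_in_uniq // => p r /(allP QL)/andP[_ tp] /(allP QL)/andP[_ tr].
    by move=> E; apply: tandem_wend_inj => //; rewrite E.
  apply/and3P; split; first by rewrite -size_eq0 size_traject -lt0n.
    by apply/allP => p /(allP QL)/andP[].
  by apply: sub_in_cycle QL cL => p r /stepQ[_ E] _ /eqP <-; apply/eqP.
by move=> a /mapP[p /(allP QL)/andP[pA _] ->].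
Qed.

(** Tracing back is injective on [A], hence a permutation of [A]; so the tandems
    can also be followed forever, and the rotations found in this way can be
    removed one after the other. *)
Lemma rotation_decomposition A :
    (forall a, a \in A -> exists2 a', a' \in A &
       exists2 c, tandem x a' c & wend c = wend a) ->
    {in A, forall a, W_admissible x a} ->
  exists2 Ls, all rotation Ls &
    perm_eq (flatten (map (@plus_edges M) Ls)) (enum A).
Proof.
have [n] := ubnP #|A|; elim: n A => // n IH A /ltnSE le_n back adm.
have [->|[a0 a0A]] := set_0Vmem A.
  by exists [::] => //=; rewrite enum_set0.
have forth a : a \in A -> exists2 c, tandem x a c &
    exists2 a', a' \in A & wend a' = wend c.
  pose prev a : edge M := odflt a [pick a' | (a' \in A) &&
    [exists c, tandem x a' c && (wend c == wend a)]].
  have prevP b : b \in A -> prev b \in A /\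
      exists2 c, tandem x (prev b) c & wend c = wend b.
    move=> bA; rewrite /prev; case: pickP => [b' /andP[b'A]|].
      by case/existsP=> c /andP[t /eqP E]; split=> //; exists c.
    have [b' b'A [c t E]] := back b bA => /(_ b'); rewrite b'A /=.
    by move/existsP; case; exists c; rewrite t E eqxx.
  have inj : {in A &, injective prev}.
    move=> b b' bA b'A E; have [_ [c t Ec]] := prevP b bA.
    have [_ [c' t' Ec']] := prevP b' b'A; rewrite -E in t'.
    rewrite -(tandem_uniq t t') Ec in Ec'.
    exact: (W_admissible_uniq ax Ec' (adm _ bA) (adm _ b'A)).
  have imA : prev @: A = A.
    apply/eqP; rewrite eqEcard card_in_imset // leqnn andbT.
    by apply/subsetP => b /imsetP[b' /prevP[? _] ->].
  rewrite -{1}imA => /imsetP[b bA ->]; have [_ [c t Ec]] := prevP b bA.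
  by exists c => //; exists b.
have [L rL LA] := rotation_within a0A forth.
pose A' := A :\: [set a in plus_edges L].
have [p pL] : exists p, p \in L.
  by case/andP: rL => /and3P[]; case: (L) => // p ? _ _ _ _; exists p; apply: mem_head.
have [||| Ls aLs pLs] := IH A'.
- apply: leq_trans le_n; apply: proper_card; apply/properP.
  split; first exact: subsetDl.
  have pL1 : p.1 \in plus_edges L by apply: map_f.
  by exists p.1; rewrite ?LA // !inE pL1.
- move=> a; rewrite !inE => /andP[aL aA].
  have [a' a'A [c t E]] := back a aA; exists a'; last by exists c.
  rewrite !inE a'A andbT; apply: contra aL => /(rotation_plus rL)[c' t' pL'].
  have [q qL Eq] := rotation_next rL pL'.
  rewrite /= -(tandem_uniq t t') E in Eq.
  have adm_q := tandem_adm (rotation_tandem rL qL).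
  by rewrite (W_admissible_uniq ax Eq (adm _ aA) adm_q) map_f.
- by move=> a; rewrite !inE => /andP[_ /adm].
exists (L :: Ls); first by rewrite /= rL.
have uL : uniq (plus_edges L) by case/andP: rL.
rewrite /= uniq_perm ?enum_uniq //.
  rewrite cat_uniq uL (perm_uniq pLs) enum_uniq andbT /=.
  by apply/hasPn => a; rewrite (perm_mem pLs) mem_enum !inE => /andP[].
move=> a; rewrite mem_cat (perm_mem pLs) !mem_enum !inE.
by have [/LA ->|] := boolP (a \in plus_edges L).
Qed.

(** The invariants of the cleaning process.  No rotation loses an edge, because
    every worker on it has an entering edge. *)
Lemma clean_step_inv (G G' : dgraph M) L : clean_step x G G' ->
    {in G.1, forall a, W_admissible x a} ->
    G.2 = [set c | [exists a in G.1, tandem x a c]] ->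
  [/\ G'.1 \subset G.1, #|G'.1| < #|G.1|,
      G'.2 = [set c | [exists a in G'.1, tandem x a c]] &
      rotation L -> {subset plus_edges L <= G.1} ->
        {subset plus_edges L <= G'.1}].
Proof.
case/existsP=> a /and3P[aG /forallP noc /eqP ->] /= adm G2; split.
- exact: subsetDl.
- by rewrite [X in _ < X](cardsD1 a) aG.
- apply/setP => c; rewrite !inE G2 inE negb_and negbK.
  apply/andP/existsP => [[ok /existsP[b /andP[bG tb]]]|[b]].
    have [Eb|ne] := eqVneq b a; last by exists b; rewrite !inE ne bG.
    rewrite Eb in tb; rewrite tb /= in ok.
    by case/existsP: ok => b' /and3P[b'G ne t]; exists b'; rewrite !inE ne b'G.
  rewrite !inE -andbA => /and3P[ne bG tb]; split.
    by apply/orP; right; apply/existsP; exists b; rewrite bG ne.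
  by apply/existsP; exists b; rewrite bG.
- move=> rL LG b bL; rewrite !inE LG // andbT; apply/eqP => E.
  have [c t pL] := rotation_plus rL bL; have [q qL Eq] := rotation_prev rL pL.
  have tq := rotation_tandem rL qL.
  have := noc q.2; rewrite Eq E /= eqxx implybF G2 inE => /negP[].
  by apply/existsP; exists q.1; rewrite LG ?map_f.
Qed.

Lemma rotation_at_sound L : rotation_at x L -> rotation L.
Proof.
case=> G [Ls [_ /and3P[aLs pLs _] LLs]]; rewrite /rotation (allP aLs) //=.
have : uniq (flatten (map (@plus_edges M) Ls)).
  by rewrite (perm_uniq pLs) enum_uniq.
elim: Ls LLs {aLs pLs} => // L' Ls IH; rewrite inE /= cat_uniq.
by case/orP=> [/eqP <- /andP[]|/IH IH' /and3P[_ _]].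
Qed.

(** In the final graph of any cleaning every worker that is left is also
    entered, since no step applies.  This remains true when [L] is taken away,
    so the rest decomposes into rotations as well. *)
Lemma rotation_at_complete L : rotation L -> rotation_at x L.
Proof.
move=> rL.
pose inv (G : dgraph M) := [/\ {in G.1, forall a, W_admissible x a},
  G.2 = [set c | [exists a in G.1, tandem x a c]] &
  {subset plus_edges L <= G.1}].
have inv0 : inv (D_graph x).
  split=> [a||a /(rotation_plus rL)[c t _]]; rewrite /= ?inE //.
    apply/setP => c; rewrite !inE; apply/existsP/existsP=> -[b].
      by move=> t; exists b; rewrite inE (tandem_adm t).
    by case/andP=> _; exists b.
  exact: tandem_adm t.
have [G [conG norm [adm G2 LG]]] : exists G,
    [/\ connect (clean_step x) (D_graph x) G,
        ~~ [exists G', clean_step x G G'] & inv G].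
  have := connect0 (clean_step x) (D_graph x); move: inv0.
  move: {1 3}(D_graph x) => G; have [n] := ubnP #|G.1|.
  elim: n G => // n IH G /ltnSE le_n invG conG.
  have [/existsP[G' st]|] := boolP [exists G', clean_step x G G']; last first.
    by exists G.
  case: invG => adm G2 LG.
  have [sub lt_card G2' pres] := clean_step_inv L st adm G2.
  apply: (IH G'); first exact: leq_trans lt_card le_n.
    split=> //; last exact: pres.
    by move=> a /(subsetP sub); apply: adm.
  exact: connect_trans conG (connect1 st).
have back a : a \in G.1 -> exists2 a', a' \in G.1 &
    exists2 c, tandem x a' c & wend c = wend a.
  move=> aG; move: norm; rewrite negb_exists => /forallP.
  set G' : dgraph M := (G.1 :\ a, G.2 :\: [set c | tandem x a c &&
                           ~~ [exists a' in G.1, (a' != a) && tandem x a' c]]).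
  move/(_ G')/existsPn/(_ a); rewrite aG eqxx andbT /= negb_forall.
  case/existsP=> c; rewrite negb_imply negbK => /andP[].
  by rewrite G2 inE => /existsP[a' /andP[a'G t]] /eqP E; exists a' => //; exists c.
pose A := G.1 :\: [set a in plus_edges L].
have [||Ls aLs pLs] := @rotation_decomposition A.
- move=> a; rewrite !inE => /andP[aL aG].
  have [a' a'G [c t E]] := back a aG; exists a'; last by exists c.
  rewrite !inE a'G andbT; apply: contra aL => /(rotation_plus rL)[c' t' pL'].
  have [q qL Eq] := rotation_next rL pL'.
  rewrite /= -(tandem_uniq t t') E in Eq.
  have adm_q := tandem_adm (rotation_tandem rL qL).
  by rewrite (W_admissible_uniq ax Eq (adm _ aG) adm_q) map_f.
- by move=> a; rewrite !inE => /andP[_ /adm].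
have aLLs : all rotation (L :: Ls) by rewrite /= rL.
have pLLs : perm_eq (flatten (map (@plus_edges M) (L :: Ls))) (enum G.1).
  have uL : uniq (plus_edges L) by case/andP: rL.
  rewrite /= uniq_perm ?enum_uniq //.
    rewrite cat_uniq uL (perm_uniq pLs) enum_uniq andbT /=.
    by apply/hasPn => a; rewrite (perm_mem pLs) mem_enum !inE => /andP[].
  move=> a; rewrite mem_cat (perm_mem pLs) !mem_enum !inE.
  by have [/LG ->|] := boolP (a \in plus_edges L).
exists G, (L :: Ls); split; [by rewrite /is_active_graph conG | | exact: mem_head].
apply/and3P; split=> //; first by apply/allP => K /(allP aLLs)/andP[].
have wLs (Ks : seq (dcycle M)) : all rotation Ks ->
    perm_eq (map (@wend M) (flatten (map (@minus_edges M) Ks)))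
            (map (@wend M) (flatten (map (@plus_edges M) Ks))).
  elim: Ks => //= K Ks IH /andP[rK /IH pK]; rewrite !map_cat perm_cat //.
  by rewrite -!map_comp; apply: rotation_wends.
rewrite uniq_perm ?enum_uniq //.
  apply: (@map_uniq _ _ (@wend M)); rewrite (perm_uniq (wLs _ aLLs)).
  rewrite map_inj_in_uniq ?(perm_uniq pLLs) ?enum_uniq // => a b.
  rewrite !(perm_mem pLLs) !mem_enum => aG bG E.
  exact: (W_admissible_uniq ax E (adm _ aG) (adm _ bG)).
move=> c; rewrite mem_enum G2 inE; apply/flatten_mapP/existsP => [[K KLs]|].
  move=> /(rotation_minus (allP aLLs _ KLs))[a t pK]; exists a.
  rewrite t andbT -mem_enum -(perm_mem pLLs); apply/flatten_mapP.
  by exists K => //; apply: (map_f fst pK).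
case=> a /andP[]; rewrite -mem_enum -(perm_mem pLLs) => /flatten_mapP[K KLs].
move=> /(rotation_plus (allP aLLs _ KLs))[c' t' pK] t; exists K => //.
by rewrite (tandem_uniq t t'); apply: (map_f snd pK).
Qed.

Lemma rotation_atP L : rotation_at x L <-> rotation L.
Proof. by split; [exact: rotation_at_sound | exact: rotation_at_complete]. Qed.

End ActiveGraph.

(** * Shifting along a rotation *)

Section Shift.

Variables (M : market) (ax : market_axioms M).
Implicit Types (e a c l : edge M) (u v x y z : vec M) (w : worker M).
Implicit Types (L : dcycle M).

(** The extra unit of [c] lies within the join of [z] and [v], from which the firm
    takes just [v]. *)
Lemma better_drop f z v c : better f z v -> v c < z c ->
  fchoice f (vadd v c 1) = v.
Proof.
case=> Bz Bv E lt_c; rewrite -[RHS]E.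
apply: (C_cons ax) (inB_vmax Bz Bv) _ _.
  by apply/vleP => e; rewrite !ffunE; case: eqP => [->|]; lia.
by rewrite E; apply/vleP => e; rewrite ffunE; case: eqP; lia.
Qed.

Lemma good_swap f z a c t : inB (inr f) z -> fchoice f z = z ->
    inB (inr f) (vadd z a t) -> vadd (fchoice f (vadd z a t)) c t = vadd z a t ->
  good f z (fchoice f (vadd z a t)).
Proof.
move=> Bz Cz Bt E; split.
  by apply: (better_of ax Bt) => //; apply/vleP => e; rewrite ffunE; case: eqP; lia.
by move: (congr1 (@vnorm M) E); rewrite !vnorm_vadd => /addIn.
Qed.

(** Unlike [rotation] this does not refer to an allocation and is inherited by
    tails, which permits induction on [L]. *)
Definition pairing L := [/\ uniq (plus_edges L), uniq (minus_edges L),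
  forall e, e \in plus_edges L -> e \notin minus_edges L &
  forall p, p \in L -> fend p.2 = fend p.1].

Lemma pairing_tail p L : pairing (p :: L) -> pairing L.
Proof.
case=> /= /andP[_ up] /andP[_ um] dis fe; split=> // [e eL|q qL].
  by have := dis e; rewrite !inE eL orbT => /(_ isT); rewrite negb_or => /andP[].
by apply: fe; rewrite inE qL orbT.
Qed.

Lemma feasible_tail x p L t : feasible x (p :: L) t -> feasible x L t.
Proof. by case/and4P=> /= t0 /andP[_ ?] /andP[_ ?] /andP[_ ?]; apply/and4P. Qed.

Lemma rotation_pairing x L : g_alloc x -> rotation x L -> pairing L.
Proof.
move=> gx rL; split; first by case/andP: rL.
- exact: rotation_uniq_minus rL.
- move=> e eL; apply/negP => eL'.
  exact: (rotation_disjoint ax gx rL rL eL eL').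
- by move=> p /(rotation_tandem rL)/tandem_firm.
Qed.

Lemma feasible_cap x L t e : feasible x L t -> g_alloc x -> e \in plus_edges L ->
  x e + t <= cap e.
Proof.
case/and4P=> t0 _ /allP/(_ e) le_t _ gx /le_t.
by have := galloc_cap gx e; lia.
Qed.

Lemma feasible_pos x L t e : feasible x L t -> e \in minus_edges L -> t <= x e.
Proof. by case/and4P=> _ /allP/(_ e). Qed.

Lemma feasible_tandem x L t p : feasible x L t -> p \in L ->
  let z := vadd (xf (fend p.1) x) p.1 t in
  vadd (fchoice (fend p.1) z) p.2 t = z.
Proof. by case/and4P=> _ _ _ /allP aL /aL/eqP. Qed.

Lemma shift_plus x L t e : pairing L -> e \in plus_edges L ->
  shift x L t e = x e + t.
Proof.
by case=> _ _ dis _ eL; rewrite ffunE eL (negbTE (dis e eL)) muln0 muln1 subn0.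
Qed.

Lemma shift_minus x L t e : pairing L -> e \in minus_edges L ->
  shift x L t e = x e - t.
Proof.
case=> _ _ dis _ eL; have /negbTE eP : e \notin plus_edges L.
  by apply: contraL eL; apply: dis.
by rewrite ffunE eL eP muln1 muln0 addn0.
Qed.

Lemma shift_other x L t e : e \notin plus_edges L -> e \notin minus_edges L ->
  shift x L t e = x e.
Proof. by rewrite ffunE => /negbTE-> /negbTE->; rewrite muln0 addn0 subn0. Qed.

(** The tandems of [L] change disjoint sets of edges, so [good_comb] adds them one
    by one. *)
Lemma shift_good x L t : g_alloc x -> pairing L -> feasible x L t ->
  forall f, good f (xf f x) (xf f (shift x L t)).
Proof.
move=> gx pL fL f; have Bz := galloc_inB gx (inr f).
have Cz := galloc_firm gx f.
elim: L pL fL => [|[a c] L IH] pL fL.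
  have -> : shift x [::] t = x by apply/ffunP => e; rewrite ffunE muln0 addn0 subn0.
  exact: good_refl.
have good1 := IH (pairing_tail pL) (feasible_tail fL).
have [upl umi dis fe] := pL.
have aP : a \in plus_edges ((a, c) :: L) by apply: mem_head.
have cM : c \in minus_edges ((a, c) :: L) by apply: mem_head.
have fca : fend c = fend a := fe _ (mem_head _ _).
have aL : a \notin plus_edges L by case/andP: upl.
have cL : c \notin minus_edges L by case/andP: umi.
have aL' : a \notin minus_edges L.
  by have := dis a aP; rewrite inE negb_or => /andP[].
have cL' : c \notin plus_edges L.
  by apply: contraL cM => cL'; apply: dis; rewrite inE cL' orbT.
have nca : c != a.
  by have := dis a aP; rewrite inE negb_or eq_sym => /andP[].
have shift_step e : e != a -> e != c -> shift x ((a, c) :: L) t e = shift x L t e.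
  by move=> na nc; rewrite !ffunE !inE (negbTE na) (negbTE nc).
have [Ef|nf] := eqVneq (fend a) f; last first.
  suff -> : xf f (shift x ((a, c) :: L) t) = xf f (shift x L t) by [].
  apply/ffunP => e; rewrite [LHS]ffunE [RHS]ffunE; case: ifP => // fe'.
  apply: shift_step; first by apply: contraNneq nf => <-.
  by apply: contraNneq nf => Ee; rewrite -fca -Ee.
have Et := feasible_tandem fL (mem_head _ _); rewrite /= Ef in Et.
have Bt : inB (inr f) (vadd (xf f x) a t).
  by apply: inB_vadd => //; rewrite ffunE /= Ef eqxx; apply: feasible_cap fL gx aP.
have good2 := good_swap Bz Cz Bt Et.
set v2 := fchoice _ _ in Et good2.
have v2E e : v2 e + (e == c) * t = xf f x e + (e == a) * t.
  move: (congr1 (fun v : vec M => v e) Et); rewrite /= !ffunE.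
  by case: (e == c); case: (e == a); rewrite ?mul1n ?mul0n ?addn0.
have v1E e : e == a \/ e == c -> xf f (shift x L t) e = xf f x e.
  by case=> /eqP ->; rewrite [LHS]ffunE [RHS]ffunE /= ?fca Ef eqxx shift_other.
have [|+ _] := good_comb ax good1 good2 _ Cz.
  move=> e; have [Ea|na] := eqVneq e a; first by left; apply: v1E; rewrite Ea eqxx; left.
  have [Ec|nc] := eqVneq e c; first by left; apply: v1E; rewrite Ec eqxx; right.
  by right; have := v2E e; rewrite (negbTE na) (negbTE nc) !mul0n !addn0.
set v := finfun _; suff -> : v = xf f (shift x ((a, c) :: L) t) by [].
apply/ffunP => e; rewrite [LHS]ffunE; have := v2E e.
have zE d : fend d = f -> forall y : vec M, xf f y d = y d.
  by move=> fd y; rewrite ffunE /= fd eqxx.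
have [Ea|na] := eqVneq e a.
  rewrite v1E; last by rewrite Ea eqxx; left.
  rewrite Ea eq_sym (negbTE nca) (zE a Ef) (zE a Ef) shift_plus //= => E.
  by rewrite -[v2 a]addn0 E mul1n addKn.
have [Ec|nc] := eqVneq e c.
  rewrite v1E; last by rewrite Ec eqxx; right.
  have fc : fend c = f by rewrite fca.
  rewrite Ec (zE c fc) (zE c fc) shift_minus // mul1n mul0n addn0 => <-.
  by rewrite addKn addnK.
rewrite !mul0n !addn0 => ->; rewrite addnK [LHS]ffunE [RHS]ffunE.
by rewrite shift_step.
Qed.

Lemma shift_cap x L t e : g_alloc x -> pairing L -> feasible x L t ->
  shift x L t e <= cap e.
Proof.
move=> gx pL fL; have [eP|eP] := boolP (e \in plus_edges L).
  by rewrite shift_plus // (feasible_cap fL).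
rewrite ffunE (negbTE eP) muln0 addn0.
exact: leq_trans (leq_subr _ _) (galloc_cap gx e).
Qed.

Lemma sum_mem_count (s : seq (edge M)) (P : pred (edge M)) : uniq s ->
  \sum_(e | P e) (e \in s : nat) = count P s.
Proof.
move=> us; rewrite -size_filter -(card_uniqP (filter_uniq P us)) -sum1_card.
rewrite [RHS]big_mkcond [LHS]big_mkcond /=.
by apply: eq_bigr => e _; rewrite mem_filter; case: (e \in s); case: (P e).
Qed.

(** The workers left by the cycle are, up to order, those entered by it. *)
Lemma shift_worker_norm x L t w : g_alloc x -> rotation x L -> feasible x L t ->
  vnorm (xw w (shift x L t)) = vnorm (xw w x).
Proof.
move=> gx rL fL; have pL := rotation_pairing gx rL.
have [up um _ _] := pL.
rewrite !vnorm_restr_w.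
have : \sum_(e | wend e == w) (shift x L t e + t * (e \in minus_edges L)) =
       \sum_(e | wend e == w) (x e + t * (e \in plus_edges L)).
  apply: eq_bigr => e _; rewrite ffunE subnK //.
  have [eM|_] := boolP (e \in minus_edges L); last by rewrite muln0.
  by rewrite muln1 (leq_trans (feasible_pos fL eM)) ?leq_addr.
rewrite !big_split /= -!big_distrr /= !sum_mem_count //.
rewrite !count_map.
have /permP/(_ (pred1 w)) := rotation_wends rL.
by rewrite !count_map => -> /addIn.
Qed.

Section Stable.

Variables (x : vec M) (L : dcycle M) (t : nat).
Hypotheses (sx : stable x) (rL : rotation x L) (fL : feasible x L t).

Let gx := stable_g sx.
Let pL := rotation_pairing gx rL.
Let x' := shift x L t.

Lemma shift_galloc : g_alloc x'.
Proof.
apply/andP; split; first by apply/forallP => e; apply: shift_cap.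
apply/forallP => d; apply/andP; split.
  by apply: restr_inB => e; apply: shift_cap.
case: d => [w|f] /=.
  by rewrite wchoice_below_quota // shift_worker_norm // galloc_quota.
by have [/(better_acc ax) -> _] := shift_good gx pL fL f.
Qed.

Lemma inter_drop e : e \in minus_edges L -> ~~ inter x' e.
Proof.
move=> eM; apply/negP => /(interP ax shift_galloc)[_].
have [/better_drop drop _] := shift_good gx pL fL (fend e).
rewrite drop ?restr_f_edge ?ltnn // shift_minus //.
have := feasible_pos fL eM; have : 0 < t by case/and4P: fL.
lia.
Qed.

(** An edge that has been given up attracts its firm no longer; so the weight of
    [e] has not fallen and [better_keep] applies. *)
Lemma inter_kept e : inter x' e -> inter x e.
Proof.
move=> ie; have eM : e \notin minus_edges L by apply: contraL ie; apply: inter_drop.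
have le_e : x e <= x' e by rewrite ffunE (negbTE eM) muln0 subn0 leq_addr.
have [lt_cap keep] := interP ax shift_galloc _ ie.
apply/(interP ax gx); split; first exact: leq_ltn_trans lt_cap.
have [bet _] := shift_good gx pL fL (fend e).
have := better_keep ax (e := e) bet; rewrite !restr_f_edge; apply=> //.
exact: (inB_offer shift_galloc lt_cap).
Qed.

(** The edge that a worker receives is its best candidate, so afterwards all
    other candidates are still below everything that the worker holds. *)
Lemma shift_stable : stable x'.
Proof.
apply/andP; split; first exact: shift_galloc.
apply/forallP => e; rewrite /blocks negb_and; apply/orP.
have [ie|ni] := boolP (inter x' e); last by right.
left; have [full up] := stable_inter ax sx (inter_kept ie).
have full' : vnorm (xw (wend e) x') = quota (wend e).
  by rewrite shift_worker_norm.
apply: interesting_w_full => // e' we' x'e'.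
have [xe'|/negPn/eqP xe'] := boolP (x e' != 0); first exact: up.
have eP : e' \in plus_edges L.
  apply: contraT => nP; move: x'e'.
  by rewrite ffunE (negbTE nP) xe' muln0 addn0 sub0n.
have [c tac _] := rotation_plus rL eP; have adm := tandem_adm tac.
have ce : W_candidate x (wend e) e.
  apply/(W_candidateP ax); split=> //; last exact: inter_kept.
  case/andP: adm => /(W_candidateP ax)[_ [d wd xd] _ _] _.
  by exists d => //; rewrite wd.
case/andP: adm => _ /forallP/(_ e); rewrite we' ce eq_sym /=.
by case: eqP.
Qed.

End Stable.

End Shift.

(** * The join of two stable allocations *)

Section Join.

Variables (M : market) (ax : market_axioms M).
Implicit Types (e a c l : edge M) (u v x y z : vec M) (w : worker M).
Implicit Types (L : dcycle M).

(** For stable [x] and [y] the total at every vertex is that of [x]; see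
    [join_norms]. *)
Definition join x y : vec M :=
  [ffun e => fchoice (fend e) (vmax (xf (fend e) x) (xf (fend e) y)) e].

Lemma joinC x y : join x y = join y x.
Proof.
apply/ffunP => e; rewrite !ffunE; congr (fchoice _ _ _).
by apply/ffunP => d; rewrite !ffunE maxnC.
Qed.

Lemma leq_sum_eq (I : finType) (F G : I -> nat) : (forall i, F i <= G i) ->
  \sum_i G i <= \sum_i F i -> forall i, F i = G i.
Proof.
move=> FG le_GF i; apply/eqP; rewrite eqn_leq FG leqNgt; apply/negP => lt_i.
move: le_GF; apply/negP; rewrite -ltnNge (bigD1 i) //= [X in _ < X](bigD1 i) //=.
by rewrite -addSn leq_add // leq_sum.
Qed.

Lemma sum_by_worker x : \sum_e x e = \sum_w vnorm (xw w x).
Proof.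
rewrite (partition_big (@wend M) xpredT) //=; apply: eq_bigr => w _.
by rewrite vnorm_restr_w.
Qed.

Lemma sum_by_firm x : \sum_e x e = \sum_f vnorm (xf f x).
Proof.
rewrite (partition_big (@fend M) xpredT) //=; apply: eq_bigr => f _.
by rewrite vnorm_restr_f.
Qed.

Section OneSided.

Variables x y : vec M.
Hypotheses (sx : stable x) (sy : stable y).

Let gx := stable_g sx.
Let gy := stable_g sy.
Let zf f := vmax (xf f x) (xf f y).

Let Bz f : inB (inr f) (zf f).
Proof. by apply: inB_vmax; apply: galloc_inB. Qed.

Let zE e : zf (fend e) e = maxn (x e) (y e).
Proof. by rewrite ffunE !restr_f_edge. Qed.

Lemma join_firm f : xf f (join x y) = fchoice f (zf f).
Proof.
apply/ffunP => e; rewrite ffunE /=; case: eqP => [<-|/eqP ne].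
  by rewrite ffunE.
by rewrite (inB_out (inB_C ax (Bz f)) ne).
Qed.

Lemma join_le e : join x y e <= maxn (x e) (y e).
Proof. by rewrite -zE ffunE C_leE. Qed.

Lemma join_cap e : join x y e <= cap e.
Proof.
by apply: leq_trans (join_le e) _; rewrite geq_max !galloc_cap.
Qed.

Lemma join_firm_norm_ge f : vnorm (xf f x) <= vnorm (xf f (join x y)).
Proof.
by rewrite join_firm -{1}(galloc_firm gx f) C_size // vle_maxl.
Qed.

(** The firm takes [join x y e] units of [e] from an offer above [x + 1^e]; use
    (A2). *)
Lemma join_gt_inter e : x e < join x y e -> inter x e.
Proof.
move=> lt_e; have lt_cap := leq_trans lt_e (join_cap e).
apply/(interP ax gx); split=> //.
have le1 : vle (vadd (xf (fend e) x) e 1) (zf (fend e)).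
  apply/vleP => d; rewrite ffunE; case: eqP => [->|_]; last exact: (vleP _ _ (vle_maxl _ _) d).
  by rewrite zE restr_f_edge addn1; apply: leq_trans lt_e (join_le e).
have := C_subst ax e (Bz _) le1; move: lt_e.
rewrite ffunE -/(zf _) [in X in minn _ X]ffunE eqxx restr_f_edge; lia.
Qed.

End OneSided.

Section TwoSided.

Variables x y : vec M.
Hypotheses (sx : stable x) (sy : stable y).

Let gx := stable_g sx.
Let gy := stable_g sy.
Let J := join x y.

(** An edge [e] on which the firms want more than [x] is ranked by [w] below all
    that [w] holds in [x], and an edge [d] on which they want more than [y] below
    all that [w] holds in [y].  But then [d] is held in [x] and [e] in [y], and
    each would be ranked below the other. *)
Lemma join_one_side w : (forall e, wend e = w -> J e <= x e) \/
  (forall e, wend e = w -> J e <= y e).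
Proof.
have [/forallP all_x|] := boolP [forall e, (wend e == w) ==> (J e <= x e)].
  by left=> e we; apply: (implyP (all_x e)); apply/eqP.
rewrite negb_forall => /existsP[e]; rewrite negb_imply -ltnNge => /andP[/eqP we lt_e].
right=> d wd; rewrite leqNgt; apply/negP => lt_d.
have [_ upe] := stable_inter ax sx (join_gt_inter sx sy lt_e).
rewrite /J joinC in lt_d.
have [_ upd] := stable_inter ax sy (join_gt_inter sy sx lt_d).
have le_e := join_le sx sy e; have le_d := join_le sy sx d.
rewrite joinC in lt_d le_d; rewrite -/J in lt_e lt_d le_e le_d.
rewrite we in upe; rewrite wd in upd.
have xd : x d != 0 by lia.
have ye : y e != 0 by lia.
have := upe d wd xd; have := upd e we ye.
have [E|ne] := eqVneq e d; first by rewrite E in lt_e le_e; lia.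
move=> /= p p'; apply: (pref_anti ax (e := e) (e' := d)); first by rewrite we wd.
  by rewrite we.
by rewrite we.
Qed.

Lemma join_worker_norm_le w : vnorm (xw w J) <= vnorm (xw w x).
Proof.
have [/existsP[e /andP[/eqP we lt_e]]|] := boolP [exists e, (wend e == w) && (x e < J e)].
  have [full _] := stable_inter ax sx (join_gt_inter sx sy lt_e).
  case: (join_one_side w) => [/(_ e we)|le_y]; first by rewrite leqNgt lt_e.
  rewrite we in full; rewrite full; apply: leq_trans (galloc_quota ax gy w).
  by rewrite !vnorm_restr_w; apply: leq_sum => d /eqP; apply: le_y.
rewrite negb_exists => /forallP le_x; rewrite !vnorm_restr_w.
by apply: leq_sum => d wd; have := le_x d; rewrite wd -leqNgt.
Qed.

(** Every worker has at most as much in the join as in [x], every firm at least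
    as much, by (A3); both sums are the sum over all edges. *)
Lemma join_norms : (forall w, vnorm (xw w J) = vnorm (xw w x)) /\
  (forall f, vnorm (xf f x) = vnorm (xf f J)).
Proof.
have le_w := leq_sum (index_enum _) (fun w (_ : true) => join_worker_norm_le w).
have le_f := leq_sum (index_enum _) (fun f (_ : true) => join_firm_norm_ge sx sy f).
rewrite -!sum_by_worker -!sum_by_firm in le_w le_f.
split; apply: leq_sum_eq; [exact: join_worker_norm_le| |exact: join_firm_norm_ge|].
  by rewrite -!sum_by_worker.
by rewrite -!sum_by_firm.
Qed.

End TwoSided.

(** Suppose that the firms can improve on [x] by means of [y].  The workers that
    receive more than in [x] somewhere also lose something; each of them has a
    candidate, and the edge given up in exchange for its best candidate belongs
    to a worker of the same kind.  Following these tandems one finds a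
    rotation. *)
Lemma rotation_of_improvement x y e0 : stable x -> stable y ->
  x e0 < join x y e0 -> exists L, rotation x L.
Proof.
move=> sx sy lt_e0; set J := join x y in lt_e0.
have gx := stable_g sx; have gy := stable_g sy.
have [nw nf] := join_norms sx sy; rewrite -/J in nw nf.
pose W1 w := [exists e, (wend e == w) && (x e < J e)].
have first_a w : W1 w -> exists2 a, W_admissible x a & wend a = w.
  case/existsP => e /andP[/eqP we lt_e].
  have ie := join_gt_inter sx sy lt_e.
  have [full up] := stable_inter ax sx ie.
  have [|a adm [wa _]] := W_admissible_exists ax (x := x) (e := e); last first.
    by exists a => //; rewrite wa.
  apply/(W_candidateP ax); split=> //.
  suff : exists d, (wend d == w) && (x d != 0).
    by case=> d /andP[/eqP wd xd]; exists d; rewrite ?wd.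
  apply/existsP; apply: contraT; rewrite negb_exists => /forallP x0.
  have : vnorm (xw w J) = 0.
    rewrite nw vnorm_restr_w big1 // => d wd; apply/eqP.
    by have := x0 d; rewrite wd negbK.
  by rewrite vnorm_restr_w (bigD1 e) ?we //=; lia.
pose A := [set a | W_admissible x a && W1 (wend a)].
have next_a a : a \in A -> exists2 c, tandem x a c & x c > J c.
  rewrite inE => /andP[adm /existsP[e /andP[/eqP we lt_e]]].
  set f := fend a; set z := xf f x.
  have ie := join_gt_inter sx sy lt_e.
  have ia := W_admissible_inter ax adm.
  have [lt_cap keep] := interP ax gx _ ia.
  have Bza := inB_offer gx lt_cap; rewrite -/f -/z in Bza keep.
  have Bzf : inB (inr f) (vmax z (xf f y)) by apply: inB_vmax; apply: galloc_inB.
  have JE : fchoice f (vmax z (xf f y)) = xf f J by rewrite join_firm.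
  have za : z a = x a by rewrite /z restr_f_edge.
  have ya : xf f y a = y a by rewrite restr_f_edge.
  have [v [Bv zav Cv]] : exists v,
      [/\ inB (inr f) v, vle (vadd z a 1) v & fchoice f v = xf f J].
    have [lt_y|ge_y] := ltnP (x a) (y a).
      exists (vmax z (xf f y)); split=> //.
      by apply: vle_vadd1_max; rewrite za ya.
    have ge_y' : xf f y a <= z a by rewrite za ya.
    pose v := vadd (vmax z (xf f y)) a 1.
    have Bv : inB (inr f) v.
      by rewrite /v vadd1_max //; apply: inB_vmax; rewrite ?galloc_inB.
    have zav : vle (vadd z a 1) v by rewrite vle_vadd2 ?vle_maxl.
    exists v; split=> //.
    have le_v : vle (vmax z (xf f y)) v by apply: vle_vadd.
    have zya : vmax z (xf f y) a = x a by rewrite vmaxE za ya; apply/maxn_idPl.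
    have le_a : fchoice f v a <= x a.
      rewrite leqNgt; apply/negP => gt_a.
      have lt_ycap : y a < cap a by apply: leq_ltn_trans lt_cap.
      have iy : inter y a.
        apply/(interP ax gy); split=> //.
        have le_yv : vle (vadd (xf f y) a 1) v by rewrite vle_vadd2 ?vle_maxr.
        have := C_subst ax a Bv le_yv; rewrite vaddE eqxx ya addn1.
        by move/(leq_trans _); apply; rewrite leq_min ltnSn andbT (leq_ltn_trans ge_y).
      have [_ up] := stable_inter ax sy iy.
      have le_e := join_le sx sy e; rewrite -/J in le_e.
      have lt_ye : x e < y e.
        by move: (leq_trans lt_e le_e); rewrite leq_max ltnn.
      have ye : y e != 0 by rewrite -lt0n (leq_ltn_trans _ lt_ye).
      have := up e we ye; have [E|ne] := eqVneq e a.
        by rewrite E ltnNge ge_y in lt_ye.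
      move=> /= pe; case/andP: adm => ca /forallP/(_ e); rewrite ne andbT.
      have [_ [d wd xd] _ _] := W_candidateP ax _ _ ca.
      have [full upx] := stable_inter ax sx ie.
      have -> /= : W_candidate x (wend a) e.
        by rewrite -we; apply/(W_candidateP ax); split=> //; exists d; rewrite ?we.
      by move=> pa; case: (pref_anti ax (esym we) pa pe).
    rewrite -JE; symmetry; apply: (C_cons ax Bv) => //.
    apply/vleP => d; have [->|ne] := eqVneq d a.
      by rewrite zya.
    by have := C_leE ax d Bv; rewrite vaddE (negbTE ne).
  have sz : vnorm (fchoice f (vadd z a 1)) <= vnorm z.
    by rewrite (leq_trans (C_size ax Bv zav)) // Cv nf.
  rewrite -{1}za in keep.
  have [c [fc nca Ec]] :=
    exchange ax (galloc_inB gx (inr f)) (galloc_firm gx f) Bza sz keep.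
  exists c.
    by apply/and4P; split=> //; apply/eqP.
  have := C_subst ax c Bv zav; rewrite Cv.
  move: (congr1 (fun v : vec M => v c) Ec); rewrite /= -/z.
  rewrite vaddE eqxx vaddE (negbTE nca).
  rewrite ![restr _ _ c]ffunE /= fc eqxx; clear; lia.
have more_elsewhere c : J c < x c -> W1 (wend c).
  move=> lt_c; apply: contraT; rewrite negb_exists => /forallP le_J.
  have : vnorm (xw (wend c) J) < vnorm (xw (wend c) x).
    rewrite !vnorm_restr_w (bigD1 c) //= [X in _ < X](bigD1 c) //= -addSn.
    rewrite leq_add //; apply: leq_sum => d /andP[wd _].
    by have := le_J d; rewrite wd -leqNgt.
  by rewrite nw ltnn.
have [a0 adm0 wa0] : exists2 a, W_admissible x a & wend a = wend e0.
  by apply: first_a; apply/existsP; exists e0; rewrite eqxx.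
have [|a|L rL _] := @rotation_within M ax x A a0; last by exists L.
  by rewrite inE adm0 wa0; apply/existsP; exists e0; rewrite eqxx.
move=> aA; have [c tac lt_c] := next_a a aA; exists c => //.
have [|a' adm' wa'] := first_a (wend c); last first.
  exists a' => //; rewrite inE adm' wa' /=.
  exact: more_elsewhere lt_c.
exact: more_elsewhere lt_c.
Qed.

(** Without rotations the join with [y] exceeds [x] nowhere, and it has the same
    totals, so it is [x]. *)
Lemma max_of_no_rotation x : stable x -> (forall L, ~ rotation x L) ->
  is_max_stable x.
Proof.
move=> sx norot; split=> // y sy; have gx := stable_g sx.
have gy := stable_g sy; have [_ nf] := join_norms sx sy.
have le_J e : join x y e <= x e.
  rewrite leqNgt; apply/negP => /(rotation_of_improvement sx sy)[L].
  exact: norot.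
have Jx f : fchoice f (vmax (xf f x) (xf f y)) = xf f x.
  rewrite -(join_firm sx sy); apply: vle_norm_eq; last by rewrite nf.
  by apply/vleP => e; rewrite [X in X <= _]ffunE [X in _ <= X]ffunE; case: ifP.
have [->|ne] := eqVneq y x; [by left | right].
rewrite /fprec gx gy ne; apply/forallP => f.
have [//|nf'] := eqVneq (xf f y) (xf f x).
rewrite /vprec nf' /= Jx eqxx andbT.
by case/andP: gy => _ /forallP ->; case/andP: gx => _ /forallP ->.
Qed.

End Join.

(** * Feasible weights and the gapless condition *)

Section Feasibility.

Variables (M : market) (ax : market_axioms M).
Implicit Types (e a c l : edge M) (u v x y z : vec M) (w : worker M).
Implicit Types (L K : dcycle M) (s : seq (dcycle M * nat)).

Lemma rotation_feasible1 x L : rotation x L -> feasible x L 1.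
Proof.
move=> rL; apply/and4P; split=> //; apply/allP => e.
- by case/(rotation_minus rL) => a ta _; apply: tandem_pos ta.
- by case/(rotation_plus rL) => c ta _; rewrite subn_gt0; apply: tandem_lt_cap ta.
- by move=> /(rotation_tandem rL)/tandemE /= ->.
Qed.

Lemma feasible_downward x L t t' : g_alloc x -> rotation x L -> feasible x L t ->
  0 < t' <= t -> feasible x L t'.
Proof.
move=> gx rL fL /andP[t'_gt0 le_t].
apply/and4P; split=> //; apply/allP => e eL.
- exact: leq_trans le_t (feasible_pos fL eL).
- rewrite leq_subRL ?galloc_cap //.
  by apply: leq_trans (feasible_cap fL gx eL); rewrite leq_add2l.
- have te := rotation_tandem rL eL; apply/eqP.
  apply: (C_exchange_downward ax (f := fend e.1) (t := t)) => //.
  + exact: galloc_inB.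
  + exact: galloc_firm.
  + apply: inB_vadd => //; first exact: galloc_inB.
    by rewrite restr_f_edge; apply: (feasible_cap fL gx); apply: map_f.
  + exact: tandem_neq te.
  + exact: feasible_tandem fL eL.
Qed.

Lemma feasible_bounded x L t : rotation x L -> feasible x L t ->
  t <= \sum_(e : edge M) cap e.
Proof.
move=> rL fL; have [p pL] : exists p, p \in L.
  by case/andP: rL => /and3P[]; case: (L) => // p ? _ _ _ _; exists p; apply: mem_head.
case/and4P: fL => _ _ /allP/(_ p.1 (map_f _ pL)) le_t _.
by rewrite (bigD1 p.1) //= (leq_trans le_t) // (leq_trans (leq_subr _ _)) ?leq_addr.
Qed.

Lemma max_feasible_exists x L : rotation x L -> exists t, max_feasible x L t.
Proof.
move=> rL.
have [t ft mt] := ex_maxnP (ex_intro (feasible x L) 1 (rotation_feasible1 rL))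
  (fun t => @feasible_bounded x L t rL).
by exists t.
Qed.

(** Offering the units of [a] one after the other leads to the same vector as
    offering them together, by (A1). *)
Lemma exchange_succ f z a c t : inB (inr f) (vadd z a t.+1) -> fend a = f ->
    c != a ->
    vadd (fchoice f (vadd z a t)) c t = vadd z a t ->
    let v := fchoice f (vadd z a t) in
    vadd (fchoice f (vadd v a 1)) c 1 = vadd v a 1 ->
  vadd (fchoice f (vadd z a t.+1)) c t.+1 = vadd z a t.+1.
Proof.
move=> Bu fa nca Et v E1; set u := vadd z a t.+1.
have vE e : v e + (e == c) * t = z e + (e == a) * t.
  move: (congr1 (fun v : vec M => v e) Et); rewrite !vaddE -/v.
  by case: (e == c); case: (e == a); rewrite ?mul1n ?mul0n ?addn0.
have le_u : vle (vadd z a t) u.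
  by apply/vleP => e; rewrite !vaddE; case: eqP => // _; rewrite leq_add2l.
have Cu : fchoice f (vadd v a 1) = fchoice f u.
  apply: (C_cons ax Bu).
    apply/vleP => e; have := vE e; rewrite !vaddE; case: (e == a); case: (e == c);
    clear; lia.
  apply/vleP => e; have := C_subst ax e Bu le_u; have := C_leE ax e Bu.
  have := vE e; rewrite -/v !vaddE; have [->|nea] := eqVneq e a.
    by rewrite eq_sym (negbTE nca); clear; lia.
  by clear; lia.
apply/ffunP => e; have := vE e.
move: (congr1 (fun v : vec M => v e) E1); rewrite Cu !vaddE.
case: (e == a); case: (e == c); clear; lia.
Qed.

Lemma vprec_good f z v : fchoice f z = z -> good f z v -> z != v ->
  vprec (inr f) z v.
Proof.
move=> Cz [zv _] ne; have [Bz Bv E] := zv; have Cv := better_acc ax zv.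
rewrite /vprec /acceptable Bz Bv /= Cz Cv !eqxx ne /=.
suff -> : vmax v z = vmax z v by rewrite E.
by apply/ffunP => e; rewrite !vmaxE maxnC.
Qed.

Hypothesis gl : gapless M.

(** How (C) is used: if [f] still exchanges [a] for [c] at some [y] beyond the
    vector reached after exchanging [t] units of [c] for [a], then it would
    not switch to another edge at that vector. *)
Lemma gapless_extend f z a c t y : inB (inr f) z -> fchoice f z = z ->
    fend a = f -> fend c = f -> c != a -> 0 < t ->
    inB (inr f) (vadd z a t.+1) ->
    vadd (fchoice f (vadd z a 1)) c 1 = vadd z a 1 ->
    vadd (fchoice f (vadd z a t)) c t = vadd z a t ->
    let v := fchoice f (vadd z a t) in
    good f v y -> v a <= y a -> inB (inr f) (vadd y a 1) ->
    vadd (fchoice f (vadd y a 1)) c 1 = vadd y a 1 ->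
  vadd (fchoice f (vadd z a t.+1)) c t.+1 = vadd z a t.+1.
Proof.
move=> Bz Cz fa fc nca t_gt0 Bt1 E1 Et v vy le_a By1 Ey.
have Bt : inB (inr f) (vadd z a t).
  apply: inB_vle Bt1 _; apply/vleP => e; rewrite !vaddE.
  by case: eqP => // _; rewrite leq_add2l.
have zv : good f z v by apply: (good_swap ax Bz Cz Bt Et).
have [[_ Bv _] _] := zv; have [[_ By _] _] := vy.
have Cv : fchoice f v = v by apply: C_idem.
have Cy : fchoice f y = y by case: vy => /(better_acc ax).
have vE e : v e + (e == c) * t = z e + (e == a) * t.
  move: (congr1 (fun v : vec M => v e) Et); rewrite !vaddE -/v.
  by case: (e == c); case: (e == a); rewrite ?mul1n ?mul0n ?addn0.
have lt_cap d : inB (inr f) (vadd d a 1) -> d a < cap a.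
  by move/forallP/(_ a); rewrite vaddE eqxx /= fa eqxx addn1.
have pos (d : vec M) c' : c' != a ->
    vadd (fchoice f (vadd d a 1)) c' 1 = vadd d a 1 -> 0 < d c'.
  move=> ne /(congr1 (fun v : vec M => v c')).
  by rewrite /= !vaddE eqxx (negbTE ne) => <-; rewrite addn1.
apply: exchange_succ => //; rewrite -/v.
have [c3 [fc3 nc3 E3]] := good_exchange ax vy Cv le_a By1 nca Ey.
suff -> : c = c3 by [].
have uniq_c (d : vec M) c1 c2 :
    vadd (fchoice f (vadd d a 1)) c1 1 = vadd d a 1 ->
    vadd (fchoice f (vadd d a 1)) c2 1 = vadd d a 1 -> c1 = c2.
  move=> Ed1 Ed2; have := congr1 (fun v : vec M => v c1) (etrans Ed1 (esym Ed2)).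
  by rewrite /= !(vaddE (fchoice _ _)) eqxx; case: eqP => // _; clear; lia.
have [Evy|ne_vy] := eqVneq v y; first by rewrite -Evy in Ey; apply: uniq_c Ey E3.
have ne_zv : z != v.
  apply/eqP => Ezv; have := vE a; rewrite -Ezv eq_sym (negbTE nca) eqxx.
  by move: t_gt0; clear; lia.
have Bz1 : inB (inr f) (vadd z a 1).
  apply: inB_vle Bt1 _; apply/vleP => e; rewrite !vaddE.
  by case: eqP => // _; rewrite leq_add2l.
have Bv1 : inB (inr f) (vadd v a 1).
  apply: inB_vadd => //; have := vE a; rewrite eq_sym (negbTE nca) eqxx mul0n mul1n addn0 => ->.
  by move/forallP: Bt1 => /(_ a); rewrite vaddE eqxx /= fa eqxx addn1 addnS.
apply: (gl (f := f) (z1 := z) (z2 := v) (z3 := y) (a := a) (c3 := c)) => //.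
- by rewrite /acceptable Bz /= Cz.
- by rewrite /acceptable Bv /= Cv.
- by rewrite /acceptable By /= Cy.
- exact: vprec_good.
- exact: vprec_good.
- by rewrite /abstract_tandem fa fc !eqxx lt_cap // E1 eqxx (pos _ _ nca E1).
- by rewrite /abstract_tandem fa fc3 !eqxx lt_cap // E3 eqxx (pos _ _ nc3 E3).
- by rewrite /abstract_tandem fa fc !eqxx lt_cap // Ey eqxx (pos _ _ nca Ey).
Qed.

End Feasibility.

(** * Rotations at the same allocation commute *)

Section Commute.

Variables (M : market) (ax : market_axioms M).
Implicit Types (e a c l : edge M) (u v x y z : vec M) (w : worker M).
Implicit Types (L K : dcycle M) (s : seq (dcycle M * nat)).

(** The shape in which [good_comb] adds two improvements. *)
Lemma shift_cat x L1 L2 t1 t2 e : pairing (L1 ++ L2) -> feasible x L1 t1 ->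
  feasible x L2 t2 ->
  shift (shift x L1 t1) L2 t2 e + x e = shift x L1 t1 e + shift x L2 t2 e /\
  (shift x L1 t1 e = x e \/ shift x L2 t2 e = x e).
Proof.
rewrite /pairing /plus_edges /minus_edges !map_cat => -[up um dis _] f1 f2.
rewrite !cat_uniq in up um; case/and3P: up => _ /hasPn hp _.
case/and3P: um => _ /hasPn hm _; move: hp hm => /(_ e) hp /(_ e) hm.
have {dis} := dis e; rewrite !mem_cat.
have := @feasible_pos M x L1 t1 e f1; have := @feasible_pos M x L2 t2 e f2.
move: hp hm; rewrite !ffunE /= /plus_edges /minus_edges.
case: (e \in map fst L1); case: (e \in map fst L2);
  case: (e \in map snd L1); case: (e \in map snd L2) => /=; clear => h1 h2 h3 h4 h5;
  try (by have := h1 isT); try (by have := h2 isT); try (by have := h5 isT);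
  try have {}h3 := h3 isT; try have {}h4 := h4 isT;
  rewrite ?muln0 ?muln1 ?addn0 ?subn0; lia.
Qed.

Lemma shift_comm x L1 L2 t1 t2 : pairing (L1 ++ L2) -> feasible x L1 t1 ->
  feasible x L2 t2 ->
  shift (shift x L1 t1) L2 t2 = shift (shift x L2 t2) L1 t1.
Proof.
rewrite /pairing /plus_edges /minus_edges => pr f1 f2.
have pr' : pairing (L2 ++ L1).
  move: pr; rewrite /pairing /plus_edges /minus_edges !map_cat => -[up um dis fe].
  split; [by rewrite uniq_catC|by rewrite uniq_catC| |].
    by move=> e; rewrite !mem_cat orbC [_ || (e \in map snd _)]orbC -!mem_cat; apply: dis.
  by move=> p; rewrite mem_cat orbC -mem_cat; apply: fe.
apply/ffunP => e; have [E1 _] := shift_cat e pr f1 f2.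
have [E2 _] := shift_cat e pr' f2 f1.
by apply: (@addIn (x e)); rewrite E1 E2 addnC.
Qed.

Lemma pairing_sub L1 L2 : pairing (L1 ++ L2) -> pairing L1 /\ pairing L2.
Proof.
rewrite /pairing /plus_edges /minus_edges !map_cat !cat_uniq.
case=> /and3P[u1 _ u2] /and3P[m1 _ m2] dis fe; split; split=> // e eL.
- by have := dis e; rewrite !mem_cat eL negb_or => /(_ isT) /andP[].
- by apply: fe; rewrite mem_cat eL.
- by have := dis e; rewrite !mem_cat eL orbT negb_or => /(_ isT) /andP[].
- by apply: fe; rewrite mem_cat eL orbT.
Qed.

Lemma shift_good_cat x L1 L2 t1 t2 : g_alloc x -> pairing (L1 ++ L2) ->
  feasible x L1 t1 -> feasible x L2 t2 -> forall f,
  good f (xf f (shift x L1 t1)) (xf f (shift (shift x L1 t1) L2 t2)).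
Proof.
move=> gx pr f1 f2 f; have [p1 p2] := pairing_sub pr.
have [|_] := good_comb ax (shift_good ax gx p1 f1 f) (shift_good ax gx p2 f2 f)
  _ (galloc_firm gx f).
  move=> e; rewrite ![restr _ _ e]ffunE; case: ifP; last by left.
  by have [_] := shift_cat e pr f1 f2.
set v := finfun _; suff -> : v = xf f (shift (shift x L1 t1) L2 t2) by [].
apply/ffunP => e; rewrite [LHS]ffunE ![restr _ _ e]ffunE; case: ifP => // _.
by have [<- _] := shift_cat e pr f1 f2; rewrite addnK.
Qed.

Lemma feasible_one x L t p : feasible x L t -> p \in L -> feasible x [:: p] t.
Proof.
case/and4P=> t0 /allP h1 /allP h2 /allP h3 pL.
by apply/and4P; rewrite /= !andbT; split=> //; [apply: h1|apply: h2|apply: h3]; rewrite ?map_f.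
Qed.

(** This makes condition (C), which is about single tandems, applicable to
    shifts. *)
Lemma shift1_firm x p t : g_alloc x -> pairing [:: p] -> feasible x [:: p] t ->
  xf (fend p.1) (shift x [:: p] t) =
  fchoice (fend p.1) (vadd (xf (fend p.1) x) p.1 t).
Proof.
move=> gx pr fp; have := feasible_tandem fp (mem_head _ _); rewrite /=.
move=> E; apply/ffunP => e; move: (congr1 (fun v : vec M => v e) E).
have [_ _ dis fe] := pr; have nca : p.2 != p.1.
  by have := dis p.1; rewrite !inE eqxx eq_sym => /(_ isT).
have fc := fe p (mem_head _ _).
have le_t := feasible_pos fp (mem_head _ _ : p.2 \in minus_edges [:: p]).
rewrite /= !(vaddE _ _ _ e) [in RHS]ffunE [restr _ _ e]ffunE /=.
rewrite [shift _ _ _ e]ffunE !inE.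
have [->|ne2] := eqVneq e p.2.
  rewrite (negbTE nca) fc eqxx muln0 muln1 addn0 => E'.
  by rewrite -E' addnK.
have [->|ne1] := eqVneq e p.1; first by rewrite eqxx muln1 muln0 subn0.
by rewrite muln0 addn0 subn0; case: ifP.
Qed.

Section Step.

Variables (x : vec M) (L1 L2 : dcycle M) (t1 : nat).
Hypotheses (sx : stable x) (r1 : rotation x L1) (r2 : rotation x L2).
Hypotheses (ne : ~ same_cycle L1 L2) (f1 : feasible x L1 t1).

Let gx := stable_g sx.
Let x1 := shift x L1 t1.
Let sx1 : stable x1 := shift_stable ax sx r1 f1.
Let gx1 := stable_g sx1.

Lemma pairing_two : pairing (L1 ++ L2).
Proof.
have [u1 m1 d1 fe1] := rotation_pairing ax gx r1.
have [u2 m2 d2 fe2] := rotation_pairing ax gx r2.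
split.
- rewrite /plus_edges map_cat cat_uniq u1 u2 andbT /=; apply/hasPn => e eL2.
  by apply/negP => eL1; apply: ne; exact: (rotation_same_plus ax r1 r2 eL1 eL2).
- rewrite /minus_edges map_cat cat_uniq m1 m2 andbT /=; apply/hasPn => e eL2.
  by apply/negP => eL1; apply: ne; exact: (rotation_same_minus ax r1 r2 eL1 eL2).
- move=> e; rewrite /plus_edges /minus_edges !map_cat !mem_cat negb_or.
  move=> eP; apply/andP; split; apply/negP => eM;
    by case/orP: eP => eP; apply: (rotation_disjoint ax gx _ _ eP eM).
- by move=> p; rewrite mem_cat => /orP[/fe1|/fe2].
Qed.

Let off1 e : e \in plus_edges L2 \/ e \in minus_edges L2 -> x1 e = x e.
Proof.
move=> eL; have [up um dis _] := pairing_two.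
rewrite /plus_edges /minus_edges !map_cat !cat_uniq in up um dis.
case/and3P: up => _ /hasPn hp _; case/and3P: um => _ /hasPn hm _.
apply: shift_other; case: eL => eL.
- exact: hp eL.
- by apply: contraL eL => eL; have := dis e; rewrite !mem_cat eL negb_or => /(_ isT) /andP[].
- by have := dis e; rewrite !mem_cat eL orbT negb_or => /(_ isT) /andP[].
- exact: hm eL.
Qed.

Lemma pairing_one p : p \in L2 -> pairing (L1 ++ [:: p]).
Proof.
move=> pL; have [up um dis fe] := pairing_two.
rewrite /plus_edges /minus_edges !map_cat !cat_uniq in up um dis.
case/and3P: up => u1 /hasPn hp _; case/and3P: um => m1 /hasPn hm _.
have p1 : p.1 \in map fst L2 by apply: map_f.
have p2 : p.2 \in map snd L2 by apply: map_f.
split; rewrite /plus_edges /minus_edges ?map_cat ?cat_uniq ?u1 ?m1 /= ?orbF ?andbT.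
- exact: hp.
- exact: hm.
- move=> e; have := dis e; rewrite !mem_cat !inE !negb_or => D /orP[e1|/eqP E].
    have /andP[-> D2] := D (introT orP (or_introl e1)).
    by apply: contraNneq D2 => ->.
  rewrite E p1 orbT in D *; have /andP[-> D2] := D isT.
  by apply: contraNneq D2 => ->.
- by move=> q; rewrite mem_cat inE => /orP[q1|/eqP->]; apply: fe; rewrite mem_cat ?q1 ?pL ?orbT.
Qed.

(** By [good_comb] the firm of a tandem of [L2] carries out its exchange on top of
    the shift along [L1]. *)
Lemma feasible_after t : feasible x L2 t -> feasible x1 L2 t.
Proof.
move=> f2; have [t0 h1 h2 h3] := and4P f2.
apply/and4P; split=> //.
- by apply/allP => e eL; rewrite off1 ?(allP h1) //; right.
- by apply/allP => e eL; rewrite off1 ?(allP h2) //; left.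
apply/allP => p pL /=; have pr := pairing_one pL.
have fp := feasible_one f2 pL; have [_ prp] := pairing_sub pr.
set f := fend p.1.
have [[B1 B12 E] _] := shift_good_cat gx pr f1 fp f; rewrite -/x1 in E B1 B12.
have fc : fend p.2 = f by have [_ _ _ fe] := prp; apply: fe (mem_head _ _).
have nca : p.2 != p.1.
  by have [_ _ dis _] := prp; have := dis p.1; rewrite !inE eqxx eq_sym => /(_ isT).
have x1p1 : x1 p.1 = x p.1 by apply: off1; left; apply: map_f.
have x1p2 : x1 p.2 = x p.2 by apply: off1; right; apply: map_f.
have le_t := feasible_pos fp (mem_head _ _ : p.2 \in minus_edges [:: p]).
have swE e : xf f (shift x1 [:: p] t) e + (e == p.2) * t = xf f x1 e + (e == p.1) * t.
  rewrite ![restr _ _ e]ffunE /=; have [Ee2|ne2] := eqVneq e p.2.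
    rewrite Ee2 fc eqxx ffunE !inE eqxx (negbTE nca) muln0 muln1 mul1n mul0n !addn0.
    by rewrite subnK // x1p2.
  have [Ee1|ne1] := eqVneq e p.1.
    rewrite Ee1 in ne2 *.
    by rewrite eqxx ffunE !inE (negbTE ne2) eqxx muln0 muln1 mul1n mul0n addn0 subn0.
  rewrite !mul0n !addn0; case: ifP => // _.
  by rewrite ffunE !inE (negbTE ne1) (negbTE ne2) !muln0 addn0 subn0.
have Emax : vmax (xf f x1) (xf f (shift x1 [:: p] t)) = vadd (xf f x1) p.1 t.
  apply/ffunP => e; have := swE e; rewrite vmaxE vaddE.
  have [->|_] := eqVneq e p.1; first by rewrite eq_sym (negbTE nca); clear; lia.
  by case: (e == p.2); clear; lia.
apply/eqP; rewrite -/f -Emax E; apply/ffunP => e; have := swE e.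
rewrite !vaddE vmaxE; have [->|_] := eqVneq e p.1.
  by rewrite eq_sym (negbTE nca); clear; lia.
by case: (e == p.2); clear; lia.
Qed.

Let xw_off p : p \in L2 -> xw (wend p.1) x1 = xw (wend p.1) x.
Proof.
move=> pL; apply/ffunP => e; rewrite ![restr _ _ e]ffunE; case: ifP => // /eqP we.
have tp := rotation_tandem r2 pL.
apply: shift_other; apply/negP => eL; apply: ne.
  have [c tec _] := rotation_plus r1 eL.
  have Ee := W_admissible_uniq ax we (tandem_adm tec) (tandem_adm tp).
  by apply: (rotation_same_plus ax r1 r2 eL); rewrite Ee map_f.
have [a tae aL] := rotation_minus r1 eL; have [q qL /= Eq] := rotation_next r1 aL.
have tq := rotation_tandem r1 qL; rewrite we in Eq.
have Ee := W_admissible_uniq ax Eq (tandem_adm tp) (tandem_adm tq).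
by apply: (rotation_same_plus ax r1 r2 (map_f fst qL)); rewrite -Ee map_f.
Qed.

(** The workers of [L2] are not touched by [L1], and by [inter_kept] they get no
    new candidates. *)
Lemma rotation_after : rotation x1 L2.
Proof.
have fe1 := feasible_after (rotation_feasible1 ax r2).
case/andP: r2 => /and3P[L0 aL cL] uL; apply/andP; split=> //.
apply/and3P; split=> //; apply/allP => p pL.
have tp := rotation_tandem r2 pL.
have E1 := feasible_tandem fe1 pL; rewrite /= in E1.
have lt_cap : x1 p.1 < cap p.1.
  by rewrite off1; [apply: (tandem_lt_cap ax tp) | left; apply: map_f].
have ip : inter x1 p.1.
  apply/(interP ax gx1); split=> //.
  move: (congr1 (fun v : vec M => v p.1) E1); rewrite !vaddE eqxx restr_f_edge.
  by rewrite eq_sym (negbTE (tandem_neq tp)) => ->; rewrite addn1.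
have xwE := xw_off pL.
have x1E e : wend e = wend p.1 -> x1 e = x e.
  by move=> we; move: (congr1 (fun v : vec M => v e) xwE); rewrite !ffunE /= we eqxx.
have upE e : supp_upto (wend p.1) x e -> supp_upto (wend p.1) x1 e.
  by move=> up d wd; rewrite x1E //; apply: up.
have upE' e : supp_upto (wend p.1) x1 e -> supp_upto (wend p.1) x e.
  by move=> up d wd; rewrite -x1E //; apply: up.
apply/and4P; split.
- case/andP: (tandem_adm tp) => cp /forallP mp; apply/andP; split.
    case/(W_candidateP ax): cp => full [d wd xd] up _.
    apply/(W_candidateP ax); split; rewrite ?xwE //; last exact: upE.
    by exists d; rewrite ?x1E.
  apply/forallP => e; apply/implyP => /andP[ce nep].
  have we : wend e = wend p.1 by case/and4P: ce => /eqP.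
  have := mp e; rewrite nep andbT => /implyP; apply.
  rewrite -we in ce *; case/(W_candidateP ax): ce => full [d wd xd] up ie.
  apply/(W_candidateP ax); split.
  + by rewrite we -xwE -we.
  + by exists d => //; rewrite -x1E // wd.
  + by rewrite we; apply: upE'; rewrite -we.
  + exact: inter_kept r1 f1 _ ie.
- by apply/eqP; apply: tandem_firm tp.
- exact: tandem_neq tp.
- by apply/eqP.
Qed.

Hypothesis gl : gapless M.

(** Without (C) the firm could stop giving up [c] for [a] earlier at [x] than at
    [x1], and the maximal weight of [L2] would depend on whether [L1] has been
    used before. *)
Lemma feasible_before t : feasible x L2 t -> feasible x1 L2 t.+1 ->
  feasible x L2 t.+1.
Proof.
move=> f2 f2'; have t_gt0 : 0 < t by case/and4P: f2.
apply/and4P; split=> //.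
- by apply/allP => e eL; rewrite -off1 ?(feasible_pos f2') //; right.
- apply/allP => e eL; rewrite -off1; last by left.
  by case/and4P: f2' => _ _ /allP h _; apply: h.
apply/allP => p pL /=; have pr := pairing_one pL.
have fp := feasible_one f2 pL; have [_ prp] := pairing_sub pr.
have tp := rotation_tandem r2 pL; have r2' := rotation_after.
have fc := tandem_firm tp; have nca := tandem_neq tp; set f := fend p.1.
have p1L : p.1 \in plus_edges L2 by apply: map_f.
have p2L : p.2 \in minus_edges L2 by apply: map_f.
have x1p1 : x1 p.1 = x p.1 by apply: off1; left.
have x1p2 : x1 p.2 = x p.2 by apply: off1; right.
have [p2' p1'] : t.+1 <= x1 p.2 /\ x1 p.1 + t.+1 <= cap p.1.
  by split; [apply: feasible_pos f2' p2L|apply: feasible_cap f2' gx1 p1L].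
have f2'' := feasible_downward ax gx1 r2' f2' (introT andP (conj t_gt0 (leqnSn t))).
have fp'' := feasible_one f2'' pL.
have yE := shift1_firm gx1 prp fp''; have vE := shift1_firm gx prp fp.
rewrite -/f in yE vE; set y := xf f (shift x1 [:: p] t) in yE.
have Bx1 : inB (inr f) (vadd (xf f x1) p.1 t.+1).
  apply: inB_vadd => //; first exact: galloc_inB.
  by rewrite restr_f_edge.
have le_t1 : vle (vadd (xf f x1) p.1 t) (vadd (xf f x1) p.1 t.+1).
  by apply/vleP => e; rewrite !vaddE; case: eqP => // _; rewrite leq_add2l.
have Bx1t := inB_vle Bx1 le_t1.
have Et := feasible_tandem f2'' pL; rewrite /= -/f -yE in Et.
have Et1 := feasible_tandem f2' pL; rewrite /= -/f in Et1.
have yp e : y e + (e == p.2) * t = xf f x1 e + (e == p.1) * t.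
  move: (congr1 (fun v : vec M => v e) Et); rewrite !vaddE.
  by case: (e == p.2); case: (e == p.1); rewrite ?mul1n ?mul0n ?addn0.
have ypS e : fchoice f (vadd (xf f x1) p.1 t.+1) e + (e == p.2) * t.+1 =
    xf f x1 e + (e == p.1) * t.+1.
  move: (congr1 (fun v : vec M => v e) Et1); rewrite !vaddE.
  by case: (e == p.2); case: (e == p.1); rewrite ?mul1n ?mul0n ?addn0.
have le_y1 : vle (vadd y p.1 1) (vadd (xf f x1) p.1 t.+1).
  apply/vleP => e; have := yp e; rewrite !vaddE.
  by case: (e == p.2); case: (e == p.1); clear; lia.
have Cy1 : fchoice f (vadd y p.1 1) = fchoice f (vadd (xf f x1) p.1 t.+1).
  apply: (C_cons ax Bx1) => //; apply/vleP => e; have := yp e; have := ypS e.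
  rewrite vaddE; have [->|_] := eqVneq e p.1; last by case: (e == p.2); clear; lia.
  by rewrite eq_sym (negbTE nca); clear; lia.
apply/eqP; apply: (gapless_extend ax gl (f := f) (y := y)) => //.
- exact: galloc_inB.
- exact: galloc_firm.
- apply: inB_vadd => //; first exact: galloc_inB.
  by rewrite restr_f_edge -x1p1.
- exact: tandemE tp.
- exact: feasible_tandem f2 pL.
- rewrite -vE /y; have pr' : pairing ([:: p] ++ L1).
    move: pr; rewrite /pairing /plus_edges /minus_edges !map_cat => -[up um dis fe].
    split; [by rewrite uniq_catC|by rewrite uniq_catC| |].
      by move=> e; rewrite !mem_cat orbC [_ || (e \in map snd L1)]orbC -!mem_cat; apply: dis.
    by move=> q; rewrite mem_cat orbC -mem_cat; apply: fe.
  by rewrite (shift_comm pr f1 fp); apply: shift_good_cat.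
- have := yp p.1; rewrite -vE /y ![restr _ _ p.1]ffunE eqxx.
  rewrite eq_sym (negbTE nca) /= eqxx.
  rewrite (shift_plus (L := [:: p]) x t prp (mem_head _ _)) -x1p1.
  by rewrite mul0n mul1n addn0 => ->.
- exact: inB_vle Bx1 le_y1.
- rewrite Cy1; apply/ffunP => e; have := ypS e; have := yp e; rewrite !vaddE.
  have [->|_] := eqVneq e p.1; last by case: (e == p.2); clear; lia.
  by rewrite eq_sym (negbTE nca); clear; lia.
Qed.

Lemma max_feasible_after t : max_feasible x L2 t -> max_feasible x1 L2 t.
Proof.
case=> f2 m2; split; first exact: feasible_after.
move=> t' f'; rewrite leqNgt; apply/negP => lt_t.
have : feasible x L2 t.+1.
  apply: feasible_before => //.
  by apply: (feasible_downward ax gx1 rotation_after f').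
by move/m2; rewrite ltnn.
Qed.

End Step.

End Commute.

(** * Routes *)

Section Routes.

Variables (M : market) (ax : market_axioms M) (gl : gapless M).
Implicit Types (e a c l : edge M) (u v x y z : vec M) (w : worker M).
Implicit Types (L K : dcycle M) (s : seq (dcycle M * nat)).
Implicit Types (P : dcycle M -> Prop).

Lemma route_consE x L t s y : route x ((L, t) :: s) y ->
  [/\ stable x, rotation x L, max_feasible x L t & route (shift x L t) s y].
Proof.
move=> r; inversion r as [|? ? ? ? ? sx rL]; subst; split=> //.
by apply/(rotation_atP ax).
Qed.

Lemma route_consI x L t s y : stable x -> rotation x L -> max_feasible x L t ->
  route (shift x L t) s y -> route x ((L, t) :: s) y.
Proof.
move=> sx rL mt r; apply: route_cons => //.
by apply/(rotation_atP ax).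
Qed.

Lemma route_nilE x y : route x [::] y -> x = y.
Proof. by move=> r; inversion r. Qed.

Lemma route_start x s y : route x s y -> stable x.
Proof. by case. Qed.

Lemma route_end x s y : route x s y -> stable y.
Proof. by elim. Qed.

Lemma route_cat x s y s' z : route x s y -> route y s' z -> route x (s ++ s') z.
Proof. by elim=> // {}x L t {}s {}y sx rL mt _ IH /IH; apply: route_cons. Qed.

Lemma route_catE x s s' z : route x (s ++ s') z ->
  exists2 y, route x s y & route y s' z.
Proof.
elim: s x => [|[L t] s IH] x /=.
  by move=> r; exists x => //; apply: route_nil; apply: route_start r.
case/route_consE=> sx rL mt /IH[y r r']; exists y => //.
exact: route_consI.
Qed.

Lemma route_rcons x s y L t : route x s y -> rotation y L -> max_feasible y L t ->
  route x (rcons s (L, t)) (shift y L t).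
Proof.
move=> r rL mt; rewrite -cats1; apply: route_cat (r) _.
have sy := route_end r; apply: route_consI => //; apply: route_nil.
by apply: shift_stable => //; case: mt.
Qed.

(** By [inter_kept] interest is only lost, and by [inter_drop] the weight of an
    edge does not fall before. *)
Lemma route_inter x s y e : route x s y -> inter y e -> inter x e /\ x e <= y e.
Proof.
elim: s x => [|[L t] s IH] x; first by move/route_nilE->.
case/route_consE=> sx rL [ft _] r iy; have [ix' le_e] := IH _ r iy.
split; first exact: (inter_kept ax sx rL ft ix').
apply: leq_trans le_e; rewrite ffunE; have eM : e \notin minus_edges L.
  by apply: contraL ix' => eM; apply: (inter_drop ax sx rL ft eM).
by rewrite (negbTE eM) muln0 subn0 leq_addr.
Qed.

Lemma route_not_inter x s y e : route x s y -> ~~ inter x e ->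
  ~~ inter y e /\ y e <= x e.
Proof.
elim: s x => [|[L t] s IH] x; first by move/route_nilE->.
case/route_consE=> sx rL [ft _] r nx.
have nx' : ~~ inter (shift x L t) e.
  by apply: contra nx => ix'; apply: (inter_kept ax sx rL ft ix').
have [ny le_e] := IH _ r nx'; split=> //; apply: leq_trans le_e _.
have eP : e \notin plus_edges L.
  apply: contra nx => /(rotation_plus rL)[c tec _].
  exact: (W_admissible_inter ax (tandem_adm tec)).
by rewrite ffunE (negbTE eP) muln0 addn0 leq_subr.
Qed.

Lemma route_good x s y f : route x s y -> good f (xf f x) (xf f y).
Proof.
elim: s x => [|[L t] s IH] x.
  move=> r; rewrite -(route_nilE r); have gx := stable_g (route_start r).
  by apply: good_refl; [apply: galloc_inB | apply: galloc_firm].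
case/route_consE=> sx rL [ft _] r; have gx := stable_g sx.
apply: (good_trans ax) (IH _ r).
exact: (shift_good ax gx (rotation_pairing ax gx rL) ft).
Qed.

(** When a rotation is used with its maximal weight, one of its tandems
    disappears for good: [c] has been used up and the firm is not interested in
    it any more, or [a] is saturated, or the firm has switched from [c] to
    another edge and (C) forbids it to switch back. *)
Lemma max_feasible_dead x L t : stable x -> rotation x L -> max_feasible x L t ->
  exists2 p, p \in L &
    forall s y, route (shift x L t) s y -> ~~ tandem y p.1 p.2.
Proof.
move=> sx rL [ft mt]; have gx := stable_g sx.
have t_gt0 : 0 < t by case/and4P: ft.
have pL := rotation_pairing ax gx rL; set x' := shift x L t.
have sx' : stable x' := shift_stable ax sx rL ft.
have nf : ~~ feasible x L t.+1 by apply/negP => /mt; rewrite ltnn.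
have [/allPn[c cM]|/negPn m_ok] := boolP (~~ all (fun e => t.+1 <= x e) (minus_edges L)).
  rewrite -ltnNge ltnS => le_c.
  have x'c : x' c = 0.
    by rewrite /x' shift_minus //; apply/eqP; rewrite subn_eq0.
  have nic : ~~ inter x' c := inter_drop ax sx rL ft cM.
  have [a _ pacL] := rotation_minus rL cM; exists (a, c) => //= s y r.
  have [_] := route_not_inter r nic; rewrite x'c leqn0 => /eqP yc.
  by apply/negP => /tandem_pos; rewrite yc.
have [/allPn[a aP]|/negPn p_ok] := boolP (~~ all (fun e => t.+1 <= cap e - x e) (plus_edges L)).
  rewrite -ltnNge ltnS => le_a.
  have nia : ~~ inter x' a.
    apply/negP => /inter_cap; rewrite /x' shift_plus // ltnNge => /negP[].
    by rewrite -leq_subLR.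
  have [c _ pacL] := rotation_plus rL aP; exists (a, c) => //= s y r.
  have [ny _] := route_not_inter r nia.
  by apply: contra ny => /tandem_adm/(W_admissible_inter ax).
have /allPn[p pL0 np] : ~~ all (fun p => let f := fend p.1 in
    let z := vadd (xf f x) p.1 t.+1 in vadd (fchoice f z) p.2 t.+1 == z) L.
  by move: nf; rewrite /feasible m_ok p_ok.
exists p => // s y r; apply: contra np => tpy.
have [i [L' Erot]] : exists i L', rot i L = p :: L'.
  by have [i L' E] := rot_to pL0; exists i, L'.
have sc : same_cycle L (p :: L') by exists i.
have tp := rotation_tandem rL pL0; have nca := tandem_neq tp.
have fc := tandem_firm tp; set f := fend p.1 => /=.
have rL' := rotation_same_cycle sc rL.
have ft' : feasible x (p :: L') t by rewrite -(same_cycle_feasible _ _ sc).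
have prL' := rotation_pairing ax gx rL'.
have fp := feasible_one ft' (mem_head _ _); have fL' := feasible_tail ft'.
have [prp _] := @pairing_sub M [:: p] L' prL'.
have x'E : x' = shift (shift x [:: p] t) L' t.
  rewrite /x' (same_cycle_shift _ _ sc); apply/ffunP => e.
  have [E0 dis] := @shift_cat M x [:: p] L' t t e prL' fp fL'.
  apply: (@addIn (x e)); rewrite E0.
  have [up um di _] := prL'.
  have p1n : p.1 \notin plus_edges L' by case/andP: up.
  have p2n : p.2 \notin minus_edges L' by case/andP: um.
  have [Ep1|ne1] := eqVneq e p.1.
    have p1n' : p.1 \notin minus_edges L'.
      by have := di p.1 (mem_head _ _); rewrite inE negb_or => /andP[].
    rewrite Ep1 (shift_other _ _ p1n p1n') (shift_plus _ _ prL' (mem_head _ _)).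
    by rewrite (shift_plus _ _ prp (mem_head _ _)).
  have [Ep2|ne2] := eqVneq e p.2.
    have p2n' : p.2 \notin plus_edges L'.
      apply/negP => p2P; have := di p.2; rewrite !inE p2P orbT => /(_ isT).
      by rewrite eqxx.
    rewrite Ep2 (shift_other _ _ p2n' p2n) (shift_minus _ _ prL' (mem_head _ _)).
    by rewrite (shift_minus _ _ prp (mem_head _ _)).
  have -> : shift x (p :: L') t e = shift x L' t e.
    by rewrite !ffunE !inE (negbTE ne1) (negbTE ne2).
  by rewrite addnC (@shift_other M x [:: p]) // inE.
have vE := shift1_firm gx prp fp; rewrite -/f in vE.
have good_vx' : good f (fchoice f (vadd (xf f x) p.1 t)) (xf f x').
  by rewrite -vE x'E; apply: shift_good_cat.
have iy := W_admissible_inter ax (tandem_adm tpy).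
have [ix' le_a] := route_inter r iy.
have gy := stable_g (route_end r).
have x'p1 : x' p.1 = x p.1 + t by rewrite /x' shift_plus // map_f.
apply/eqP; apply: (gapless_extend ax gl (f := f) (y := xf f y)) => //.
- exact: galloc_inB.
- exact: galloc_firm.
- apply: inB_vadd => //; first exact: galloc_inB.
  rewrite restr_f_edge addnS -x'p1.
  exact: inter_cap ix'.
- exact: tandemE tp.
- exact: feasible_tandem ft pL0.
- exact: (good_trans ax good_vx' (route_good f r)).
- rewrite -vE !restr_f_edge; apply: leq_trans le_a.
  by rewrite x'p1 (shift_plus _ _ prp (mem_head _ _)).
- exact: (inB_offer gy (inter_cap iy)).
- exact: tandemE tpy.
Qed.

Lemma route_used x s y q : route x s y -> q \in s ->
  exists s1 y1, [/\ route x s1 y1, rotation y1 q.1 & max_feasible y1 q.1 q.2].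
Proof.
elim: s x => // [[L t] s IH] x /route_consE[sx rL mt r].
rewrite inE => /orP[/eqP ->|/(IH _ r)[s1 [y1 [r1 rot1 mt1]]]].
  by exists [::], x; split=> //; apply: route_nil.
by exists ((L, t) :: s1), y1; split=> //; apply: route_consI.
Qed.

Lemma route_dead x L t s y : route x ((L, t) :: s) y ->
  exists2 p, p \in L & forall q, q \in s -> p \notin q.1.
Proof.
case/route_consE=> sx rL mt r; have [p pL dead] := max_feasible_dead sx rL mt.
exists p => // q qs; have [s1 [y1 [r1 rot1 _]]] := route_used r qs.
by apply: contra (dead _ _ r1) => /(rotation_tandem rot1).
Qed.

(** Each step destroys a tandem for good, which bounds the length of routes. *)
Lemma route_bound x s y : route x s y -> size s <= #|edge M| * #|edge M|.
Proof.
move=> r; suff [ps [ups <- _]] : exists ps : seq (edge M * edge M),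
    [/\ uniq ps, size ps = size s & forall p, p \in ps -> exists2 q, q \in s & p \in q.1].
  by rewrite -card_prod -(card_uniqP ups) max_card.
elim: s x r => [|[L t] s IH] x r; first by exists [::].
have [_ _ _ r'] := route_consE r; have [ps [ups sz psP]] := IH _ r'.
have [p pL dead] := route_dead r; exists (p :: ps); split=> /=; rewrite ?sz //.
  by rewrite ups andbT; apply/negP => /psP[q /dead/negP].
move=> p'; rewrite inE => /orP[/eqP->|/psP[q qs pq]].
  by exists (L, t) => //; apply: mem_head.
by exists q => //; rewrite inE qs orbT.
Qed.

Lemma route_used_once x s y i j L d : route x s y -> i < size s -> j < size s ->
  same_cycle L (nth d s i).1 -> same_cycle L (nth d s j).1 -> i = j.
Proof.
elim: s x i j => // -[K t] s IH x i j r.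
have [_ _ _ r'] := route_consE r; have [p pK dead] := route_dead r.
have no k : k < size s -> same_cycle L K -> same_cycle L (nth d s k).1 -> False.
  move=> lt_k sK sk; have /negP[] := dead _ (mem_nth d lt_k).
  by rewrite -(same_cycle_mem (same_cycle_trans (same_cycle_sym sK) sk)).
case: i j => [|i] [|j] //=; rewrite ?ltnS.
- by move=> _ lt_j sK sj; case: (no j).
- by move=> lt_i _ si sK; case: (no i).
- by move=> lt_i lt_j si sj; congr _.+1; apply: IH r' lt_i lt_j si sj.
Qed.

Lemma used_inP L t s (d : dcycle M * nat) : used_in L t s <->
  exists i, [/\ i < size s, same_cycle L (nth d s i).1 & t = (nth d s i).2].
Proof.
split=> [[p ps [sc ->]]|[i [lt_i sc ->]]].
  by exists (index p s); rewrite index_mem nth_index.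
by exists (nth d s i); rewrite ?mem_nth.
Qed.

Lemma used_in_cons L t K (u : nat) s : used_in L t ((K, u) :: s) <->
  (same_cycle L K /\ t = u) \/ used_in L t s.
Proof.
split=> [[p]|[[sc ->]|[p ps h]]].
- by rewrite inE => /orP[/eqP-> /=|ps h]; [left|right; exists p].
- by exists (K, u) => //; apply: mem_head.
- by exists p => //; rewrite inE ps orbT.
Qed.

Lemma used_in_cat L t s s' : used_in L t (s ++ s') <->
  used_in L t s \/ used_in L t s'.
Proof.
split=> [[p]|[[p ps h]|[p ps h]]].
- by rewrite mem_cat => /orP[ps|ps] h; [left|right]; exists p.
- by exists p => //; rewrite mem_cat ps.
- by exists p => //; rewrite mem_cat ps orbT.
Qed.

Lemma used_in_same L L' t s : same_cycle L L' -> used_in L t s -> used_in L' t s.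
Proof.
by move=> sc [p ps [scp ->]]; exists p => //; split=> //;
  apply: same_cycle_trans (same_cycle_sym sc) scp.
Qed.

(** * Routes restricted to a class of rotations *)

Section Restricted.

Variable P : dcycle M -> Prop.

Definition blocked y := forall L, rotation y L -> ~ P L.

Definition route_in x s y := route x s y /\ forall q, q \in s -> P q.1.

Lemma route_in_consE x L t s y : route_in x ((L, t) :: s) y ->
  P L /\ route_in (shift x L t) s y.
Proof.
case=> r h; have [_ _ _ r'] := route_consE r; split; first exact: (h _ (mem_head _ _)).
by split=> // q qs; apply: h; rewrite inE qs orbT.
Qed.

(** As long as it is not used, the rotation stays applicable with the same
    weight; at the end it is not applicable, so it is used somewhere, and
    commuting brings it to the front. *)
Lemma route_in_strip x s y L t : route_in x s y -> blocked y -> P L ->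
    rotation x L -> max_feasible x L t ->
  exists s', route_in (shift x L t) s' y /\
    forall K (u : nat), used_in K u s <-> (same_cycle K L /\ u = t) \/ used_in K u s'.
Proof.
move=> rin ny PL; elim: s x rin => [|[K u] s IH] x rin rL mt.
  by case: (ny L) => //; rewrite -(route_nilE (proj1 rin)).
have [PK rin'] := route_in_consE rin; have [sx rK mu r'] := route_consE (proj1 rin).
have [sc|nsc] := classic (same_cycle L K).
  have Et : u = t := max_feasible_uniq mu (same_cycle_max_feasible sc mt).
  exists s; rewrite (same_cycle_shift _ _ sc) -Et; split=> // K' u'.
  rewrite used_in_cons; split=> -[[sK ->]|h]; [left|right|left|right] => //.
    by split=> //; apply: same_cycle_trans sK (same_cycle_sym sc).
  by split=> //; apply: same_cycle_trans sK sc.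
have [fu ft] := (proj1 mu, proj1 mt).
have nsc' : ~ same_cycle K L by move/same_cycle_sym.
have rL' := rotation_after ax sx rK rL nsc' fu.
have mt' := max_feasible_after ax sx rK rL nsc' fu gl mt.
have [s' [rin1 us']] := IH _ rin' rL' mt'.
have rK' := rotation_after ax sx rL rK nsc ft.
have mu' := max_feasible_after ax sx rL rK nsc ft gl mu.
have prKL := pairing_two ax sx rK rL nsc'.
have Esh := shift_comm prKL fu ft.
exists ((K, u) :: s'); split.
  split.
    apply: route_consI; rewrite -?Esh ?(proj1 rin1) //.
      exact: shift_stable.
    by case: rin1.
  by move=> q; rewrite inE => /orP[/eqP->//|]; case: rin1 => _; apply.
move=> K' u'; rewrite !used_in_cons us'; tauto.
Qed.

(** The rotations of the first route are stripped from the second one by one. *)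
Lemma route_in_confluent x s y s' y' : route_in x s y -> blocked y ->
    route_in x s' y' -> blocked y' ->
  forall K (u : nat), used_in K u s <-> used_in K u s'.
Proof.
move=> rin ny; elim: s x s' rin => [|[L t] s IH] x s' rin rin' ny'.
  have Exy := route_nilE (proj1 rin).
  case: s' rin' => [|[L t] s'] rin' //.
  have [PL _] := route_in_consE rin'; have [_ rL _ _] := route_consE (proj1 rin').
  by rewrite Exy in rL; case: (ny L).
have [PL rin1] := route_in_consE rin; have [sx rL mt _] := route_consE (proj1 rin).
have [s1 [rin1' us1]] := route_in_strip rin' ny' PL rL mt.
move=> K u; rewrite used_in_cons us1.
by have := IH _ _ rin1 rin1' ny' K u; tauto.
Qed.

Lemma route_in_extend x : stable x -> exists s y, route_in x s y /\ blocked y.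
Proof.
move=> sx.
suff H n : exists s y, route_in x s y /\ (blocked y \/ size s = n).
  have [s [y [rin [ny|sz]]]] := H (#|edge M| * #|edge M|).+1; first by exists s, y.
  by have := route_bound (proj1 rin); rewrite sz ltnn.
elim: n => [|n [s [y [rin [ny|sz]]]]].
- by exists [::], x; split; [split=> //; apply: route_nil | right].
- by exists s, y; split=> //; left.
have [ny|] := classic (blocked y); first by exists s, y; split=> //; left.
move/not_all_ex_not => [L nL]; have [rL /NNPP PL] := imply_to_and _ _ nL.
have [t mt] := max_feasible_exists ax rL; case: rin => r h.
exists (rcons s (L, t)), (shift y L t); split; last by right; rewrite size_rcons sz.
split; first exact: route_rcons.
by move=> q; rewrite mem_rcons inE => /orP[/eqP->|/h].
Qed.

End Restricted.

(** * The poset of rotations *)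

Lemma fprec_better x y f : fprec x y -> better f (xf f x) (xf f y).
Proof.
case/and4P=> gx gy _ /forallP/(_ f)/orP[/eqP <-|].
  by apply: better_refl; [apply: galloc_inB|apply: galloc_firm].
case/and4P=> /andP[Bx _] /andP[By _] _ /eqP E; split=> //.
rewrite -[RHS]E; congr (fchoice _ _).
by apply/ffunP => e; rewrite !vmaxE maxnC.
Qed.

Lemma fprec_anti x y : fprec x y -> fprec y x -> x = y.
Proof.
move=> xy yx; apply/ffunP => e.
have := better_anti (fprec_better (fend e) xy) (fprec_better (fend e) yx).
by move/(congr1 (fun v : vec M => v e)); rewrite !restr_f_edge.
Qed.

Lemma min_stable_uniq x y : is_min_stable x -> is_min_stable y -> x = y.
Proof.
move=> [sx mx] [sy my]; case: (mx _ sy) => // xy.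
by case: (my _ sx) => // yx; apply: fprec_anti.
Qed.

Lemma max_stable_blocked x : is_max_stable x -> blocked (fun=> True) x.
Proof.
case=> sx mx L rL _; have gx := stable_g sx.
have [t [ft _]] := max_feasible_exists ax rL.
have pr := rotation_pairing ax gx rL.
have sx' : stable (shift x L t) := shift_stable ax sx rL ft.
have [p pL] : exists p, p \in L.
  by case/andP: rL => /and3P[]; case: (L) => // p ? _ _ _ _; exists p; apply: mem_head.
have [] : shift x L t <> x.
  move/(congr1 (fun v : vec M => v p.1)); rewrite shift_plus ?map_f // => /eqP.
  by case/and4P: ft; rewrite -[X in _ == X]addn0 eqn_add2l; case: t {sx'}.
case: (mx _ sx') => // lt; apply/ffunP => e.
have [good_e _] := shift_good ax gx pr ft (fend e).
have := better_anti (fprec_better (fend e) lt) good_e.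
by move/(congr1 (fun v : vec M => v e)); rewrite !restr_f_edge.
Qed.

Variable xmin : vec M.
Hypothesis xmin_min : is_min_stable xmin.

Lemma full_routeP s : full_route s <->
  exists2 y, route xmin s y & blocked (fun=> True) y.
Proof.
split=> [[x [y [mx my r]]]|[y r ny]].
  by exists y; [rewrite (min_stable_uniq xmin_min mx)|apply: max_stable_blocked].
exists xmin, y; split=> //; apply: (max_of_no_rotation ax (route_end r)).
by move=> L rL; apply: (ny L rL).
Qed.

Lemma full_route_used s s' : full_route s -> full_route s' ->
  forall K (u : nat), used_in K u s <-> used_in K u s'.
Proof.
case/full_routeP=> y r ny /full_routeP[y' r' ny'].
by apply: route_in_confluent ny _ ny'; split=> //; eassumption.
Qed.

Lemma rotation_weightP s L t : full_route s ->
  rotation_weight L t <-> used_in L t s.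
Proof.
move=> fs; split=> [[s' fs' us']|us]; last by exists s.
by apply/(full_route_used fs fs').
Qed.

Definition other K L := ~ same_cycle L K.

(** If [L] can be used before [K], then it is used on some route that avoids [K],
    hence on all maximal ones, by confluence.  Conversely a route that avoids
    [K] and uses [L] extends to a full route, in which [K] can only come later. *)
Lemma rot_ltP s K L s' y' : full_route s ->
    (exists t, used_in K t s) -> (exists t, used_in L t s) ->
    route_in (other K) xmin s' y' -> blocked (other K) y' ->
  rot_lt K L <-> ~ same_cycle L K /\ ~ exists t, used_in L t s'.
Proof.
move=> fs [tK uK] [tL uL] rin' ny'; pose d : dcycle M * nat := ([::], 0).
have prefix_used s1 y1 t : route xmin s1 y1 ->
    (forall q, q \in s1 -> other K q.1) -> used_in L t s1 -> used_in L t s'.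
  move=> r1 h1 u1; have [s2 [y2 [rin2 ny2]]] := @route_in_extend (other K) _ (route_end r1).
  have rin12 : route_in (other K) xmin (s1 ++ s2) y2.
    split; first exact: route_cat r1 (proj1 rin2).
    by move=> q; rewrite mem_cat => /orP[/h1|]; case: rin2 => // _ h; apply: h.
  by apply/(route_in_confluent rin12 ny2 rin' ny'); apply/used_in_cat; left.
split=> [[_ _ all_earlier]|[nLK nu]].
  have := all_earlier _ fs => -[i [j [/andP[lt_ij lt_j] sKi sLj]]].
  have [y r ny] := (proj1 (full_routeP s) fs).
  split=> [sLK|[t uLs']].
    have := route_used_once r (ltn_trans lt_ij lt_j) lt_j sKi
      (same_cycle_trans (same_cycle_sym sLK) sLj).
    by move=> E; rewrite E ltnn in lt_ij.
  have [s2 [y2 [[r2 _] ny2]]] := @route_in_extend (fun=> True) _ (route_end (proj1 rin')).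
  have r12 := route_cat (proj1 rin') r2.
  have fs2 : full_route (s' ++ s2) by apply/full_routeP; exists y2.
  have [i' [j' [/andP[lt_ij' lt_j'] sKi' sLj']]] := all_earlier _ fs2.
  have [k [lt_k sLk _]] := proj1 (used_inP L t s' d) uLs'.
  have Ej : k = j'.
    apply: (route_used_once (d := d) r12) sLj' => //.
      by rewrite size_cat ltn_addr.
    by rewrite nth_cat lt_k.
  have lt_i's : i' < size s' by rewrite -Ej in lt_ij'; apply: ltn_trans lt_k.
  move: sKi'; rewrite nth_cat lt_i's => sKi'.
  exact: (proj2 rin' _ (mem_nth _ lt_i's)) (same_cycle_sym sKi').
split; [by exists tK, s|by exists tL, s|move=> s0 fs0].
have [iK [lt_iK sK _]] := proj1 (used_inP K tK s0 d) (proj1 (full_route_used fs fs0 _ _) uK).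
have [iL [lt_iL sL EtL]] := proj1 (used_inP L tL s0 d) (proj1 (full_route_used fs fs0 _ _) uL).
have [y0 r0 _] := proj1 (full_routeP s0) fs0.
exists iK, iL; split=> //; rewrite lt_iL andbT ltnNge leq_eqVlt; apply/negP.
case/orP=> [/eqP E|lt_LK].
  by rewrite E in sL; apply: nLK; apply: same_cycle_trans sL (same_cycle_sym sK).
apply: nu; exists tL.
have szt : size (take iL.+1 s0) = iL.+1 by rewrite size_takel.
have [y1 r1 _] : exists2 y1, route xmin (take iL.+1 s0) y1 & route y1 (drop iL.+1 s0) y0.
  by apply: route_catE; rewrite cat_take_drop.
apply: (prefix_used _ _ _ r1).
  move=> q /(nthP d)[k]; rewrite szt ltnS => le_k <-; rewrite nth_take // => sk.
  have E : k = iK.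
    apply: (route_used_once (d := d) r0 _ lt_iK (same_cycle_sym sk) sK).
    by apply: leq_ltn_trans le_k lt_iL.
  by rewrite E leqNgt lt_LK in le_k.
apply/(used_inP _ _ _ d); exists iL; rewrite szt ltnSn nth_take //.
Qed.

End Routes.

(** * Programs with counted loops *)

(** A [PFor] loop has a bound that does not change during the loop; a [PWhile]
    loop is meant to stop after logarithmically many rounds.  The distinction
    makes the running time a syntactic notion. *)
Inductive prog :=
| PSkip
| PPut of nat & expr & expr
| PSeq of prog & prog
| PIf of expr & prog & prog
| PFor of nat & expr & prog
| PWhile of expr & prog
| PAsk of expr & nat & nat.

Definition V (v : nat) := Get v (Const 0).

Fixpoint compile (p : prog) : cmd :=
  match p with
  | PSkip => Skip
  | PPut a i e => Put a i e
  | PSeq p q => Seq (compile p) (compile q)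
  | PIf e p q => If e (compile p) (compile q)
  | PFor v b p =>
      Seq (Put v (Const 0) (Const 0))
          (While (Op Lt (V v) b)
             (Seq (compile p) (Put v (Const 0) (Op Add (V v) (Const 1)))))
  | PWhile e p => While e (compile p)
  | PAsk e a r => Ask e a r
  end.

Fixpoint written (c : cmd) : seq nat :=
  match c with
  | Skip => [::]
  | Put a _ _ => [:: a]
  | Seq c1 c2 => written c1 ++ written c2
  | If _ c1 c2 => written c1 ++ written c2
  | While _ c => written c
  | Ask _ _ r => [:: r]
  end.

Definition writes p := written (compile p).

(** Running time when [PFor] loops make at most [N] and [PWhile] loops at most
    [g] rounds.  The constants 11 and 7 cover the bookkeeping of the counter. *)
Fixpoint duration (N g : nat) (p : prog) : nat :=
  match p with
  | PSkip => 1
  | PPut _ i e => (cost i + cost e).+1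
  | PSeq p q => duration N g p + duration N g q
  | PIf e p q => (cost e + (duration N g p + duration N g q)).+1
  | PFor _ b p => N * (duration N g p + cost b + 11) + cost b + 7
  | PWhile e p => g * (duration N g p + cost e + 1) + cost e + 1
  | PAsk e _ _ => (cost e).+1
  end.

Fixpoint while_depth (p : prog) : nat :=
  match p with
  | PSeq p q => maxn (while_depth p) (while_depth q)
  | PIf _ p q => maxn (while_depth p) (while_depth q)
  | PFor _ _ p => while_depth p
  | PWhile _ p => (while_depth p).+1
  | _ => 0
  end.

(** Each nested loop multiplies by [N] or [g]; only [PWhile] loops contribute
    powers of [g]. *)
Lemma duration_poly p : exists K, forall N g, 0 < g ->
  duration N g p <= K * N.+1 ^ K * g ^ while_depth p.
Proof.
have up K K' N g d d' : 0 < g -> K <= K' -> d <= d' ->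
    K * N.+1 ^ K * g ^ d <= K' * N.+1 ^ K' * g ^ d'.
  by move=> g0 le_K le_d; rewrite !leq_mul ?leq_pexp2l.
have ge1 K N g d : 0 < g -> 0 < N.+1 ^ K * g ^ d.
  by move=> g0; rewrite muln_gt0 !expn_gt0 g0.
have const n N g d : 0 < g -> n <= n * N.+1 ^ n * g ^ d.
  by move=> g0; rewrite -mulnA leq_pmulr // ge1.
elim: p => [|a i e|p [K IHp] q [K' IHq]|e p [K IHp] q [K' IHq]|v b p [K IHp]|e p [K IHp]|e a r] /=.
- by exists 1 => N g g0; apply: const.
- by exists (cost i + cost e).+1 => N g g0; apply: const.
- exists (K + K') => N g g0; rewrite !mulnDl leq_add //.
    apply: leq_trans (IHp N g g0) _.
    by rewrite !leq_mul ?leq_pexp2l ?leq_addr ?leq_maxl.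
  apply: leq_trans (IHq N g g0) _.
  by rewrite !leq_mul ?leq_pexp2l ?leq_addl ?leq_maxr.
- exists ((cost e).+1 + (K + K')) => N g g0.
  rewrite -addSn; rewrite mulnDl mulnDl leq_add //.
    rewrite -mulnA leq_pmulr // ge1 //.
  rewrite !mulnDl leq_add //.
    apply: leq_trans (IHp N g g0) _.
    by rewrite !leq_mul ?leq_pexp2l ?leq_addr ?leq_maxl // addnCA leq_addr.
  apply: leq_trans (IHq N g g0) _.
  by rewrite !leq_mul ?leq_pexp2l ?leq_addl ?leq_maxr // addnA leq_addl.
- exists (K + (cost b + 11) + (cost b + 7)).+1 => N g g0.
  have := IHp N g g0; set D := duration N g p; set d := while_depth p.
  set K2 := (K + (cost b + 11) + (cost b + 7)) => le_D.
  have le_K : K <= K2 by rewrite /K2 -addnA leq_addr.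
  have le_pow : N.+1 ^ K * N.+1 <= N.+1 ^ K2.+1 by rewrite -expnSr leq_pexp2l.
  have g1 : 0 < g ^ d by rewrite expn_gt0 g0.
  have P1 : 0 < N.+1 ^ K by rewrite expn_gt0.
  have : N * (D + cost b + 11) + cost b + 7 <= K2.+1 * (N.+1 ^ K * N.+1) * g ^ d.
    apply: (@leq_trans ((K2 * N.+1 ^ K * g ^ d) * N.+1)); last first.
      rewrite mulnAC -[_ * _ * N.+1]mulnA leq_mul2r; apply/orP; right.
      by rewrite leq_mul2r leqnSn orbT.
    have le1 : D + (cost b + 11) <= (K + (cost b + 11)) * (N.+1 ^ K * g ^ d).
      rewrite mulnDl leq_add //; first by rewrite mulnA.
      by rewrite leq_pmulr // muln_gt0 P1.
    have le2 : cost b + 7 <= (cost b + 7) * (N.+1 ^ K * g ^ d).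
      by rewrite leq_pmulr // muln_gt0 P1.
    rewrite -[K2 * _ * _]mulnA; move: le1 le2; rewrite /K2.
    move: (N.+1 ^ K * g ^ d) => Z; clear; nia.
  by move/leq_trans; apply; rewrite leq_mul2r leq_mul2l le_pow !orbT.
- exists (K + (cost e + 1) + (cost e + 1)).+1 => N g g0.
  have := IHp N g g0; set D := duration N g p; set d := while_depth p.
  set K2 := (K + (cost e + 1) + (cost e + 1)) => le_D.
  have le_K : K <= K2.+1 by rewrite /K2 -addnA leqW // leq_addr.
  have g1 : 0 < g ^ d by rewrite expn_gt0 g0.
  have P1 : 0 < N.+1 ^ K2.+1 by rewrite expn_gt0.
  have le1 : D + (cost e + 1) <= (K + (cost e + 1)) * (N.+1 ^ K2.+1 * g ^ d).
    rewrite mulnDl leq_add //.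
      apply: leq_trans le_D _; rewrite -mulnA leq_mul2l leq_mul2r.
      by rewrite leq_pexp2l ?orbT.
    by rewrite leq_pmulr // muln_gt0 P1.
  have le2 : cost e + 1 <= (cost e + 1) * (N.+1 ^ K2.+1 * g ^ d).
    by rewrite leq_pmulr // muln_gt0 P1.
  have -> : K2.+1 * N.+1 ^ K2.+1 * g ^ d.+1 =
            K2.+1 * (g * (N.+1 ^ K2.+1 * g ^ d)).
    by rewrite (expnS g d) -mulnA; congr (_ * _); rewrite mulnCA.
  move: le1 le2; move: (N.+1 ^ K2.+1 * g ^ d) => Z; rewrite /K2; move: g0.
  by clear; nia.
- by exists (cost e).+1 => N g g0; apply: const.
Qed.

(** * Total correctness *)

Definition frame (W : seq nat) (s s' : state) :=
  forall a, a \notin W -> s' a = s a.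

Definition updated (s : state) (a i n : nat) (s' : state) :=
  [/\ forall a', a' != a -> s' a' = s a', s' a i = n &
      forall j, j != i -> s' a j = s a j].

Section Runs.

Variables (O : oracle) (bnd N g : nat).

Definition runs (p : prog) (s : state) (Q : state -> Prop) : Prop :=
  exists s' t, [/\ exec O bnd (compile p) s s' t, t <= duration N g p & Q s'].

Lemma exec_frame c s s' t : exec O bnd c s s' t -> frame (written c) s s'.
Proof.
elim=> {c s s' t} /=.
- by [].
- by move=> a i e s _ _ a'; rewrite inE /set_cell /set_array => /negbTE->.
- move=> c1 c2 s s1 s2 t1 t2 _ IH1 _ IH2 a; rewrite mem_cat negb_or.
  by case/andP=> /IH1 <- /IH2 <-.
- move=> e c1 c2 s s' t _ _ IH a; rewrite mem_cat negb_or => /andP[n1 n2].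
  by apply: IH; case: ifP.
- by [].
- by move=> e c s s1 s2 t1 t2 _ _ _ IH1 _ IH2 a na; rewrite IH2 ?IH1.
- by move=> e a r s A _ _ a'; rewrite inE /set_array => /negbTE->.
Qed.

Lemma runs_frame p s Q : runs p s Q ->
  runs p s (fun s' => Q s' /\ frame (writes p) s s').
Proof.
case=> s' [t [ex le_t Qs']]; exists s', t; split=> //; split=> //.
exact: exec_frame ex.
Qed.

Lemma runs_conseq p s Q Q' : runs p s Q ->
  (forall s', frame (writes p) s s' -> Q s' -> Q' s') -> runs p s Q'.
Proof.
by move/runs_frame=> [s' [t [ex le_t [Qs' fr]]]] imp; exists s', t; split; auto.
Qed.

Lemma runs_skip s (Q : state -> Prop) : Q s -> runs PSkip s Q.
Proof. by move=> Qs; exists s, 1; split=> //; constructor. Qed.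

Lemma runs_put a i e s (Q : state -> Prop) : fits bnd s i -> fits bnd s e ->
    (forall s', updated s a (eval s i) (eval s e) s' -> Q s') ->
  runs (PPut a i e) s Q.
Proof.
move=> fi fe Qs; exists (set_cell s a (eval s i) (eval s e)), (cost i + cost e).+1.
split=> //; first by constructor.
apply: Qs; rewrite /set_cell /set_array; split=> [a' /negbTE->||j /negbTE] //.
  by rewrite !eqxx.
by rewrite eqxx => ->.
Qed.

Lemma runs_seq p q s Q : runs p s (fun s' => runs q s' Q) -> runs (PSeq p q) s Q.
Proof.
case=> s1 [t1 [ex1 le1 [s2 [t2 [ex2 le2 Qs2]]]]].
by exists s2, (t1 + t2); split; [apply: exec_seq ex1 ex2|apply: leq_add|].
Qed.

Lemma runs_if e p q s Q : fits bnd s e ->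
    (eval s e != 0 -> runs p s Q) -> (~~ (eval s e != 0) -> runs q s Q) ->
  runs (PIf e p q) s Q.
Proof.
move=> fe Hp Hq; have [E|ne] := eqVneq (eval s e) 0.
  have [s' [t [ex le_t Qs']]] : runs q s Q by apply: Hq; rewrite E.
  exists s', (cost e + t).+1; split=> //=; last by rewrite ltnS leq_add2l (leq_trans le_t) ?leq_addl.
  by apply: exec_if => //; rewrite E.
have [s' [t [ex le_t Qs']]] := Hp ne.
exists s', (cost e + t).+1; split=> //=; last by rewrite ltnS leq_add2l (leq_trans le_t) ?leq_addr.
by apply: exec_if => //; rewrite ne.
Qed.

(** The index [k] of the invariant bounds the number of rounds to come. *)
Lemma runs_while e p s (I : nat -> state -> Prop) n (Q : state -> Prop) : n <= g ->
    (forall k s', I k s' -> fits bnd s' e) ->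
    (forall s', I 0 s' -> eval s' e = 0) ->
    (forall k s', I k.+1 s' -> eval s' e != 0 -> runs p s' (I k)) ->
    I n s -> (forall k s', I k s' -> eval s' e = 0 -> Q s') ->
  runs (PWhile e p) s Q.
Proof.
move=> le_n fe stop step In fin.
suff [s' [t [ex le_t Qs']]] : exists s' t, [/\ exec O bnd (While e (compile p)) s s' t,
    t <= n * (duration N g p + cost e + 1) + cost e + 1 & Q s'].
  exists s', t; split=> //=; apply: leq_trans le_t _.
  by rewrite !leq_add2r leq_mul2r le_n orbT.
elim: n s In {le_n} => [|n IH] s In.
  exists s, (cost e).+1; split; last exact: fin In (stop _ In).
    by apply: exec_while_stop; [apply: fe In|apply: stop].
  by rewrite mul0n addn1.
have [E|ne] := eqVneq (eval s e) 0.
  exists s, (cost e).+1; split; last exact: fin In E.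
    by apply: exec_while_stop => //; apply: fe In.
  by rewrite addn1 ltnS leq_addl.
have [s1 [t1 [ex1 le1 I1]]] := step _ _ In ne.
have [s2 [t2 [ex2 le2 Q2]]] := IH _ I1.
exists s2, (cost e + t1 + t2).+1; split=> //.
  by apply: exec_while_loop ex1 ex2 => //; apply: fe In.
by move: le1 le2; rewrite mulSn; clear; lia.
Qed.

(** The counter is advanced after the body, so the invariant must not depend on
    the array [v]. *)
Lemma runs_for v b p s n (I : nat -> state -> Prop) (Q : state -> Prop) :
    v \notin writes p -> n <= N -> n < bnd ->
    (forall s', frame (v :: writes p) s s' -> fits bnd s' b /\ eval s' b = n) ->
    (forall i s' s'', I i s' -> (forall a, a != v -> s'' a = s' a) -> I i s'') ->
    I 0 s ->
    (forall i s', i < n -> frame (v :: writes p) s s' -> s' v 0 = i -> I i s' ->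
       runs p s' (I i.+1)) ->
    (forall s', frame (v :: writes p) s s' -> I n s' -> Q s') ->
  runs (PFor v b p) s Q.
Proof.
move=> vp le_nN lt_nb Hb irr I0 step fin.
have bnd1 : 1 < bnd \/ n = 0 by case: (n) lt_nb => [|n0]; [right|left; apply: leq_trans lt_nb].
pose J i s' := [/\ frame (v :: writes p) s s', s' v 0 = i & I i s'].
suff H k i s1 : i + k = n -> J i s1 -> exists s' t,
    [/\ exec O bnd (While (Op Lt (V v) b) (Seq (compile p)
          (Put v (Const 0) (Op Add (V v) (Const 1))))) s1 s' t,
        t <= k * (duration N g p + cost b + 11) + cost b + 4 & J n s'].
  have [s' [t [ex le_t [fr _ In]]]] : exists s' t,
    [/\ exec O bnd (While (Op Lt (V v) b) (Seq (compile p)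
          (Put v (Const 0) (Op Add (V v) (Const 1))))) (set_cell s v 0 0) s' t,
        t <= n * (duration N g p + cost b + 11) + cost b + 4 & J n s'].
    apply: (H n 0) => //; split.
    - by move=> a; rewrite inE negb_or /set_cell /set_array => /andP[/negbTE->].
    - by rewrite /set_cell /set_array !eqxx.
    - by apply: irr I0 _ => a /negbTE; rewrite /set_cell /set_array => ->.
  exists s', (3 + t); split; last exact: fin.
    by apply: exec_seq ex; apply: exec_put.
  have : n * (duration N g p + cost b + 11) <= N * (duration N g p + cost b + 11).
    by rewrite leq_mul2r le_nN orbT.
  move: le_t => /=; clear; lia.
elim: k i s1 => [|k IH] i s1.
  rewrite addn0 => -> [fr Ei In]; have [fb Eb] := Hb _ fr.
  exists s1, (cost (Op Lt (V v) b)).+1; split; last by split.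
    apply: exec_while_stop; rewrite /= ?fb Ei Eb ltnn //=.
    by rewrite (leq_ltn_trans _ lt_nb).
  by rewrite mul0n /=; clear; lia.
move=> Ein [fr Ei Ii]; have lt_in : i < n by rewrite -Ein -addSnnS leq_addr.
have [fb Eb] := Hb _ fr.
have [s2 [t2 [ex2 le2 [I2 fr2]]]] := runs_frame (step _ _ lt_in fr Ei Ii).
have v2 : s2 v 0 = i by rewrite fr2.
pose s3 := set_cell s2 v 0 i.+1.
have J3 : J i.+1 s3.
  split.
  - move=> a; rewrite inE negb_or => /andP[av aw].
    rewrite /s3 /set_cell /set_array (negbTE av) fr2 // fr // inE negb_or av.
    by [].
  - by rewrite /s3 /set_cell /set_array !eqxx.
  - by apply: irr I2 _ => a /negbTE; rewrite /s3 /set_cell /set_array => ->.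
have [|s' [t' [ex' le' J']]] := IH i.+1 s3 _ J3; first by rewrite addSnnS.
exists s', (cost (Op Lt (V v) b) + (t2 + (cost (Const 0) +
   cost (Op Add (V v) (Const 1))).+1) + t').+1; split=> //.
  apply: exec_while_loop ex'.
  - rewrite /= fb Ei Eb lt_in /=; case: bnd1 => // n0.
    by rewrite n0 in lt_in.
  - by rewrite /= Ei Eb lt_in.
  apply: exec_seq ex2 _.
  have <- : set_cell s2 v (eval s2 (Const 0)) (eval s2 (Op Add (V v) (Const 1))) = s3.
    by rewrite /= v2 addn1.
  by apply: exec_put => //=; rewrite v2 addn1 (leq_ltn_trans lt_in).
by move: le2 le'; rewrite mulSn /=; clear; lia.
Qed.

(** Tests whether [e1] implies [e2] for all values of [v] below [b].  The tests
    are nested because the evaluation of [e2] may get stuck where [e1] fails. *)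
Definition PAll flag v b e1 e2 : prog :=
  PSeq (PPut flag (Const 0) (Const 1))
       (PFor v b (PIf e1 (PIf e2 PSkip (PPut flag (Const 0) (Const 0))) PSkip)).

Lemma runs_all flag v b e1 e2 s n (A : pred nat) (Q : state -> Prop) :
    v != flag -> n <= N -> n < bnd ->
    (forall s', frame [:: v; flag] s s' -> fits bnd s' b /\ eval s' b = n) ->
    (forall i s', i < n -> frame [:: v; flag] s s' -> s' v 0 = i ->
       [/\ fits bnd s' e1, eval s' e1 != 0 -> fits bnd s' e2 &
           (eval s' e1 != 0) ==> (eval s' e2 != 0) = A i]) ->
    (forall s', frame [:: v; flag] s s' -> s' flag 0 = all A (iota 0 n) -> Q s') ->
  runs (PAll flag v b e1 e2) s Q.
Proof.
move=> nvf le_n lt_n Hb He fin; apply: runs_seq; apply: runs_put => // s1 [u1 u2 _].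
have fr1 s' : frame (v :: writes (PIf e1 (PIf e2 PSkip (PPut flag (Const 0) (Const 0))) PSkip))
    s1 s' -> frame [:: v; flag] s s'.
  move=> fr a; rewrite !inE negb_or => /andP[av af].
  by rewrite fr ?u1 // !inE negb_or av.
apply: (runs_for (n := n) (I := fun i s' => s' flag 0 = all A (iota 0 i))) => //.
- by rewrite inE.
- by move=> s' /fr1; apply: Hb.
- by move=> i s' s'' E u; rewrite u // eq_sym.
- move=> i s' lt_in fr Ei Ii.
  have [f1 f2 EA] := He _ _ lt_in (fr1 _ fr) Ei.
  have iotaS : all A (iota 0 i.+1) = all A (iota 0 i) && A i.
    by rewrite -addn1 iotaD all_cat /= andbT add0n.
  apply: runs_if => // [n1|E1]; last first.
    by apply: runs_skip; rewrite iotaS -EA (negbTE E1) andbT.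
  apply: runs_if => [|n2|E2]; first exact: f2.
    by apply: runs_skip; rewrite iotaS -EA n2 implybT andbT.
  apply: runs_put => // s2 [_ -> _].
  by rewrite iotaS -EA n1 (negbTE E2) andbF.
- by move=> s' /fr1; apply: fin.
Qed.

End Runs.

Arguments runs_all {O bnd N g flag v b e1 e2 s} n A {Q}.

(** * Programs for the tandems *)

(* Arrays 0 to 6 hold the input and 7 to 12 the output.  A scalar variable is
   cell 0 of an array of its own. *)
Notation aX := 20 (only parsing).
Notation aCand := 21 (only parsing).
Notation aAdm := 22 (only parsing).
Notation aTan := 23 (only parsing).
Notation aR := 24 (only parsing).
Notation aNext := 25 (only parsing).
Notation aNextC := 26 (only parsing).
Notation aUsed := 27 (only parsing).
Notation aLess := 28 (only parsing).
Notation vE := 30 (only parsing).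
Notation vI := 31 (only parsing).
Notation vSum := 32 (only parsing).
Notation vA := 33 (only parsing).
Notation vC := 34 (only parsing).
Notation vFlag := 35 (only parsing).
Notation vCur := 36 (only parsing).
Notation vLen := 37 (only parsing).
Notation vStart := 38 (only parsing).
Notation vRow := 39 (only parsing).
Notation vN := 40 (only parsing).
Notation vIt := 41 (only parsing).
Notation vLo := 42 (only parsing).
Notation vHi := 43 (only parsing).
Notation vT := 44 (only parsing).
Notation vM2 := 45 (only parsing).
Notation vM1 := 46 (only parsing).
Notation vK := 47 (only parsing).
Notation vL := 48 (only parsing).
Notation vRound := 49 (only parsing).
Notation vOk := 50 (only parsing).
Notation vJ := 51 (only parsing).

Definition z0 := Const 0.
Definition z1 := Const 1.
Definition nE := Get 0 (Const 2).
Definition eNot e := Op Eq e z0.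
Definition eSame a i j := Op Eq (Get a i) (Get a j).
Definition eLe i j := eNot (Op Lt j i).
Definition eCell i j n := Op Add (Op Mul i n) j.

Definition incr a i e := PPut a i (Op Add (Get a i) e).
Definition decr a i e := PPut a i (Op Defs.Sub (Get a i) e).
Definition askFirm v := PAsk (Get 2 (V v)) aX aR.

(** See [W_candidate_sum] for the test.  The oracle is asked only if there is room
    for one more unit of the edge, so that the query is legal. *)
Definition pCandidate :=
  PSeq (PPut vSum z0 z0)
  (PSeq (PFor vI nE (PIf (Op And (eSame 1 (V vI) (V vE)) (eLe (Get 5 (V vI)) (Get 5 (V vE))))
           (incr vSum z0 (Get aX (V vI))) PSkip))
  (PSeq (PPut aCand (V vE) z0)
  (PIf (Op And (Op And (Op Eq (V vSum) (Get 4 (Get 1 (V vE)))) (Op Lt z0 (V vSum)))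
               (Op Lt (Get aX (V vE)) (Get 3 (V vE))))
     (PSeq (incr aX (V vE) z1)
     (PSeq (askFirm vE)
     (PSeq (decr aX (V vE) z1)
     (PIf (Op Lt (Get aX (V vE)) (Get aR (V vE))) (PPut aCand (V vE) z1) PSkip))))
     PSkip))).

(** The best candidate of a worker is the one in the least position. *)
Definition pAdmissible :=
  PSeq (PAll vFlag vI nE (Op And (Get aCand (V vI)) (eSame 1 (V vI) (V vA)))
                         (eLe (Get 5 (V vA)) (Get 5 (V vI))))
       (PPut aAdm (V vA) (Op And (Get aCand (V vA)) (V vFlag))).

(** The units of [vA] are added in place for the query and removed afterwards.
    The answer is compared on the edges of the firm only, since the oracle leaves
    the other cells unchanged. *)
Definition pExchange :=
  PSeq (incr aX (V vA) (V vT))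
  (PSeq (askFirm vA)
  (PSeq (PAll vFlag vI nE (eSame 2 (V vI) (V vA))
           (Op Eq (Op Add (Get aR (V vI)) (Op Mul (Op Eq (V vI) (V vC)) (V vT)))
                  (Get aX (V vI))))
  (decr aX (V vA) (V vT)))).

Definition pTandem :=
  PSeq (PPut vFlag z0 z0)
  (PSeq (PIf (Op And (Op And (Get aAdm (V vA)) (eSame 2 (V vC) (V vA)))
                     (eNot (Op Eq (V vC) (V vA))))
     (PSeq (PPut vT z0 z1) pExchange)
     PSkip)
  (PPut aTan (eCell (V vA) (V vC) nE) (V vFlag))).

Definition pTandems :=
  PSeq (PFor vE nE pCandidate)
  (PSeq (PFor vA nE pAdmissible)
  (PFor vA nE (PFor vC nE pTandem))).

Lemma evalAnd s e1 e2 :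
  (eval s (Op And e1 e2) != 0) = (eval s e1 != 0) && (eval s e2 != 0).
Proof. by rewrite /=; case: (_ && _). Qed.

Lemma evalEq s e1 e2 : (eval s (Op Eq e1 e2) != 0) = (eval s e1 == eval s e2).
Proof. by rewrite /=; case: (eval s e1 == eval s e2). Qed.

Lemma evalLt s e1 e2 : (eval s (Op Lt e1 e2) != 0) = (eval s e1 < eval s e2).
Proof. by rewrite /=; case: (_ < _). Qed.

Lemma evalNot s e : (eval s (eNot e) != 0) = ~~ (eval s e != 0).
Proof. by rewrite evalEq /= negbK. Qed.

Lemma evalLe s e1 e2 : (eval s (eLe e1 e2) != 0) = (eval s e1 <= eval s e2).
Proof. by rewrite evalNot evalLt -leqNgt. Qed.

Lemma evalSame s a e1 e2 :
  (eval s (eSame a e1 e2) != 0) = (s a (eval s e1) == s a (eval s e2)).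
Proof. by rewrite /eSame evalEq /=. Qed.

Definition evalE := (evalSame, evalLe, evalNot, evalAnd, evalEq, evalLt).

Section Numbering.

Lemma num_lt (T : finType) (u : T) : num u < #|T|.
Proof. exact: ltn_ord. Qed.

Lemma num_inj (T : finType) : injective (@num T).
Proof. by move=> u v /val_inj/enum_rank_inj. Qed.

Lemma num_onto (T : finType) i : i < #|T| -> exists u : T, num u = i.
Proof. by move=> lt_i; exists (enum_val (Ordinal lt_i)); rewrite /num enum_valK. Qed.

Lemma num_eq (T : finType) (u v : T) : (num u == num v) = (u == v).
Proof. by apply: inj_eq; apply: num_inj. Qed.

Lemma nth_num (T : finType) (A : Type) (d : A) (F : T -> A) u :
  nth d [seq F v | v <- enum T] (num u) = F u.
Proof.
by rewrite (nth_map u) -?cardE ?num_lt // nth_enum_rank.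
Qed.

Lemma onth_num (T : finType) (u : T) : onth (enum T) (num u) = Some u.
Proof.
by rewrite onthE (nth_map u) -?cardE ?num_lt // /num nth_enum_rank.
Qed.

Lemma all_num (T : finType) (A : pred nat) :
  all A (iota 0 #|T|) = [forall u : T, A (num u)].
Proof.
apply/allP/forallP => [h u|h i].
  by apply: h; rewrite mem_iota add0n num_lt.
by rewrite mem_iota add0n => /num_onto[u <-].
Qed.

Lemma sum_num (T : finType) (F : nat -> nat) :
  \sum_(0 <= i < #|T|) F i = \sum_(u : T) F (num u).
Proof.
rewrite big_mkord (reindex (@enum_rank T)) //=.
by apply: onW_bij; apply: enum_rank_bij.
Qed.

Lemma idx_lt i j n k : i < n -> j < k -> i * k + j < n * k.
Proof. by move=> lt_i lt_j; nia. Qed.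

End Numbering.

Section Spec.

Variables (M : market) (ax : market_axioms M) (xmin : vec M).
Variables (bnd N g B : nat).
Notation m := #|edge M|.
Hypothesis le_N : m * m + m + 2 <= N.
Hypothesis big_bnd : m.+2 ^ 5 * (2 * B + 4) <= bnd.
Hypothesis cap_B : forall e : edge M, cap e <= B.

Implicit Types (e d : edge M) (x y z : vec M) (w : worker M).
Implicit Types (s : state) (L K : dcycle M).

Notation runs := (runs (market_oracle M) bnd N g).

Let pow_m : m.+2 ^ 5 = m.+2 * m.+2 * m.+2 * m.+2 * m.+2.
Proof. by rewrite !expnS expn0; lia. Qed.

(** The largest numbers that occur are positions in tables with at most [m * m]
    rows and columns, and sums over the [m] edges. *)
Lemma bnd_poly n : n <= (m * m).+1 * ((m * m).+1) + (m * m).+1 -> n < bnd.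
Proof. by move=> le_n; apply: leq_trans big_bnd; rewrite pow_m; clear -le_n; nia. Qed.

Lemma bnd_num n : n <= m * B + 2 * B + 2 -> n < bnd.
Proof. by move=> le_n; apply: leq_trans big_bnd; rewrite pow_m; clear -le_n; nia. Qed.

Lemma bnd_bool (b : bool) : b < bnd.
Proof. by apply: bnd_poly; case: b; rewrite // addnS. Qed.

Lemma bnd_cap n : n <= 2 * B + 2 -> n < bnd.
Proof. by move=> le_n; apply: bnd_num; clear -le_n; lia. Qed.

Lemma bnd_le n : n <= B -> n < bnd.
Proof. by move=> le_n; apply: bnd_num; clear -le_n; lia. Qed.

Lemma bnd_edge n : n <= m.+1 -> n < bnd.
Proof. by move=> le_n; apply: bnd_poly; clear -le_n; nia. Qed.

Lemma loop_edge : m <= N /\ m < bnd.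
Proof. by split; [clear -le_N; lia|apply: bnd_edge]. Qed.

Definition inp s := forall a, a < 7 -> s a = input xmin a.

Lemma inp_frame W s s' : frame W s s' -> inp s -> all (fun a => 7 <= a) W -> inp s'.
Proof.
move=> fr i aW a lt_a; rewrite fr ?i //; apply/negP => /(allP aW).
by rewrite leqNgt lt_a.
Qed.

Definition rep s (a : nat) (x : vec M) := forall e, s a (num e) = x e.

Section Input.
Variable s : state.
Hypothesis si : inp s.
Lemma inp_m : s 0 2 = m. Proof. by rewrite si. Qed.
Lemma inp_wend e : s 1 (num e) = num (wend e).
Proof. by rewrite si //; exact: (nth_num 0 (fun e => num (wend e))). Qed.
Lemma inp_fend e : s 2 (num e) = num (fend e).
Proof. by rewrite si //; exact: (nth_num 0 (fun e => num (fend e))). Qed.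
Lemma inp_cap e : s 3 (num e) = cap e.
Proof. by rewrite si //; apply: (nth_num 0 (fun e => cap e)). Qed.
Lemma inp_quota w : s 4 (num w) = quota w.
Proof. by rewrite si //; apply: (nth_num 0 (fun w => quota w)). Qed.
Lemma inp_pref e : s 5 (num e) = pref_position e.
Proof. by rewrite si //; apply: (nth_num 0 (fun e => pref_position e)). Qed.
Lemma inp_xmin : rep s 6 xmin.
Proof. by move=> e; rewrite si //; apply: (nth_num 0 (fun e => xmin e)). Qed.
End Input.

Lemma runs_ask v s e x (Q : state -> Prop) : inp s -> s v 0 = num e ->
    rep s aX x -> inB (inr (fend e)) (xf (fend e) x) ->
    (forall s', frame [:: aR] s s' ->
       (forall d, fend d = fend e -> s' aR (num d) = fchoice (fend e) (xf (fend e) x) d) ->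
       Q s') ->
  runs (askFirm v) s Q.
Proof.
move=> si sv sx Bx fin.
have zE : [ffun d => if fend d == fend e then s aX (num d) else 0] = xf (fend e) x.
  by apply/ffunP => d; rewrite !ffunE sx.
pose A i := if onth (enum (edge M)) i is Some d then
  if fend d == fend e then fchoice (fend e) (xf (fend e) x) d else s aR i else s aR i.
exists (set_array s aR A), (cost (Get 2 (V v))).+1; split=> //.
  apply: exec_ask => //; rewrite /= sv (inp_fend si) /market_oracle onth_num.
  by rewrite zE Bx.
apply: fin => [a|d fd]; first by rewrite inE /set_array => /negbTE->.
by rewrite /set_array eqxx /A onth_num fd eqxx.
Qed.

(** The last edge of the worker need not be known: if the edges at least as good
    as [e] use up the quota, nothing below [e] is held, and if their sum is
    positive, the last edge is one of them. *)
Lemma W_candidate_sum x e : g_alloc x ->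
  W_candidate x (wend e) e =
  [&& \sum_(d | (wend d == wend e) && (pref_position d <= pref_position e)) x d == quota (wend e),
      0 < \sum_(d | (wend d == wend e) && (pref_position d <= pref_position e)) x d &
      inter x e].
Proof.
move=> gx; set S := \sum_(d | _) x d; set w := wend e.
have le_q := galloc_quota ax gx w; rewrite vnorm_restr_w in le_q.
have split_sum : \sum_(d | wend d == w) x d =
    S + \sum_(d | (wend d == w) && ~~ (pref_position d <= pref_position e)) x d.
  by rewrite (bigID (fun d => pref_position d <= pref_position e)).
apply/(W_candidateP ax)/and3P => [[full [d wd xd] up ie]|[/eqP Sq S0 ie]].
  rewrite vnorm_restr_w split_sum [X in _ + X]big1 in full; last first.
    move=> d' /andP[/eqP wd']; rewrite -(weak_pref_position ax (w := w)) // => np.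
    by apply/eqP; apply: contraNT np => xd'; apply: up.
  rewrite addn0 in full; split=> //; first exact/eqP.
  have upd := up d wd xd; rewrite (weak_pref_position ax (w := w)) // in upd.
  rewrite lt0n; apply: contraNneq xd => /eqP; rewrite sum_nat_eq0 => /forallP/(_ d).
  by rewrite wd eqxx upd.
have rest0 : \sum_(d | (wend d == w) && ~~ (pref_position d <= pref_position e)) x d = 0.
  by move: le_q; rewrite split_sum -/S Sq -/w; clear; lia.
split=> //.
- by rewrite vnorm_restr_w split_sum rest0 addn0.
- have [d] : exists d, ((wend d == w) && (pref_position d <= pref_position e)) && (x d != 0).
    apply/existsP; apply: contraTT S0; rewrite negb_exists => /forallP x0.
    rewrite -eqn0Ngt /S sum_nat_eq0; apply/forallP => d; apply/implyP => hd.
    by have := x0 d; rewrite hd /= negbK.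
  by case/andP=> /andP[/eqP wd _] xd; exists d.
- move=> d wd xd; rewrite (weak_pref_position ax (w := w)) //.
  apply: contraT => np; move/eqP: rest0; rewrite sum_nat_eq0 => /forallP/(_ d).
  by rewrite wd eqxx np /= (negbTE xd).
Qed.

Lemma pCandidate_spec s x e : inp s -> rep s aX x -> g_alloc x -> s vE 0 = num e ->
  runs pCandidate s (fun s' => [/\ rep s' aX x,
    s' aCand (num e) = W_candidate x (wend e) e &
    forall j, j != num e -> s' aCand j = s aCand j]).
Proof.
move=> si sx gx se; have [loopN loopb] := loop_edge.
pose F j := if (s 1 j == s 1 (num e)) && (s 5 j <= s 5 (num e)) then s aX j else 0.
have le_F j : j < m -> F j <= B.
  case/(@num_onto (edge M)) => d <-; rewrite /F; case: ifP => // _.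
  by rewrite sx (leq_trans (galloc_cap gx d)).
have le_sum i : i <= m -> \sum_(0 <= j < i) F j <= i * B.
  elim: i => [|i IH] lt_i; first by rewrite big_geq.
  rewrite big_nat_recr //= mulSn addnC leq_add //; first exact: le_F.
  by apply: IH; apply: ltnW.
have sumE : \sum_(0 <= j < m) F j =
    \sum_(d | (wend d == wend e) && (pref_position d <= pref_position e)) x d.
  rewrite sum_num [RHS]big_mkcond; apply: eq_bigr => d _.
  by rewrite /F !inp_wend // !inp_pref // num_eq sx.
apply: runs_seq; apply: runs_put => // s1 [u1 u1s _].
apply: runs_seq.
apply: (runs_for (n := m)
  (I := fun i s' => s' vSum 0 = \sum_(0 <= j < i) F j)) => //.
- by move=> s' fr; rewrite /= fr // u1 // inp_m.
- by move=> i s' s'' E u; rewrite u.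
- by rewrite u1s big_geq.
- move=> i s' lt_i fr Ei Is.
  have rd a : a \notin [:: vI; vSum] -> s' a = s a.
    by rewrite !inE negb_or => /andP[n1 n2]; rewrite fr ?u1 // !inE negb_or n1.
  have E1 : s' 1 = s 1 by apply: rd.
  have E5 : s' 5 = s 5 by apply: rd.
  have EX : s' aX = s aX by apply: rd.
  have EE : s' vE = s vE by apply: rd.
  have le_S := le_sum _ lt_i.
  have Frec : \sum_(0 <= j < i.+1) F j = \sum_(0 <= j < i) F j + F i by rewrite big_nat_recr.
  apply: runs_if => [|c1|c1].
  + by rewrite /= !bnd_bool.
  + move: c1; rewrite !evalE /= E1 E5 EE Ei se => c1.
    have FiE : F i = s aX i by rewrite /F c1.
    apply: runs_put => //=.
      rewrite Is EX Ei -FiE -Frec bnd_num // (leq_trans le_S) //.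
      by rewrite -addnA (leq_trans _ (leq_addr _ _)) // leq_mul2r lt_i orbT.
    by move=> s2 [_ -> _]; rewrite Is EX Ei -FiE -Frec.
  + move: c1; rewrite !evalE /= E1 E5 EE Ei se => c1.
    have FiE : F i = 0 by rewrite /F (negbTE c1).
    by apply: runs_skip; rewrite Frec FiE addn0 Is.
move=> s2 fr2 S2; rewrite sumE in S2.
have rd2 a : a \notin [:: vI; vSum] -> s2 a = s a.
  by rewrite !inE negb_or => /andP[n1 n2]; rewrite fr2 ?u1 // !inE negb_or n1.
apply: runs_seq; apply: runs_put => // s3 [u3 u3c u3o].
rewrite /= rd2 // se in u3c u3o.
have rd3 a : a \notin [:: vI; vSum; aCand] -> s3 a = s a.
  by rewrite !inE !negb_or => /and3P[n1 n2 n3]; rewrite u3 ?rd2 // !inE negb_or n1 n2.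
have o3 j : j != num e -> s3 aCand j = s aCand j.
  by move=> nj; rewrite u3o // rd2.
have se3 : s3 vE 0 = num e by rewrite rd3.
have s3i : inp s3 by move=> a lt_a; rewrite rd3 ?si // !inE; case: a lt_a => [|[|[|[|[|[|[|]]]]]]].
have s3x : rep s3 aX x by move=> d; rewrite rd3.
have s3S : s3 vSum 0 = s2 vSum 0 by rewrite u3.
have candE := W_candidate_sum e gx; rewrite -S2 -s3S in candE.
apply: runs_if => [|c4|c4].
- by rewrite /= !bnd_bool.
- move: c4; rewrite !evalE /= se3 inp_wend // inp_quota // s3x inp_cap //.
  move=> /andP[/andP[cq c0] lt_cap].
  rewrite cq c0 /= in candE.
  apply: runs_seq; apply: runs_put => //=.
    rewrite se3 s3x bnd_cap // addn1; apply: leq_trans lt_cap _.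
    by apply: leq_trans (cap_B e) _; clear; lia.
  rewrite se3 s3x => s4 [u4 u4e u4o].
  pose x1 := vadd x e 1.
  have s4x : rep s4 aX x1.
    move=> d; rewrite vaddE; case: eqP => [->|/eqP ne] //.
    by rewrite u4o ?s3x // num_eq.
  have x1E : xf (fend e) x1 = vadd (xf (fend e) x) e 1.
    apply/ffunP => d; rewrite vaddE ![restr _ _ d]ffunE vaddE.
    by have [->|] := eqVneq d e; rewrite /= ?eqxx.
  have s4i : inp s4 by move=> a lt_a; rewrite u4 ?s3i //; case: eqP lt_a => // ->.
  apply: runs_seq; apply: (runs_ask (e := e) (x := x1)) => //.
  + by rewrite u4.
  + by rewrite x1E; apply: inB_offer.
  move=> s5 fr5 R5.
  have s5e : s5 vE 0 = num e by rewrite fr5 // u4.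
  apply: runs_seq; apply: runs_put => //=.
    rewrite s5e fr5 // s4x bnd_cap // (leq_trans (leq_subr _ _)) //.
    rewrite vaddE eqxx addn1; apply: leq_trans lt_cap _.
    by apply: leq_trans (cap_B e) _; clear; lia.
  rewrite s5e fr5 // s4x vaddE eqxx addnK => s6 [u6 u6e u6o].
  have s6x : rep s6 aX x.
    move=> d; have [->//|ne] := eqVneq d e.
    by rewrite u6o ?num_eq // fr5 // s4x vaddE (negbTE ne).
  have s6e : s6 vE 0 = num e by rewrite u6.
  have s6c j : s6 aCand j = s3 aCand j by rewrite u6 // fr5 // u4.
  have interE : inter x e = (x e < s6 aR (num e)).
    rewrite u6 // R5 // x1E; apply/(interP ax gx)/idP => [[]|] //.
  apply: runs_if => [|c7|c7].
  + by rewrite /= bnd_bool.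
  + move: c7; rewrite !evalE /= s6e s6x -interE => c7.
    apply: runs_put => // s7 [u7 u7e u7o]; rewrite /= s6e in u7e u7o; split.
    * by move=> d; rewrite u7.
    * by rewrite u7e candE c7.
    * by move=> j nj; rewrite u7o // s6c o3.
  + move: c7; rewrite !evalE /= s6e s6x -interE => c7.
    apply: runs_skip; split=> //.
    * by rewrite s6c u3c candE (negbTE c7).
    * by move=> j nj; rewrite s6c o3.
- move: c4; rewrite !evalE /= se3 inp_wend // inp_quota // s3x inp_cap // => c4.
  apply: runs_skip; split=> //; rewrite u3c candE.
  have [ie|] := boolP (inter x e); last by rewrite !andbF.
  by move: c4; rewrite (inter_cap ie) !andbT => /negbTE->.
Qed.

Lemma rep_frame W s s' (a : nat) x : a \notin W -> frame W s s' -> rep s a x -> rep s' a x.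
Proof. by move=> aW fr sx d; rewrite fr. Qed.

Lemma pExchange_spec s x a c t : inp s -> rep s aX x -> g_alloc x ->
    s vA 0 = num a -> s vC 0 = num c -> s vT 0 = t -> x a + t <= cap a ->
    fend c = fend a ->
  runs pExchange s (fun s' => rep s' aX x /\
    s' vFlag 0 = (let z := vadd (xf (fend a) x) a t in
                  vadd (fchoice (fend a) z) c t == z)).
Proof.
move=> si sx gx sa sc st le_cap fc; have [loopN loopb] := loop_edge.
pose x1 := vadd x a t; set f := fend a.
have x1E : xf f x1 = vadd (xf f x) a t.
  apply/ffunP => d; rewrite vaddE ![restr _ _ d]ffunE vaddE.
  by have [->|] := eqVneq d a; rewrite /= ?eqxx.
have Bx1 : inB (inr f) (vadd (xf f x) a t).
  by apply: inB_vadd => //; [exact: galloc_inB | rewrite restr_f_edge].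
have le_B : x a + t <= B by apply: leq_trans le_cap (cap_B a).
have le_t : t <= B by apply: leq_trans le_B; rewrite leq_addl.
apply: runs_seq; apply: runs_put => //=.
  by rewrite sa sx st bnd_le.
rewrite sa sx st => s1 [u1 u1a u1o].
have s1x : rep s1 aX x1.
  move=> d; rewrite vaddE; case: eqP => [->|/eqP ne] //.
  by rewrite u1o ?sx // num_eq.
have s1i : inp s1 by move=> b lt_b; rewrite u1 ?si //; case: eqP lt_b => // ->.
apply: runs_seq; apply: (runs_ask (e := a) (x := x1)) => //.
- by rewrite u1.
- by rewrite x1E.
move=> s2 fr2 R2; rewrite x1E -/f in R2.
have s2x : rep s2 aX x1 by apply: rep_frame fr2 s1x.
have s2i : inp s2 by exact: (inp_frame fr2 s1i isT).
have [s2a s2c s2t] : [/\ s2 vA 0 = num a, s2 vC 0 = num c & s2 vT 0 = t].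
  by rewrite !fr2 // !u1.
pose A i := (s2 2 i == s2 2 (num a)) ==> (s2 aR i + (i == num c) * t == s2 aX i).
apply: runs_seq; apply: (runs_all m A) => //.
- by move=> s3 fr3; rewrite /= fr3 // inp_m.
- move=> i s3 lt_i fr3 s3i.
  rewrite !evalE /= s3i !fr3 // s2a s2c s2t; split=> //; first by rewrite bnd_bool.
  have [d <-] := @num_onto (edge M) _ lt_i.
  rewrite !inp_fend // num_eq => /eqP fd; rewrite !bnd_bool /= R2 // andbT.
  have le_R : fchoice f (vadd (xf f x) a t) d <= B.
    rewrite (leq_trans (C_leE ax d Bx1)) //.
    by move/forallP: Bx1 => /(_ d) /leq_trans; apply; case: ifP.
  have le_m : (num d == num c) * t <= B by apply: leq_trans le_t; case: (_ == _); rewrite ?mul1n.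
  rewrite !bnd_cap //; first by move: le_R le_m; clear; lia.
  by move: le_m; clear; lia.
- move=> s3 fr3 flag3.
  apply: runs_put => //=.
    by rewrite !fr3 // s2a s2t s2x bnd_le // (leq_trans (leq_subr _ _)) // vaddE eqxx.
  rewrite !fr3 // s2a s2t s2x vaddE eqxx addnK => s4 [u4 u4a u4o]; split.
    move=> d; have [->//|ne] := eqVneq d a.
    by rewrite u4o ?num_eq // fr3 // s2x vaddE (negbTE ne).
  rewrite u4 // flag3 all_num; congr nat_of_bool; apply/forallP/eqP => [h|h d].
    apply/ffunP => d; rewrite [in LHS]vaddE; have := h d.
    rewrite /A !inp_fend // !num_eq.
    have [fd|fd] := eqVneq (fend d) (fend a).
      rewrite /= R2 // s2x -x1E [xf f x1 d]ffunE /= fd eqxx => /eqP <-.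
      by case: (d == c); rewrite ?mul1n ?mul0n ?addn0.
    have dc : d != c by apply: contraNneq fd => ->; rewrite fc.
    rewrite (negbTE dc) (inB_out (inB_C ax Bx1)) // -x1E [RHS]ffunE /=.
    by rewrite (negbTE fd).
  rewrite /A !inp_fend // !num_eq; apply/implyP => /eqP fd; rewrite R2 // s2x.
  move: (congr1 (fun v : vec M => v d) h); rewrite vaddE -[in RHS]x1E.
  rewrite [RHS]ffunE /= fd eqxx => <-.
  by case: (d == c); rewrite ?mul1n ?mul0n ?addn0.
Qed.

Lemma W_admissible_pos x a : W_admissible x a =
  W_candidate x (wend a) a &&
  [forall d, (W_candidate x (wend d) d && (wend d == wend a)) ==>
             (pref_position a <= pref_position d)].
Proof.
rewrite /W_admissible; congr (_ && _); apply/forallP/forallP => h d.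
  apply/implyP => /andP[cd /eqP wd]; have := h d; rewrite -wd cd /=.
  have [->//|ne] := eqVneq d a; rewrite pref_position_lt //=.
  exact: ltnW.
apply/implyP => /andP[cd ne]; have wd : wend d = wend a by case/and4P: cd => /eqP.
have := h d; rewrite wd cd eqxx /= -(weak_pref_position ax (w := wend a)) //.
by rewrite eq_sym (negbTE ne).
Qed.

Definition boolrep s (a : nat) (P : edge M -> bool) := forall e, s a (num e) = P e.

Lemma pAdmissible_spec s x a : inp s ->
    boolrep s aCand (fun e => W_candidate x (wend e) e) -> s vA 0 = num a ->
  runs pAdmissible s (fun s' => s' aAdm (num a) = W_admissible x a /\
    forall j, j != num a -> s' aAdm j = s aAdm j).
Proof.
move=> si sc sa; have [loopN loopb] := loop_edge.
pose A i := ((s aCand i != 0) && (s 1 i == s 1 (num a))) ==> (s 5 (num a) <= s 5 i).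
apply: runs_seq; apply: (runs_all m A) => //.
- by move=> s1 fr; rewrite /= fr // inp_m.
- move=> i s1 lt_i fr Ei; rewrite !evalE /= Ei !fr // sa; split=> //; rewrite ?bnd_bool //.
move=> s1 fr flag1; apply: runs_put => //=; first by rewrite bnd_bool.
rewrite (fr vA isT) (fr aCand isT) sa flag1 => s2 [_ -> u2].
split; last by move=> j nj; rewrite u2 // fr.
rewrite sc all_num W_admissible_pos !eqb0 !negbK.
congr nat_of_bool; congr (_ && _); apply: eq_forallb => d.
by rewrite /A sc !inp_wend // !inp_pref // num_eq eqb0 negbK.
Qed.

Lemma bnd_idx i j n : i < n -> j < m -> n <= (m * m).+1 -> i * m + j < bnd /\ i * m < bnd.
Proof.
move=> lt_i lt_j le_n; have := idx_lt lt_i lt_j => lt_k.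
have le_k : i * m + j <= (m * m).+1 * (m * m).+1.
  apply: leq_trans (ltnW lt_k) _; apply: leq_mul => //.
  by move: lt_j; clear; nia.
split; apply: bnd_poly; move: le_k; clear; lia.
Qed.

Lemma bnd_tan a c : a < m -> c < m -> a * m + c < bnd /\ a * m < bnd.
Proof.
by move=> lt_a lt_c; apply: bnd_idx lt_a lt_c _; clear; nia.
Qed.

Lemma pTandem_spec s x a c : inp s -> rep s aX x -> g_alloc x ->
    boolrep s aAdm (W_admissible x) -> s vA 0 = num a -> s vC 0 = num c ->
  runs pTandem s (fun s' => [/\ rep s' aX x,
    s' aTan (num a * m + num c) = tandem x a c &
    forall j, j != num a * m + num c -> s' aTan j = s aTan j]).
Proof.
move=> si sx gx sadm sa sc.
apply: runs_seq; apply: runs_put => // s1 [u1 u1f _].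
have s1i : inp s1 by move=> b lt_b; rewrite u1 ?si //; case: eqP lt_b => // ->.
have s1x : rep s1 aX x by move=> d; rewrite u1.
have [b1 b2] := bnd_tan (num_lt a) (num_lt c).
have last s2 : frame [:: aX; aR; vFlag; vI; vT] s1 s2 -> rep s2 aX x ->
    s2 vFlag 0 = tandem x a c ->
  runs (PPut aTan (eCell (V vA) (V vC) nE) (V vFlag)) s2 (fun s' => [/\ rep s' aX x,
    s' aTan (num a * m + num c) = tandem x a c &
    forall j, j != num a * m + num c -> s' aTan j = s aTan j]).
  move=> fr2 s2x fl2; have s2i : inp s2 by exact: (inp_frame fr2 s1i isT).
  have [s2a s2c] : s2 vA 0 = num a /\ s2 vC 0 = num c by rewrite !fr2 // !u1.
  apply: runs_put => //=; first by rewrite s2a s2c inp_m // b1 b2.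
  rewrite s2a s2c inp_m // => s3 [u3 u3t u3o]; split.
  - by move=> d; rewrite u3.
  - by rewrite u3t fl2.
  - by move=> j nj; rewrite u3o // fr2 // u1.
apply: runs_seq; apply: runs_if => [|c2|c2].
- by rewrite /= !bnd_bool.
- move: c2; rewrite !evalE /= !u1 // sa sc !inp_fend // !num_eq sadm.
  case/andP=> /andP[adm /eqP fc] nca; rewrite eqb0 negbK in adm.
  apply: runs_seq; apply: runs_put => // s2 [u2 u2t _].
  have lt_cap := inter_cap (W_admissible_inter ax adm).
  apply: runs_conseq (pExchange_spec (x := x) (a := a) (c := c) (t := 1) _ _ _ _ _ _ _ _) _ => //.
  + by move=> b lt_b; rewrite u2 ?s1i //; case: eqP lt_b => // ->.
  + by move=> d; rewrite u2.
  + by rewrite u2 // u1.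
  + by rewrite u2 // u1.
  + by rewrite addn1.
  move=> s3 fr3 [s3x fl3]; apply: last => //.
    move=> b; rewrite !inE !negb_or => /and5P[n1 n2 n3 n4 n5].
    by rewrite fr3 ?u2 // !inE !negb_or n1 n2 n3 n4.
  by rewrite fl3 /tandem adm fc eqxx nca.
- move: c2; rewrite !evalE /= !u1 // sa sc !inp_fend // !num_eq sadm eqb0 negbK => c2.
  apply: runs_skip; apply: last => //.
  suff /negbTE-> : ~~ tandem x a c by rewrite u1f.
  by apply: contra c2; case/and4P=> -> -> -> _.
Qed.

Definition tanrep s x := forall a c, s aTan (num a * m + num c) = tandem x a c.

Lemma pTandems_spec s x : inp s -> rep s aX x -> g_alloc x ->
  runs pTandems s (fun s' => [/\ rep s' aX x, boolrep s' aAdm (W_admissible x) &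
    tanrep s' x]).
Proof.
move=> si sx gx; have [loopN loopb] := loop_edge.
apply: runs_seq.
apply: (runs_for (n := m) (I := fun i s' => rep s' aX x /\
  forall e, num e < i -> s' aCand (num e) = W_candidate x (wend e) e)) => //.
- by move=> s' fr; rewrite /= fr // inp_m.
- by move=> i s1 s2 [h1 h2] u; split=> e; rewrite u //; apply: h2.
- move=> i s1 lt_i fr Ei [s1x Is]; have [e Ee] := @num_onto (edge M) _ lt_i.
  apply: runs_conseq (pCandidate_spec (x := x) (e := e) _ _ _ _) _ => //.
  + exact: (inp_frame fr si isT).
  + by rewrite Ei Ee.
  move=> s2 fr2 [s2x c2 o2]; split=> // d; rewrite ltnS leq_eqVlt => /orP[/eqP Ed|lt_d].
    by have -> : d = e by apply: (@num_inj (edge M)); rewrite Ee.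
  by rewrite o2 ?Is // Ee neq_ltn lt_d.
move=> s1 fr1 [s1x c1]; have s1i := inp_frame fr1 si isT.
have {}c1 : boolrep s1 aCand (fun e => W_candidate x (wend e) e).
  by move=> e; apply: c1; apply: num_lt.
apply: runs_seq.
apply: (runs_for (n := m) (I := fun i s' =>
  forall e, num e < i -> s' aAdm (num e) = W_admissible x e)) => //.
- by move=> s' fr; rewrite /= fr // inp_m.
- by move=> i s2 s3 h u e; rewrite u //; apply: h.
- move=> i s2 lt_i fr Ei Is; have [a Ea] := @num_onto (edge M) _ lt_i.
  apply: runs_conseq (pAdmissible_spec (x := x) (a := a) _ _ _) _ => //.
  + exact: (inp_frame fr s1i isT).
  + by move=> e; rewrite fr // c1.
  + by rewrite Ei Ea.
  move=> s3 fr3 [c3 o3] d; rewrite ltnS leq_eqVlt => /orP[/eqP Ed|lt_d].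
    by have -> : d = a by apply: (@num_inj (edge M)); rewrite Ea.
  by rewrite o3 ?Is // Ea neq_ltn lt_d.
move=> s2 fr2 c2; have s2i := inp_frame fr2 s1i isT.
have {}c2 : boolrep s2 aAdm (W_admissible x).
  by move=> e; apply: c2; apply: num_lt.
have s2x : rep s2 aX x by apply: rep_frame fr2 s1x.
apply: (runs_for (n := m) (I := fun i s' => rep s' aX x /\
  forall a c, num a < i -> s' aTan (num a * m + num c) = tandem x a c)) => //.
- by move=> s' fr; rewrite /= fr // inp_m.
- by move=> i s3 s4 [h1 h2] u; split=> [d|d c lt_d]; rewrite u //; apply: h2.
- move=> i s3 lt_i fr3 Ei [s3x Is]; have [a Ea] := @num_onto (edge M) _ lt_i.
  have s3i := inp_frame fr3 s2i isT.
  apply: (runs_for (n := m) (I := fun k s' => [/\ rep s' aX x,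
     (forall c, num c < k -> s' aTan (num a * m + num c) = tandem x a c) &
     (forall j, j < i * m -> s' aTan j = s3 aTan j)])) => //.
  + by move=> s' fr; rewrite /= fr // inp_m.
  + by move=> k s4 s5 [h1 h2 h3] u; split=> d *; rewrite u //; [apply: h2|apply: h3].
  + move=> k s4 lt_k fr4 Ek [s4x Is4 o4]; have [c Ec] := @num_onto (edge M) _ lt_k.
    apply: runs_conseq (pTandem_spec (x := x) (a := a) (c := c) _ _ _ _ _ _) _ => //.
    * exact: (inp_frame fr4 s3i isT).
    * by move=> e; rewrite fr4 // fr3 // c2.
    * by rewrite fr4 // Ei Ea.
    * by rewrite Ek Ec.
    move=> s5 fr5 [s5x t5 o5]; split=> //.
      move=> d; rewrite ltnS leq_eqVlt => /orP[/eqP Ed|lt_d].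
        by have -> : d = c by apply: (@num_inj (edge M)); rewrite Ec.
      by rewrite o5 ?Is4 // eqn_add2l Ec neq_ltn lt_d.
    move=> j lt_j; rewrite o5 ?o4 // neq_ltn Ea.
    by rewrite (leq_trans lt_j) ?leq_addr.
  move=> s4 fr4 [s4x t4 o4]; split=> // b c; rewrite ltnS leq_eqVlt => /orP[/eqP Eb|lt_b].
    have -> : b = a by apply: (@num_inj (edge M)); rewrite Ea.
    by apply: t4; apply: num_lt.
  by rewrite o4 ?Is // idx_lt ?num_lt.
move=> s3 fr3 [s3x t3]; split=> //.
  by move=> e; rewrite fr3 // c2.
by move=> a c; apply: t3; apply: num_lt.
Qed.

End Spec.

(** * Finding a rotation *)

(** The value [m] marks edges without successor; cell [m] of [aNext] is set as
    well, so that iteration stays there. *)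
Definition pNext :=
  PSeq (PFor vA (V vM1) (PPut aNext (V vA) nE))
  (PFor vA nE (PFor vC nE
     (PIf (Get aTan (eCell (V vA) (V vC) nE))
        (PSeq (PPut aNextC (V vA) (V vC))
        (PFor vI nE
           (PIf (Op And (Get aAdm (V vI)) (eSame 1 (V vI) (V vC)))
              (PPut aNext (V vA) (V vI)) PSkip)))
        PSkip))).

(** The length [vLen] is 0 until an edge that returns to itself is found; the
    first return gives the exact length of the cycle. *)
Definition pCycle :=
  PSeq (PPut vLen z0 z0)
  (PFor vA nE
     (PSeq (PPut vCur z0 (V vA))
     (PFor vI nE
        (PSeq (PPut vCur z0 (Get aNext (V vCur)))
        (PIf (Op And (Op Eq (V vLen) z0) (Op Eq (V vCur) (V vA)))
           (PSeq (PPut vLen z0 (Op Add (V vI) z1)) (PPut vStart z0 (V vA)))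
           PSkip))))).

Definition pRecord :=
  PSeq (PPut vCur z0 (V vStart))
  (PSeq (PFor vI (V vLen)
     (PSeq (PPut 10 (eCell (V vRow) (V vI) nE) (V vCur))
     (PSeq (PPut 11 (eCell (V vRow) (V vI) nE) (Get aNextC (V vCur)))
     (PPut vCur z0 (Get aNext (V vCur))))))
  (PPut 8 (V vRow) (V vLen))).

Section Spec.

Variables (M : market) (ax : market_axioms M) (xmin : vec M).
Variables (bnd N g B : nat).
Notation m := #|edge M|.
Hypothesis le_N : m * m + m + 2 <= N.
Hypothesis big_bnd : m.+2 ^ 5 * (2 * B + 4) <= bnd.

Implicit Types (e d a c : edge M) (x y z : vec M) (w : worker M).
Implicit Types (s : state) (L K : dcycle M).

Notation runs := (runs (market_oracle M) bnd N g).
Notation inp := (inp xmin).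

Let bndb := bnd_bool le_N big_bnd.
Let inp_m := @inp_m M xmin.
Let inp_wend := @inp_wend M xmin.

Definition follows x a c a' :=
  [&& tandem x a c, W_admissible x a' & wend a' == wend c].

Lemma follows_uniq x a c a' d b' : follows x a c a' -> follows x a d b' ->
  c = d /\ a' = b'.
Proof.
case/and3P=> t adm /eqP w /and3P[t' adm' /eqP w'].
have E := tandem_uniq t t'; split=> //; rewrite -E in w'.
by apply: (W_admissible_uniq ax _ adm adm'); rewrite w.
Qed.

Definition nextrep s x :=
  (forall a, s aNext (num a) = m \/ exists c a', [/\ follows x a c a',
     s aNext (num a) = num a' & s aNextC (num a) = num c]) /\
  (forall a c a', follows x a c a' -> s aNext (num a) != m) /\ s aNext m = m.

Lemma pNext_spec s x : inp s -> s vM1 0 = m.+1 -> boolrep s aAdm (W_admissible x) ->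
  tanrep s x -> runs pNext s (fun s' => nextrep s' x).
Proof.
move=> si sM sadm stan; have [loopN loopb] := loop_edge le_N big_bnd.
apply: runs_seq; apply: (runs_for (n := m.+1) (I := fun i s' =>
  forall j, j < i -> s' aNext j = m)) => //.
- by rewrite (leq_trans _ le_N) // addn2 ltnS (leq_trans _ (leqnSn _)) // leq_addl.
- exact: (bnd_edge le_N big_bnd).
- by move=> s' fr; rewrite /= fr.
- by move=> i s1 s2 h u j; rewrite u //; apply: h.
- move=> i s1 lt_i fr Ei Is; apply: runs_put => // s2 [u2 u2i u2o] j.
  rewrite /= Ei in u2i u2o; rewrite ltnS leq_eqVlt => /orP[/eqP->|lt_j].
    by rewrite u2i fr // inp_m.
  by rewrite u2o ?Is // neq_ltn lt_j.
move=> s1 fr1 I1; have s1i : inp s1 := inp_frame fr1 si isT.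
pose row s' a i := (s' aNext (num a) = m \/ exists c a', [/\ follows x a c a',
     s' aNext (num a) = num a' & s' aNextC (num a) = num c]) /\
  (forall c a', follows x a c a' -> num c < i -> s' aNext (num a) != m).
apply: (runs_for (n := m) (I := fun i s' => [/\
  (forall a, num a < i -> row s' a m),
  (forall j, i <= j <= m -> s' aNext j = m) &
  s' aNext m = m])) => //.
- by move=> s' fr; rewrite /= fr // inp_m.
- by move=> i s2 s3 [h1 h2 h3] u; split=> *; rewrite /row ?u //; [apply: h1|apply: h2].
- by split=> //; apply: I1.
- move=> i s2 lt_i fr2 Ei [done2 todo2 end2].
  have [a Ea] := @num_onto (edge M) _ lt_i; have s2i : inp s2 := inp_frame fr2 s1i isT.
  apply: (runs_for (n := m) (I := fun k s' => row s' a k /\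
    (forall j, j != num a -> s' aNext j = s2 aNext j /\ s' aNextC j = s2 aNextC j))) => //.
  + by move=> s' fr; rewrite /= fr // inp_m.
  + by move=> k s3 s4 [h1 h2] u; split=> *; rewrite /row ?u //; apply: h2.
  + by split=> //; split=> //; left; rewrite todo2 // Ea leqnn ltnW.
  + move=> k s3 lt_k fr3 Ek [[row1 row2] off3].
    have [c Ec] := @num_onto (edge M) _ lt_k.
    have s3i : inp s3 := inp_frame fr3 s2i isT.
    have s3A : s3 vA 0 = num a by rewrite fr3 // Ei Ea.
    have s3C : s3 vC 0 = num c by rewrite Ek Ec.
    have s3t : s3 aTan (num a * m + num c) = tandem x a c.
      by rewrite fr3 // fr2 // fr1 // stan.
    have [b1 b2] := bnd_tan le_N big_bnd (num_lt a) (num_lt c).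
    apply: runs_if => [|t3|t3].
    * by rewrite /= s3A s3C inp_m // b1 b2.
    * rewrite /= s3A s3C inp_m // s3t eqb0 negbK in t3.
      apply: runs_seq; apply: runs_put => // s4 [u4 u4c u4o].
      rewrite /= s3A s3C in u4c u4o.
      have s4i : inp s4 by move=> b lt_b; rewrite u4 ?s3i //; case: eqP lt_b => // ->.
      apply: (runs_for (n := m) (I := fun k' s' => [/\
        s' aNext (num a) = m \/ (exists2 a', follows x a c a' & s' aNext (num a) = num a'),
        (forall a', follows x a c a' -> num a' < k' -> s' aNext (num a) != m) &
        (forall j, j != num a -> s' aNext j = s2 aNext j)])) => //.
      - by move=> s' fr; rewrite /= fr // inp_m.
      - by move=> k' s5 s6 [h1 h2 h3] u; split; rewrite ?u.
      - split=> //; rewrite !u4 //; last by move=> j /off3[].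
        case: row1 => [->|[d [a' [fo -> _]]]]; [by left|right].
        by exists a' => //; rewrite -(tandem_uniq (proj1 (andP fo)) t3).
      - move=> k' s5 lt_k' fr5 Ek' [h1 h2 h3].
        have [a' Ea'] := @num_onto (edge M) _ lt_k'.
        have s5i : inp s5 := inp_frame fr5 s4i isT.
        have s5C : s5 vC 0 = num c by rewrite fr5 // u4.
        have s5A : s5 vA 0 = num a by rewrite fr5 // u4.
        have s5adm b : s5 aAdm (num b) = W_admissible x b.
          by rewrite fr5 // u4 // fr3 // fr2 // fr1 // sadm.
        apply: runs_if => [|c5|c5].
        + by rewrite /= !bndb.
        + move: c5; rewrite !evalE /= Ek' -Ea' s5C !inp_wend // num_eq s5adm eqb0 negbK.
          case/andP=> adm' w'; have fo : follows x a c a' by rewrite /follows t3 adm'.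
          apply: runs_put => // s6 [u6 u6a u6o]; rewrite /= s5A Ek' in u6a u6o.
          split; rewrite ?u6a.
          * by right; exists a'.
          * by move=> *; rewrite -Ea' neq_ltn num_lt.
          * by move=> j nj; rewrite u6o // h3.
        move: c5; rewrite !evalE /= Ek' -Ea' s5C !inp_wend // num_eq s5adm eqb0 negbK => c5.
        apply: runs_skip; split=> // b fo; rewrite ltnS leq_eqVlt => /orP[/eqP Eb|]; last by rewrite Ea'; apply: (h2 _ fo).
        have Eba : b = a' by apply: (@num_inj (edge M)); rewrite Eb Ea'.
        by move: c5; rewrite -Eba; case/and3P: fo => _ -> ->.
      move=> s5 fr5 [h1 h2 h3].
      have s5c j : s5 aNextC j = s4 aNextC j by rewrite fr5.
      split; last first.
        move=> j nj; split; first exact: h3.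
        by rewrite s5c u4o //; case: (off3 j nj).
      split.
        case: h1 => [->|[a' fo ->]]; [by left|right].
        by exists c, a'; rewrite s5c u4c.
      move=> d a' fo _; have Ed := tandem_uniq (proj1 (andP fo)) t3.
      by rewrite Ed in fo; apply: (h2 a') => //; apply: num_lt.
    rewrite /= s3A s3C inp_m // s3t eqb0 negbK in t3.
    apply: runs_skip; split=> //; split=> // d a' fo.
    rewrite ltnS leq_eqVlt => /orP[/eqP Ed|]; last by apply: (row2 _ _ fo).
    have Edc : d = c by apply: (@num_inj (edge M)); rewrite Ec.
    by move: t3; rewrite -Edc; case/andP: fo => ->.
  move=> s3 fr3 [row3 off3]; split.
  + move=> b; rewrite ltnS leq_eqVlt => /orP[/eqP Eb|lt_b].
      by have -> : b = a by apply: (@num_inj (edge M)); rewrite Ea.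
    have nb : num b != num a by rewrite Ea neq_ltn lt_b.
    by have [o1 o2] := off3 _ nb; rewrite /row o1 o2; apply: done2.
  + move=> j /andP[lt_j le_j]; have nj : j != num a by rewrite Ea neq_ltn lt_j orbT.
    by have [-> _] := off3 _ nj; apply: todo2; rewrite (ltnW lt_j).
  + by have [|-> _] := off3 m; rewrite // neq_ltn num_lt orbT.
move=> s2 fr2 [rows _ end2]; split; [|split=> //].
  by move=> a; have [] := rows a (num_lt a).
move=> a c a' fo; have [_ h] := rows a (num_lt a).
by apply: h fo _; apply: num_lt.
Qed.

(** The cycle [L] is read off by iterating [aNext] from [vStart]. *)
Definition traces s x L := [/\ rotation x L, size L = s vLen 0 &
  forall i p, onth L i = Some p ->
    iter i (s aNext) (s vStart 0) = num p.1 /\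
    s aNextC (iter i (s aNext) (s vStart 0)) = num p.2].

Lemma nextrep_follows s x a c a' : nextrep s x -> follows x a c a' ->
  s aNext (num a) = num a' /\ s aNextC (num a) = num c.
Proof.
case=> sound [complete _] fo; case: (sound a) => [E|[d [b' [fo' -> ->]]]].
  by have := complete _ _ _ fo; rewrite E eqxx.
by have [-> ->] := follows_uniq fo fo'.
Qed.

Lemma nextrep_inv s x i : nextrep s x -> s aNext i < m -> i < m ->
  exists a c a', [/\ follows x a c a', i = num a, s aNext i = num a' &
    s aNextC i = num c].
Proof.
move=> [sound _] lt_n lt_i; have [a Ea] := @num_onto (edge M) _ lt_i.
rewrite -Ea in lt_n *; case: (sound a) => [E|[c [a' [fo E1 E2]]]].
  by rewrite E ltnn in lt_n.
by exists a, c, a'.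
Qed.

Lemma rotation_period s x L a : nextrep s x -> rotation x L -> a \in plus_edges L ->
  iter (size L) (s aNext) (num a) = num a.
Proof.
move=> nx rL aL; have [fc uL] := rotation_fcycle ax rL.
have [c ta pL] := rotation_plus rL aL.
have step p : p \in L -> next_tandem x p \in L /\
    s aNext (num p.1) = num (next_tandem x p).1.
  move=> pL'; have [q qL Eq] := rotation_next rL pL'.
  have tq := rotation_tandem rL qL; have tp := rotation_tandem rL pL'.
  rewrite (next_tandemE ax tq Eq); split=> //.
  have fo : follows x p.1 p.2 q.1.
    by rewrite /follows tp (tandem_adm tq) Eq eqxx.
  by have [] := nextrep_follows nx fo.
have it i : iter i (next_tandem x) (a, c) \in L /\
    iter i (s aNext) (num a) = num (iter i (next_tandem x) (a, c)).1.
  elim: i => [//|i [inL E]]; have [inL' E'] := step _ inL.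
  by rewrite !iterS E E'.
have [_ ->] := it (size L).
have -> : size L = order (next_tandem x) (a, c) by rewrite (order_cycle fc uL pL).
by rewrite (iter_order_cycle fc pL pL).
Qed.

(** The iterates avoid [m], from which there is no return, so each of them is
    followed along a tandem; minimality of the period makes the cycle simple. *)
Lemma period_rotation s x i len : nextrep s x -> i < m -> 0 < len ->
    iter len (s aNext) i = i -> (forall k, 0 < k < len -> iter k (s aNext) i != i) ->
    s vLen 0 = len -> s vStart 0 = i ->
  exists L, traces s x L.
Proof.
move=> nx lt_i len_gt0 per min Elen Est; set f := s aNext.
have stuck k j : f j = m -> iter k.+1 f j = m.
  by move=> fj; elim: k => [//|k IH]; rewrite iterS IH; case: nx => _ [].
have lt_it k : k <= len -> iter k f i < m.
  elim: k => [//|k IH] lt_k; rewrite iterS ltn_neqAle.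
  have lt_kk := IH (ltnW lt_k); have [a Ea] := @num_onto (edge M) _ lt_kk.
  have nm : f (iter k f i) != m.
    apply/eqP => fm; have := stuck (len - k.+1) _ fm; rewrite -iterD.
    rewrite -subSn // subSS subnK ?(ltnW lt_k) // per => Em.
    by rewrite Em ltnn in lt_i.
  rewrite nm /=; case: nx => /(_ a) [Em|[c [a' [_ Ea' _]]]] _.
    by move: nm; rewrite -Ea [f _]Em eqxx.
  by rewrite -Ea [f _]Ea' ltnW // num_lt.
have [a0 _] := @num_onto (edge M) _ lt_i.
pose ed j : edge M := nth a0 (enum (edge M)) j.
have num_ed j : j < m -> num (ed j) = j.
  case/(@num_onto (edge M)) => e <-; rewrite /ed; congr num.
  exact: nth_enum_rank.
pose pair j := (ed j, ed (s aNextC j)).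
pose L : dcycle M := [seq pair j | j <- traject f i len].
have fo k : k < len -> follows x (ed (iter k f i)) (ed (s aNextC (iter k f i)))
    (ed (iter k.+1 f i)) /\ s aNextC (iter k f i) < m.
  move=> lt_k; have lt1 := lt_it _ (ltnW lt_k); have lt2 := lt_it _ lt_k.
  have [a [c [a' [fo Ea Ea' Ec]]]] := @nextrep_inv s x (iter k f i) nx lt2 lt1.
  rewrite [iter k.+1 f i]iterS [f _]Ea' Ec num_lt Ea.
  have edn b : ed (num b) = b by apply: (@num_inj (edge M)); rewrite num_ed ?num_lt.
  by rewrite !edn.
have [utr ctr] := cycle_of_period len_gt0 per min.
exists L; split; last first.
- move=> k p; rewrite onth_map Est; case E: (onth _ k) => [j|] //= [<-].
  have lt_k : k < len by rewrite -(size_traject f i len) -onthTE E.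
  have Ej : j = iter k f i by rewrite -(nth_traject f lt_k i) (onth_nth i _ _ _ E).
  rewrite -/f /pair /= -Ej; have [_ lt_c] := fo _ lt_k; rewrite -Ej in lt_c.
  by rewrite !num_ed // Ej lt_it // ltnW.
- by rewrite size_map size_traject.
apply/andP; split; last first.
  rewrite /plus_edges -map_comp map_inj_in_uniq // => j j' /trajectP[k lt_k ->].
  move=> /trajectP[k' lt_k' ->] /= E; have := congr1 (@num _) E.
  by rewrite !num_ed // lt_it // ltnW.
apply/and3P; split.
- by rewrite -size_eq0 size_map size_traject -lt0n.
- apply/allP => p /mapP[j /trajectP[k lt_k ->] ->] /=.
  by have [/and3P[]] := fo _ lt_k.
rewrite /L cycle_map; apply: (sub_in_cycle (P := mem (traject f i len))) ctr.
  move=> j j' /trajectP[k lt_k ->] _ /eqP <-; rewrite /= -iterS.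
  by have [/and3P[_ _ /eqP->] _] := fo _ lt_k.
by apply/allP.
Qed.

Lemma pCycle_spec s x : inp s -> nextrep s x ->
  runs pCycle s (fun s' => nextrep s' x /\
    ((s' vLen 0 = 0 /\ forall L, ~ rotation x L) \/
     (0 < s' vLen 0 <= m /\ exists L, traces s' x L))).
Proof.
move=> si nx; have [loopN loopb] := loop_edge le_N big_bnd; set f := s aNext.
pose found s' := [/\ 0 < s' vLen 0 <= m, s' vStart 0 < m,
  iter (s' vLen 0) f (s' vStart 0) = s' vStart 0 &
  forall k, 0 < k < s' vLen 0 -> iter k f (s' vStart 0) != s' vStart 0].
pose none i := forall j k, j < i -> 0 < k <= m -> iter k f j != j.
apply: runs_seq; apply: runs_put => // s1 [u1 u1l _].
have s1i : inp s1 by move=> b lt_b; rewrite u1 ?si //; case: eqP lt_b => // ->.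
apply: (runs_for (n := m) (I := fun i s' =>
  (s' vLen 0 = 0 /\ none i) \/ found s')) => //.
- by move=> s' fr; rewrite /= fr // inp_m.
- move=> i s2 s3 h u; rewrite /found !u //.
- by left.
- move=> i s2 lt_i fr2 Ei Is; apply: runs_seq; apply: runs_put => // s3 [u3 u3c _].
  rewrite /= Ei in u3c.
  have s3i : inp s3.
    by move=> b lt_b; rewrite u3 ?(inp_frame fr2 s1i isT) //; case: eqP lt_b => // ->.
  have s3f : s3 aNext = f by rewrite u3 // fr2 // u1.
  apply: (runs_for (n := m) (I := fun j s' => s' vCur 0 = iter j f i /\
    ((s' vLen 0 = 0 /\ none i /\ forall k, 0 < k <= j -> iter k f i != i) \/ found s'))) => //.
  + by move=> s' fr; rewrite /= fr // inp_m.
  + by move=> j s4 s5 h u; rewrite /found !u.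
  + split=> //; case: Is => [[l0 no]|fo]; [left|right].
      by rewrite u3 //; split=> //; split=> // k; case: k.
    by rewrite /found !u3.
  + move=> j s4 lt_j fr4 Ej [cur4 I4]; apply: runs_seq; apply: runs_put => // s5 [u5 u5c _].
    have s5c : s5 vCur 0 = iter j.+1 f i by rewrite u5c /= cur4 fr4 // s3f.
    have s5A : s5 vA 0 = i by rewrite u5 // fr4 // u3 // Ei.
    have s5I : s5 vI 0 = j by rewrite u5.
    apply: runs_if => [|c5|c5].
    * by rewrite /= !bndb.
    * rewrite !evalE /= s5c s5A in c5; case/andP: c5 => /eqP l0 /eqP per.
      rewrite u5 // in l0.
      apply: runs_seq; apply: runs_put => //=.
        by rewrite s5I addn1 (bnd_edge le_N big_bnd) // ltnS ltnW.
      rewrite s5I addn1 => s6 [u6 u6l _]; apply: runs_put => // s7 [u7 u7s _].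
      rewrite /= u6 // s5A in u7s; split; first by rewrite u7 // u6.
      case: I4 => [[_ [no no4]]|[]]; last by rewrite l0.
      right; rewrite /found u7s u7 // u6l; split=> //.
    rewrite !evalE /= s5c s5A in c5.
    apply: runs_skip; split=> //; case: I4 => [[l0 [no no4]]|fo]; last first.
      by right; rewrite /found !u5.
    left; rewrite u5 //; split=> //; split=> // k /andP[k0]; rewrite leq_eqVlt.
    case/orP=> [/eqP->|lt_k]; last by apply: no4; rewrite k0 -ltnS.
    by move: c5; rewrite u5 // l0 eqxx.
  move=> s4 fr4 [_ [[l0 [no no4]]|fo]]; [left|by right].
  split=> // j k; rewrite ltnS leq_eqVlt => /orP[/eqP->|lt_j] hk; last exact: no.
  exact: no4.
move=> s2 fr2 Is; have s2f : s2 aNext = f by rewrite fr2 // u1.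
have nx2 : nextrep s2 x.
  have s2c : s2 aNextC = s aNextC by rewrite fr2 // u1.
  by rewrite /nextrep s2f s2c.
split=> //; case: Is => [[l0 no]|[hl lt_s per min]]; [left|right].
  split=> // L rL.
  have [p pL] : exists p, p \in L.
    by case/andP: rL => /and3P[]; case: (L) => // p ? _ _ _ _; exists p; apply: mem_head.
  have pP : p.1 \in plus_edges L by apply: map_f.
  have := no (num p.1) (size L) (num_lt _); rewrite (rotation_period nx rL pP) eqxx.
  have -> : size L <= m.
    case/andP: rL => _ uP; rewrite -(size_map fst) -(card_uniqP uP); exact: max_card.
  by rewrite lt0n size_eq0; case: (L) pL => // q L' _ /(_ isT).
split=> //; apply: (period_rotation nx2 lt_s _ _ _ erefl erefl).
- by case/andP: hl.
- by rewrite s2f.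
- by move=> k hk; rewrite s2f; apply: min.
Qed.

Lemma pRecord_spec s x L n : inp s -> traces s x L -> s vLen 0 <= m ->
    s vRow 0 = n -> n <= m * m ->
  runs pRecord s (fun s' => [/\ stored_rotation s' n L,
    forall k K, k < n -> size K <= m -> stored_rotation s k K ->
      stored_rotation s' k K &
    forall k, k != n -> s' 8 k = s 8 k]).
Proof.
move=> si [rL sz tr] le_len sn le_n; have [loopN loopb] := loop_edge le_N big_bnd.
apply: runs_seq; apply: runs_put => // s1 [u1 u1c _]; rewrite /= in u1c.
have s1i : inp s1 by move=> b lt_b; rewrite u1 ?si //; case: eqP lt_b => // ->.
apply: runs_seq; apply: (runs_for (n := s vLen 0) (I := fun i s' => [/\
  s' vCur 0 = iter i (s aNext) (s vStart 0),
  (forall j p, j < i -> onth L j = Some p ->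
     s' 10 (n * m + j) = num p.1 /\ s' 11 (n * m + j) = num p.2) &
  (forall j, j < n * m -> s' 10 j = s 10 j /\ s' 11 j = s 11 j)])) => //.
- exact: leq_trans le_len loopN.
- exact: leq_ltn_trans le_len loopb.
- by move=> s' fr; rewrite /= fr // u1.
- by move=> i s2 s3 [h1 h2 h3] u; split=> *; rewrite !u //; [apply: h2|apply: h3].
- by split=> // j _; rewrite !u1.
- move=> i s2 lt_i fr2 Ei [h1 h2 h3].
  have lt_im := leq_trans lt_i le_len.
  have [b1 b2] := bnd_idx le_N big_bnd (leqnn n.+1) lt_im (le_n : n < (m * m).+1).
  have s2i : inp s2 := inp_frame fr2 s1i isT.
  have s2R : s2 vRow 0 = n by rewrite fr2 // u1.
  have ok_cell s' : s' vRow 0 = n -> s' vI 0 = i -> inp s' ->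
      fits bnd s' (eCell (V vRow) (V vI) nE) /\ eval s' (eCell (V vRow) (V vI) nE) = n * m + i.
    by move=> /= -> -> s'i; rewrite inp_m // b1 b2.
  have [f2 e2] := ok_cell s2 s2R Ei s2i.
  apply: runs_seq; apply: runs_put => // s3 [u3 u3c u3o]; rewrite e2 in u3c u3o.
  have s3i : inp s3 by move=> b lt_b; rewrite u3 ?s2i //; case: eqP lt_b => // ->.
  have [f3 e3] : fits bnd s3 (eCell (V vRow) (V vI) nE) /\
      eval s3 (eCell (V vRow) (V vI) nE) = n * m + i.
    by apply: ok_cell => //; rewrite u3.
  apply: runs_seq; apply: runs_put => // s4 [u4 u4c u4o]; rewrite e3 in u4c u4o.
  apply: runs_put => // s5 [u5 u5c _].
  rewrite /= !u4 // !u3 // h1 in u5c; rewrite /= !u3 // h1 in u4c; rewrite /= h1 in u3c.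
  have next2 : s2 aNext = s aNext by rewrite fr2 // u1.
  have nextC2 : s2 aNextC = s aNextC by rewrite fr2 // u1.
  split.
  + by rewrite u5c next2.
  + move=> j p; rewrite ltnS leq_eqVlt => /orP[/eqP->|lt_j] Ep.
      have [t1 t2] := tr _ _ Ep; rewrite !u5 // u4c u4 // u3c nextC2.
      by rewrite t1 -t2 t1.
    have nj : n * m + j != n * m + i by rewrite eqn_add2l neq_ltn lt_j.
    by rewrite !u5 // u4o // u4 // u3o // u3 //; apply: h2.
  + move=> j lt_j; have nj : j != n * m + i by rewrite neq_ltn (leq_trans lt_j) ?leq_addr.
    by rewrite !u5 // u4o // u4 // u3o // u3 //; apply: h3.
move=> s2 fr2 [_ h2 h3]; have s2R : s2 vRow 0 = n by rewrite fr2 // u1.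
apply: runs_put => // s3 [u3 u3c u3o]; rewrite /= s2R in u3c u3o.
have s2l : s2 vLen 0 = s vLen 0 by rewrite fr2 // u1.
split.
- split; first by rewrite u3c s2l sz.
  move=> i p Ep; rewrite !u3 //; apply: h2 => //.
  by rewrite -sz -onthTE Ep.
- move=> k K lt_k le_K [E8 cells]; split.
    by rewrite u3o ?neq_ltn ?lt_k // fr2 // u1.
  move=> i p Ep; rewrite !u3 //.
  have lt_i : i < m by apply: leq_trans le_K; rewrite -onthTE Ep.
  have [|-> ->] := h3 (k * m + i); last exact: cells.
  exact: idx_lt.
- by move=> k nk; rewrite u3o // fr2 // u1.
Qed.

End Spec.

(** * Computing a full route *)

Definition rowA := Get 10 (eCell (V vRow) (V vJ) nE).
Definition rowC := Get 11 (eCell (V vRow) (V vJ) nE).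

Definition pFeasible :=
  PSeq (PPut vOk z0 z1)
  (PFor vJ (Get 8 (V vRow))
     (PSeq (PPut vA z0 rowA)
     (PSeq (PPut vC z0 rowC)
     (PIf (Op Lt (Get aX (V vC)) (V vT)) (PPut vOk z0 z0)
     (PIf (Op Lt (Op Defs.Sub (Get 3 (V vA)) (Get aX (V vA))) (V vT)) (PPut vOk z0 z0)
     (PSeq pExchange (PIf (V vFlag) PSkip (PPut vOk z0 z0)))))))).

Definition pBisect :=
  PSeq (PPut vT z0 (Op Div (Op Add (V vLo) (V vHi)) (Const 2)))
  (PSeq pFeasible
  (PIf (V vOk) (PPut vLo z0 (V vT)) (PPut vHi z0 (V vT)))).

(** Bisection between 1, which is feasible for a rotation, and one more than the
    capacity of an edge of [L^+], which is not.  Feasibility is inherited by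
    smaller weights ([feasible_downward]). *)
Definition pWeight :=
  PSeq (PPut vLo z0 z1)
  (PSeq (PPut vHi z0 (Op Add (Get 3 (V vStart)) z1))
  (PSeq (PWhile (Op Lt (Op Add (V vLo) z1) (V vHi)) pBisect)
  (PPut 9 (V vRow) (V vLo)))).

Definition pApply :=
  PFor vJ (Get 8 (V vRow))
    (PSeq (incr aX rowA (Get 9 (V vRow))) (decr aX rowC (Get 9 (V vRow)))).

Definition pReset := PFor vE nE (PPut aX (V vE) (Get 6 (V vE))).

Definition pStep :=
  PSeq pTandems
  (PSeq pNext
  (PSeq pCycle
  (PIf (V vLen)
     (PSeq (PPut vRow z0 (V vN))
     (PSeq pRecord
     (PSeq pWeight
     (PSeq pApply
     (PPut vN z0 (Op Add (V vN) z1))))))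
     PSkip))).

(** By [route_bound] one of the [m * m + 1] rounds finds no rotation; from then on
    nothing changes. *)
Definition pRoute :=
  PSeq (PPut vM1 z0 (Op Add nE z1))
  (PSeq (PPut vM2 z0 (Op Add (Op Mul nE nE) z1))
  (PSeq (PPut vN z0 z0)
  (PSeq pReset
  (PFor vIt (V vM2) pStep)))).

Section Spec.

Variables (M : market) (ax : market_axioms M) (gl : gapless M) (xmin : vec M).
Variables (bnd N g B : nat).
Notation m := #|edge M|.
Hypothesis le_N : m * m + m + 2 <= N.
Hypothesis big_bnd : m.+2 ^ 5 * (2 * B + 4) <= bnd.
Hypothesis cap_B : forall e : edge M, cap e <= B.
Hypothesis B_log : B <= 2 ^ g.
Hypothesis xmin_min : is_min_stable xmin.

Implicit Types (e d a c : edge M) (x y z : vec M) (w : worker M).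
Implicit Types (s : state) (L K : dcycle M) (rs : seq (dcycle M * nat)).

Notation runs := (runs (market_oracle M) bnd N g).
Notation inp := (inp xmin).

Let bndb := bnd_bool le_N big_bnd.
Let inp_m := @inp_m M xmin.
Let inp_cap := @inp_cap M xmin.
Let inp_frame := @inp_frame M xmin.

Lemma take_onth (T : Type) (r : seq T) i p : onth r i = Some p ->
  take i.+1 r = rcons (take i r) p.
Proof.
move=> E; have lt_i : i < size r by rewrite -onthTE E.
by rewrite (take_nth p lt_i) (onth_nth p _ _ _ E).
Qed.

Lemma onth_lt (T : Type) (r : seq T) i : i < size r -> exists p, onth r i = Some p.
Proof. by rewrite -onthTE; case: (onth r i) => // p; exists p. Qed.

Lemma row_cell s n j : inp s -> s vRow 0 = n -> s vJ 0 = j -> n <= m * m -> j < m ->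
  fits bnd s (eCell (V vRow) (V vJ) nE) /\ eval s (eCell (V vRow) (V vJ) nE) = n * m + j.
Proof.
move=> si En Ej le_n lt_j.
have [b1 b2] := bnd_idx le_N big_bnd (leqnn n.+1) lt_j (le_n : n < (m * m).+1).
by rewrite /= En Ej inp_m // b1 b2.
Qed.

Section Row.

Variables (n : nat) (L : dcycle M).
Hypotheses (le_n : n <= m * m) (le_L : size L <= m).

Lemma row_pair s j p : inp s -> s vRow 0 = n -> s vJ 0 = j -> stored_rotation s n L ->
    onth L j = Some p ->
  [/\ fits bnd s rowA, fits bnd s rowC, eval s rowA = num p.1 & eval s rowC = num p.2].
Proof.
move=> si En Ej [_ cells] Ep; have lt_j : j < m.
  by apply: leq_trans le_L; rewrite -onthTE Ep.
have [f1 e1] := row_cell si En Ej le_n lt_j.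
have [c1 c2] := cells _ _ Ep.
by split=> //; rewrite /rowA /rowC /eval -/eval e1.
Qed.

Lemma stored_frame W s s' : frame W s s' -> 8 \notin W -> 10 \notin W -> 11 \notin W ->
  stored_rotation s n L -> stored_rotation s' n L.
Proof.
by move=> fr n1 n2 n3 [E cells]; split=> [|i p Ep]; rewrite !fr //; apply: cells.
Qed.

Lemma feasible_all x t : 0 < t -> feasible x L t =
  all (fun p => [&& t <= x p.2, t <= cap p.1 - x p.1 &
    let z := vadd (xf (fend p.1) x) p.1 t in
    vadd (fchoice (fend p.1) z) p.2 t == z]) L.
Proof.
by move=> t0; rewrite /feasible t0 /= !all_predI !all_map.
Qed.

Lemma pFeasible_spec s x t : inp s -> rep s aX x -> g_alloc x ->
    stored_rotation s n L -> s vRow 0 = n -> s vT 0 = t -> 0 < t ->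
    (forall p, p \in L -> fend p.2 = fend p.1) ->
  runs pFeasible s (fun s' => rep s' aX x /\ s' vOk 0 = feasible x L t).
Proof.
move=> si sx gx sL sn st t0 fe; have [loopN loopb] := loop_edge le_N big_bnd.
rewrite feasible_all //; set G := fun p : edge M * edge M => _.
apply: runs_seq; apply: runs_put => // s1 [u1 u1o _].
have fr1 : frame [:: vOk] s s1 by move=> b; rewrite inE; apply: u1.
have s1i : inp s1 := inp_frame fr1 si isT.
have sz : s1 8 n = size L by rewrite fr1 //; case: sL.
apply: (runs_for (n := size L) (I := fun i s' => rep s' aX x /\
  s' vOk 0 = all G (take i L))) => //.
- exact: leq_trans le_L loopN.
- exact: leq_ltn_trans le_L loopb.
- by move=> s' fr; rewrite /= !fr // (u1 vRow) // sn sz.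
- by move=> i s2 s3 [h1 h2] u; split=> [d|]; rewrite u.
- by rewrite take0 u1o; split=> // d; rewrite u1.
- move=> i s2 lt_i fr2 Ei [s2x s2o]; have [p Ep] := onth_lt lt_i.
  have s2i : inp s2 := inp_frame fr2 s1i isT.
  have pL : p \in L by apply/onthP; exists i.
  rewrite (take_onth Ep) all_rcons.
  have s2L : stored_rotation s2 n L.
    by apply: stored_frame fr2 _ _ _ _ => //; apply: stored_frame fr1 _ _ _ _.
  have s2R : s2 vRow 0 = n by rewrite fr2 // u1.
  have [f1 f2 e1 e2] := row_pair s2i s2R Ei s2L Ep.
  apply: runs_seq; apply: runs_put => // s3 [u3 u3a _]; rewrite [eval s2 z0]/= e1 in u3a.
  have fr3 : frame [:: vA] s2 s3 by move=> b; rewrite inE; apply: u3.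
  have s3i : inp s3 := inp_frame fr3 s2i isT.
  have s3L : stored_rotation s3 n L by apply: stored_frame fr3 _ _ _ _.
  have [_ f3 _ e3] : [/\ fits bnd s3 rowA, fits bnd s3 rowC,
      eval s3 rowA = num p.1 & eval s3 rowC = num p.2].
    by apply: (row_pair (j := i)); rewrite ?u3.
  apply: runs_seq; apply: runs_put => // s4 [u4 u4c _]; rewrite [eval s3 z0]/= e3 in u4c.
  have fr4 : frame [:: vA; vC] s2 s4.
    by move=> b; rewrite !inE negb_or => /andP[nA nC]; rewrite u4 // u3.
  have s4i : inp s4 := inp_frame fr4 s2i isT.
  have s4x : rep s4 aX x by move=> d; rewrite fr4.
  have s4o : s4 vOk 0 = all G (take i L) by rewrite fr4.
  have s4A : s4 vA 0 = num p.1 by rewrite u4 // u3a.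
  have s4t : s4 vT 0 = t by rewrite fr4 // fr2 // u1.
  have failed s5 : rep s5 aX x -> G p = false -> runs (PPut vOk z0 z0) s5
      (fun s' => rep s' aX x /\ s' vOk 0 = G p && all G (take i L)).
    move=> s5x ->; apply: runs_put => // s6 [u6 u6o _]; split=> // d.
    by rewrite u6.
  apply: runs_if => [|c5|c5].
  + by rewrite /= bndb.
  + rewrite evalLt /= u4c s4x s4t in c5; apply: failed => //.
    by rewrite /G leqNgt c5.
  rewrite evalLt /= u4c s4x s4t -leqNgt in c5.
  apply: runs_if => [|c6|c6].
  + rewrite /= s4A inp_cap // s4x bndb (bnd_le le_N big_bnd) //.
    by rewrite (leq_trans (leq_subr _ _)).
  + rewrite evalLt /= s4A inp_cap // s4x s4t in c6; apply: failed => //.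
    by rewrite /G c5 leqNgt c6.
  rewrite evalLt /= s4A inp_cap // s4x s4t -leqNgt in c6.
  apply: runs_seq.
  apply: runs_conseq (pExchange_spec ax g le_N big_bnd cap_B (x := x) (a := p.1) (c := p.2) (t := t) s4i _ _ _ _ _ _ _) _ => //.
  + by rewrite -leq_subRL ?galloc_cap.
  + exact: fe.
  move=> s5 fr5 [s5x s5f].
  have s5o : s5 vOk 0 = all G (take i L) by rewrite fr5.
  apply: runs_if => // [c7|c7].
    rewrite /= s5f eqb0 negbK in c7; apply: runs_skip; split=> //.
    by rewrite s5o /G c5 c6 c7.
  rewrite /= s5f eqb0 negbK in c7; apply: failed => //.
  by rewrite /G c5 c6 (negbTE c7).
- by move=> s2 fr2 [s2x ->]; rewrite take_size.
Qed.

Lemma pWeight_spec s x a : inp s -> rep s aX x -> stable x -> rotation x L ->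
    stored_rotation s n L -> s vRow 0 = n -> s vStart 0 = num a -> a \in plus_edges L ->
  runs pWeight s (fun s' => [/\ rep s' aX x, max_feasible x L (s' 9 n) &
    forall k, k != n -> s' 9 k = s 9 k]).
Proof.
move=> si sx stx rL sL sn sa aL; have gx := stable_g stx.
have fe p : p \in L -> fend p.2 = fend p.1.
  by have [_ _ _] := rotation_pairing ax gx rL; apply.
have nhi : ~~ feasible x L (cap a).+1.
  apply/negP => /and4P[_ _ /allP/(_ a aL) le_a _].
  by have := leq_trans le_a (leq_subr _ _); rewrite ltnn.
apply: runs_seq; apply: runs_put => // s1 [u1 u1l _].
have fr1 : frame [:: vLo] s s1 by move=> b; rewrite inE; apply: u1.
have s1i : inp s1 := inp_frame fr1 si isT.
have s1a : eval s1 (Op Add (Get 3 (V vStart)) z1) = (cap a).+1.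
  by rewrite /= (u1 vStart) // sa inp_cap // addn1.
have bhi h : h <= B.+1 -> h < bnd.
  by move=> le_h; apply: (bnd_cap le_N big_bnd); move: le_h; clear; lia.
have le_capB : (cap a).+1 <= B.+1 by rewrite ltnS.
apply: runs_seq; apply: runs_put => // [|s2 [u2 u2h _]].
  by rewrite /= -[X in X < _]/(eval s1 (Op Add (Get 3 (V vStart)) z1)) s1a bhi.
rewrite s1a in u2h.
have fr2 : frame [:: vLo; vHi] s s2.
  by move=> b; rewrite !inE negb_or => /andP[nl nh]; rewrite u2 // u1.
have s2l : s2 vLo 0 = 1 by rewrite u2.
pose I k s' := [/\ frame (vLo :: vHi :: writes pBisect) s s', rep s' aX x,
  feasible x L (s' vLo 0) && ~~ feasible x L (s' vHi 0),
  s' vLo 0 < s' vHi 0 <= B.+1 & s' vHi 0 <= s' vLo 0 + 2 ^ k].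
apply: runs_seq; apply: (runs_while (n := g) (I := I)) => //.
- move=> k s' [_ _ _ /andP[lt_h le_h] _]; rewrite /= bndb andbT bhi // addn1.
  by apply: leq_trans le_h.
- by move=> s' [_ _ _ /andP[lt_h _]]; rewrite expn0 /= => le_h; rewrite ltnNge le_h.
- move=> k s3 [fr3 s3x /andP[f3 nf3] /andP[lt_h le_h] le_2] c3.
  rewrite evalLt /= addn1 in c3.
  have s3i : inp s3 := inp_frame fr3 si isT.
  set lo := s3 vLo 0 in f3 lt_h c3 le_2; set hi := s3 vHi 0 in nf3 lt_h c3 le_h le_2.
  pose mid := (lo + hi) %/ 2.
  have [lt_lo lt_hi] : lo < mid /\ mid < hi.
    by move: c3; rewrite /mid; clear; lia.
  have mid1 : mid <= lo + 2 ^ k /\ hi <= mid + 2 ^ k.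
    move: le_2; rewrite expnS /mid; move: (2 ^ k) => q; clear; lia.
  apply: runs_seq; apply: runs_put => //=.
    rewrite -/lo -/hi (bnd_cap le_N big_bnd) /= ?bhi //.
      apply: leq_trans (ltnW lt_hi) le_h.
    by move: lt_h le_h; clear; lia.
  rewrite -/lo -/hi -/mid => s4 [u4 u4t _].
  have fr4 : frame [:: vT] s3 s4 by move=> b; rewrite inE; apply: u4.
  have fr4' : frame (vLo :: vHi :: writes pBisect) s s4.
    by move=> b nb; rewrite u4 ?fr3 //; apply: contraNneq nb => ->.
  have s4i : inp s4 := inp_frame fr4 s3i isT.
  have s4L : stored_rotation s4 n L by apply: stored_frame fr4' _ _ _ _.
  apply: runs_seq.
  apply: runs_conseq (pFeasible_spec (x := x) (t := mid) s4i _ gx s4L _ _ _ fe) _ => //.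
  + by move=> d; rewrite u4.
  + by rewrite fr4' // sn.
  + exact: leq_ltn_trans lt_lo.
  move=> s5 fr5 [s5x s5o].
  have fr5' : frame (vLo :: vHi :: writes pBisect) s s5.
    have /allP sub : all [in vLo :: vHi :: writes pBisect] (writes pFeasible) by [].
    by move=> b nb; rewrite fr5 ?fr4' //; apply: contra nb => /sub.
  have s5t : s5 vT 0 = mid by rewrite fr5.
  have s5l : s5 vLo 0 = lo by rewrite fr5 // u4.
  have s5h : s5 vHi 0 = hi by rewrite fr5 // u4.
  apply: runs_if => // [c6|c6]; rewrite /= s5o eqb0 negbK in c6;
    apply: runs_put => // s6 [u6 u6v _]; rewrite /= s5t in u6v.
  + split.
    * by move=> b nb; rewrite u6 ?fr5' //; apply: contraNneq nb => ->.
    * by move=> d; rewrite u6.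
    * by rewrite u6v u6 // s5h c6.
    * by rewrite u6v u6 // s5h lt_hi.
    * by rewrite u6v u6 // s5h; case: mid1.
  + split.
    * by move=> b nb; rewrite u6 ?fr5' //; apply: contraNneq nb => ->.
    * by move=> d; rewrite u6.
    * by rewrite u6v u6 // s5l f3.
    * by rewrite u6v u6 // s5l lt_lo (leq_trans (ltnW lt_hi)).
    * by rewrite u6v u6 // s5l; case: mid1.
- split.
  + by move=> b; rewrite !inE !negb_or => /and3P[n1 n2 _]; rewrite fr2 // !inE negb_or n1.
  + by move=> d; rewrite fr2.
  + by rewrite s2l u2h (rotation_feasible1 ax rL) nhi.
  + have := feasible_cap (rotation_feasible1 ax rL) gx aL.
    rewrite s2l u2h ltnS le_capB andbT; clear; lia.
  + by rewrite s2l u2h add1n ltnS (leq_trans (cap_B a)).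
move=> k s3 [fr3 s3x /andP[f3 nf3] /andP[lt_h le_h] _] c3.
have s3n : s3 vRow 0 = n by rewrite fr3.
apply: runs_put => // s4 [u4 u4w u4o]; rewrite /= s3n in u4w u4o; split.
- by move=> d; rewrite u4.
- rewrite u4w; split=> // t' ft'; rewrite leqNgt; apply/negP => lt_t.
  have Eh : s3 vHi 0 = (s3 vLo 0).+1.
    by apply/eqP; rewrite eqn_leq lt_h andbT; move: c3; rewrite /=; case: ltnP; rewrite addn1.
  case/negP: nf3; rewrite Eh.
  by apply: (feasible_downward ax gx rL ft').
- by move=> k' nk; rewrite u4o // fr3.
Qed.

Lemma pApply_spec s x t : inp s -> rep s aX x -> g_alloc x ->
    stored_rotation s n L -> s vRow 0 = n -> s 9 n = t -> feasible x L t -> pairing L ->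
  runs pApply s (fun s' => rep s' aX (shift x L t)).
Proof.
move=> si sx gx sL sn st ft pL; have [loopN loopb] := loop_edge le_N big_bnd.
have [up um dis _] := pL.
have sz : s 8 n = size L by case: sL.
apply: (runs_for (n := size L) (I := fun i s' => rep s' aX (shift x (take i L) t))) => //.
- exact: leq_trans le_L loopN.
- exact: leq_ltn_trans le_L loopb.
- by move=> s' fr; rewrite /= !fr // sn sz.
- by move=> i s2 s3 h u d; rewrite u.
- by move=> d; rewrite take0 sx ffunE !muln0 addn0 subn0.
- move=> i s1 lt_i fr1 Ei s1x; have [p Ep] := onth_lt lt_i.
  have s1i : inp s1 := inp_frame fr1 si isT.
  have s1L : stored_rotation s1 n L by apply: stored_frame fr1 _ _ _ _.
  have s1R : s1 vRow 0 = n by rewrite fr1.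
  have s1t : s1 9 n = t by rewrite fr1.
  have [f1 f2 e1 e2] := row_pair s1i s1R Ei s1L Ep.
  have pin : p \in L by apply/onthP; exists i.
  have p1L : p.1 \in plus_edges L by apply: map_f.
  have p2L : p.2 \in minus_edges L by apply: map_f.
  have Etake := take_onth Ep.
  have subP e : e \in plus_edges (take i L) -> e \in plus_edges L.
    by case/mapP=> q /mem_take qL ->; apply: map_f.
  have subM e : e \in minus_edges (take i L) -> e \in minus_edges L.
    by case/mapP=> q /mem_take qL ->; apply: map_f.
  have [p1n p2n] : p.1 \notin plus_edges (take i L) /\ p.2 \notin minus_edges (take i L).
    have := cat_take_drop i.+1 L; rewrite Etake => EL; have [up' um'] := (up, um).
    rewrite -EL /plus_edges map_cat map_rcons cat_uniq rcons_uniq in up'.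
    rewrite -EL /minus_edges map_cat map_rcons cat_uniq rcons_uniq in um'.
    by case/and3P: up' => /andP[? _] _ _; case/and3P: um' => /andP[? _] _ _.
  have x1 : shift x (take i L) t p.1 = x p.1.
    apply: shift_other => //; apply: contra (dis _ p1L); exact: subM.
  have x2 : shift x (take i L) t p.2 = x p.2.
    by apply: shift_other => //; apply: contraL p2L => /subP; apply: dis.
  have nca : p.2 != p.1 by apply: contraTneq p2L => ->; apply: dis.
  have le1 : x p.1 + t <= B by apply: leq_trans (feasible_cap ft gx p1L) (cap_B _).
  have le2 : x p.2 <= B by apply: leq_trans (galloc_cap gx _) (cap_B _).
  have bB := bnd_le le_N big_bnd.
  have e1' : eval s1 (Op Add (Get aX rowA) (Get 9 (V vRow))) = x p.1 + t.
    rewrite -[LHS]/(s1 aX (eval s1 rowA) + s1 9 (s1 vRow 0)).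
    by rewrite e1 s1x x1 s1R s1t.
  apply: runs_seq; apply: runs_put => //.
    apply/and3P; split=> //.
    by rewrite e1' bB.
  rewrite e1 e1' => s2 [u2 u2a u2o].
  have fr2 : frame [:: aX] s1 s2 by move=> b; rewrite inE; apply: u2.
  have s2i : inp s2 := inp_frame fr2 s1i isT.
  have s2L : stored_rotation s2 n L by apply: stored_frame fr2 _ _ _ _.
  have [_ f4 _ e4] : [/\ fits bnd s2 rowA, fits bnd s2 rowC,
      eval s2 rowA = num p.1 & eval s2 rowC = num p.2].
    by apply: (row_pair (j := i)); rewrite ?u2.
  have s2x2 : s2 aX (num p.2) = x p.2 by rewrite u2o ?num_eq // s1x x2.
  have e4' : eval s2 (Op Defs.Sub (Get aX rowC) (Get 9 (V vRow))) = x p.2 - t.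
    rewrite -[LHS]/(s2 aX (eval s2 rowC) - s2 9 (s2 vRow 0)) e4 s2x2.
    by rewrite (u2 vRow isT) (u2 9 isT) s1R s1t.
  apply: runs_put => //.
    apply/and3P; split=> //.
    by rewrite e4' bB // (leq_trans (leq_subr _ _)).
  rewrite e4 e4' => s3 [u3 u3c u3o] e.
  rewrite Etake [RHS]ffunE /plus_edges /minus_edges !map_rcons !mem_rcons !inE.
  have [->|ne2] := eqVneq e p.2.
    have /negbTE nP : p.2 \notin [seq q.1 | q <- take i L].
      by apply: contraL p2L => /subP; apply: dis.
    by rewrite u3c (negbTE nca) /= nP muln0 muln1 addn0.
  rewrite u3o ?num_eq //; have [->|ne1] := eqVneq e p.1.
    have /negbTE nM : p.1 \notin [seq q.2 | q <- take i L].
      by apply: contra (dis _ p1L); apply: subM.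
    by rewrite u2a /= nM muln1 muln0 subn0.
  by rewrite u2o ?num_eq // s1x ffunE.
- by move=> s1 _; rewrite take_size.
Qed.

End Row.

Lemma pReset_spec s : inp s -> runs pReset s (fun s' => rep s' aX xmin).
Proof.
move=> si; have [loopN loopb] := loop_edge le_N big_bnd.
apply: (runs_for (n := m) (I := fun i s' =>
  forall e, num e < i -> s' aX (num e) = xmin e)) => //.
- by move=> s' fr; rewrite /= fr // inp_m.
- by move=> i s1 s2 h u e; rewrite u //; apply: h.
- move=> i s1 lt_i fr Ei Is; apply: runs_put => // s2 [_ u2e u2o] e.
  rewrite /= Ei in u2e u2o; rewrite ltnS leq_eqVlt => /orP[/eqP Ee|lt_e].
    by rewrite Ee u2e -Ee (inp_xmin (inp_frame fr si isT)).
  by rewrite u2o ?Is // neq_ltn lt_e.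
- by move=> s1 _ h e; apply: h; apply: num_lt.
Qed.

(** The bound on the size keeps the rows, which have [m] cells, apart. *)
Definition listed s rs := forall k L t, onth rs k = Some (L, t) ->
  [/\ stored_rotation s k L, s 9 k = t & size L <= m].

Lemma listed_frame W s s' rs : frame W s s' -> 8 \notin W -> 9 \notin W ->
  10 \notin W -> 11 \notin W -> listed s rs -> listed s' rs.
Proof.
move=> fr n8 n9 n10 n11 li k L t Ek; have [st w sz] := li _ _ _ Ek.
by split=> //; [apply: stored_frame fr _ _ _ st | rewrite fr].
Qed.

Lemma rotation_size x L : rotation x L -> size L <= m.
Proof.
by case/andP=> _ uP; rewrite -(size_map fst) -(card_uniqP uP) max_card.
Qed.

Definition on_route s rs x := [/\ route xmin rs x, rep s aX x, s vN 0 = size rs &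
  listed s rs].

Lemma pStep_spec s rs x : inp s -> s vM1 0 = m.+1 -> on_route s rs x ->
  runs pStep s (fun s' => (on_route s' rs x /\ forall L, ~ rotation x L) \/
    (exists L, rotation x L) /\
    exists rs' x', on_route s' rs' x' /\ size rs' = (size rs).+1).
Proof.
move=> si sM [r sx sN li]; have stx := route_end r; have gx := stable_g stx.
have [loopN loopb] := loop_edge le_N big_bnd.
have le_rs := route_bound ax gl r.
apply: runs_seq; apply: runs_conseq (pTandems_spec ax g le_N big_bnd cap_B si sx gx) _.
move=> s1 fr1 [s1x s1a s1t]; have s1i := inp_frame fr1 si isT.
apply: runs_seq; apply: runs_conseq (pNext_spec g le_N big_bnd s1i _ s1a s1t) _.
  by rewrite fr1.
move=> s2 fr2 nx; have s2i := inp_frame fr2 s1i isT.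
apply: runs_seq; apply: runs_conseq (pCycle_spec ax g le_N big_bnd s2i nx) _.
move=> s3 fr3 [nx3 found]; have s3i := inp_frame fr3 s2i isT.
have s3x : rep s3 aX x by move=> d; rewrite fr3 // fr2 // s1x.
have s3N : s3 vN 0 = size rs by rewrite fr3 // fr2 // fr1.
have li3 : listed s3 rs.
  apply: listed_frame fr3 _ _ _ _ _ => //; apply: listed_frame fr2 _ _ _ _ _ => //.
  exact: listed_frame fr1 _ _ _ _ _.
apply: runs_if => // [c4|c4]; rewrite /= in c4; last first.
  apply: runs_skip; left; rewrite negbK in c4.
  case: found => [[_ no]|[/andP[]]]; last by rewrite (eqP c4).
  by split.
case: found => [[E]|[/andP[_ le_len] [L tr]]]; first by rewrite E in c4.
apply: runs_seq; apply: runs_put => // s4 [u4 u4r _]; rewrite /= s3N in u4r.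
have fr4 : frame [:: vRow] s3 s4 by move=> b; rewrite inE; apply: u4.
have s4i := inp_frame fr4 s3i isT.
have tr4 : traces s4 x L.
  by case: tr => rL sz cells; split=> [//||i p /cells]; rewrite !u4.
have [rL sz cells] := tr4; have le_L := rotation_size rL.
apply: runs_seq.
apply: runs_conseq (pRecord_spec g le_N big_bnd s4i tr4 _ u4r le_rs) _.
  by rewrite u4.
move=> s5 fr5 [st5 old5 _]; have s5i := inp_frame fr5 s4i isT.
have li4 : listed s4 rs by apply: listed_frame fr4 _ _ _ _ _.
have [p Ep] : exists p, onth L 0 = Some p.
  by apply: onth_lt; rewrite sz u4 // lt0n.
have [start0 _] := cells _ _ Ep; rewrite /= in start0.
have pP : p.1 \in plus_edges L by apply: map_f; apply/onthP; exists 0.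
apply: runs_seq.
apply: runs_conseq (pWeight_spec (x := x) (a := p.1) le_rs le_L s5i _ stx rL st5 _ _ pP) _.
- by move=> d; rewrite fr5 // u4.
- by rewrite fr5.
- by rewrite fr5.
move=> s6 fr6 [s6x mt old6]; have s6i := inp_frame fr6 s5i isT.
have st6 : stored_rotation s6 (size rs) L by apply: stored_frame fr6 _ _ _ st5.
have [ft _] := mt.
apply: runs_seq.
apply: runs_conseq (pApply_spec (n := size rs) (t := s6 9 (size rs)) le_rs le_L s6i s6x gx st6 _ _ ft _) _ => //.
- by rewrite fr6 // fr5.
- exact: rotation_pairing gx rL.
move=> s7 fr7 s7x.
have s7N : s7 vN 0 = size rs by rewrite fr7 // fr6 // fr5 // u4.
apply: runs_put => //=.
  rewrite s7N (bnd_poly le_N big_bnd) //.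
  by move: le_rs; move: (m * m) => q; clear; nia.
rewrite s7N addn1 => s8 [u8 u8n _]; right; split; first by exists L.
exists (rcons rs (L, s6 9 (size rs))), (shift x L (s6 9 (size rs))).
rewrite size_rcons; split=> //; split.
- exact: route_rcons.
- by move=> d; rewrite u8.
- by rewrite size_rcons.
- have s8s k K : stored_rotation s5 k K -> stored_rotation s8 k K.
    move=> [E c5]; split=> [|i q /c5]; rewrite !u8 // !fr7 // !fr6 //.
  move=> k K t; rewrite -cats1 onth_cat; case: ltnP => [lt_k Ek|ge_k].
    have [st w szK] := li4 _ _ _ Ek; split=> //.
      by apply: s8s; apply: old5.
    by rewrite u8 // fr7 // old6 ?neq_ltn ?lt_k // fr5.
  move/onth1P=> [/eqP Ek [<- <-]].
  have -> : k = size rs by apply/eqP; rewrite eqn_leq ge_k andbT -subn_eq0.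
  by split; [apply: s8s | rewrite u8 // fr7 |].
Qed.

Lemma pRoute_spec s : inp s -> runs pRoute s (fun s' => exists rs y,
  [/\ route xmin rs y, blocked (fun=> True) y, s' vN 0 = size rs, listed s' rs &
      s' vM2 0 = (m * m).+1]).
Proof.
move=> si; have [loopN loopb] := loop_edge le_N big_bnd.
have bp := bnd_poly le_N big_bnd.
apply: runs_seq; apply: runs_put => //=.
  by rewrite inp_m // addn1 (bnd_edge le_N big_bnd).
rewrite inp_m // addn1 => s1 [u1 u1m _].
have fr1 : frame [:: vM1] s s1 by move=> b; rewrite inE; apply: u1.
have s1i := inp_frame fr1 si isT.
apply: runs_seq; apply: runs_put => //=.
  rewrite inp_m // addn1; apply/andP; split; apply: bp; move: (m * m) => q; clear; nia.
rewrite inp_m // addn1 => s2 [u2 u2m _].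
have fr2 : frame [:: vM2] s1 s2 by move=> b; rewrite inE; apply: u2.
have s2i := inp_frame fr2 s1i isT.
apply: runs_seq; apply: runs_put => //= s3 [u3 u3n _].
have fr3 : frame [:: vN] s2 s3 by move=> b; rewrite inE; apply: u3.
have s3i := inp_frame fr3 s2i isT.
apply: runs_seq; apply: runs_conseq (pReset_spec s3i) _ => s4 fr4 s4x.
have s4i := inp_frame fr4 s3i isT.
have s4M1 : s4 vM1 0 = m.+1 by rewrite fr4 // u3 // u2.
have s4M2 : s4 vM2 0 = (m * m).+1 by rewrite fr4 // u3.
have s4N : s4 vN 0 = 0 by rewrite fr4.
apply: (runs_for (n := (m * m).+1) (I := fun i s' => exists rs x,
  on_route s' rs x /\ (size rs = i \/ forall L, ~ rotation x L))) => //.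
- by apply: leq_trans le_N; move: (m * m) => q; clear; lia.
- by apply: bp; move: (m * m) => q; clear; nia.
- by move=> s' fr; rewrite /= fr // s4M2.
- move=> i s5 s6 [rs [x [[r sx sN li] h]]] u; exists rs, x; split=> //; split=> //.
  + by move=> d; rewrite u.
  + by rewrite u.
  + by move=> k L t /li[[E c] w sz]; split=> //; rewrite ?u //; split=> [|j p /c]; rewrite !u.
- exists [::], xmin; split; last by left.
  split=> //; first by apply: route_nil; case: xmin_min.
  by move=> k L t; rewrite onth0n.
- move=> i s5 lt_i fr5 Ei [rs [x [on h]]].
  have s5i := inp_frame fr5 s4i isT.
  apply: runs_conseq (pStep_spec s5i _ on) _; first by rewrite fr5.
  move=> s6 fr6 [[on6 no]|[[L rL] [rs' [x' [on6 sz]]]]].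
    by exists rs, x; split=> //; right.
  exists rs', x'; split=> //; left; rewrite sz.
  by case: h => [->|no]; last by case: (no L).
move=> s5 fr5 [rs [x [[r s5x s5N li] h]]]; exists rs, x; split=> //.
  case: h => [E|no L rL _]; last by case: (no L).
  by have := route_bound ax gl r; rewrite E ltnn.
by rewrite fr5.
Qed.

End Spec.

(** * Computing the Hasse diagram *)

Definition pTry :=
  PSeq pTandems
  (PSeq (PPut vRow z0 (V vL))
  (PSeq (PAll vOk vJ (Get 8 (V vRow)) z1 (Get aTan (eCell rowA rowC nE)))
  (PIf (V vOk) (PSeq pApply (PPut aUsed (V vL) z1)) PSkip))).

(** Follows a route that avoids rotation [vK]: a pass over all rotations either
    uses one of them or shows that the route cannot be continued, so [m * m + 1]
    passes suffice.  The rotations that are not used, other than [vK], are those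
    that come after [vK]. *)
Definition pAvoid :=
  PSeq pReset
  (PSeq (PFor vL (V vN) (PPut aUsed (V vL) z0))
  (PSeq (PFor vRound (V vM2) (PFor vL (V vN)
           (PIf (Op Eq (V vL) (V vK)) PSkip pTry)))
  (PFor vL (V vN)
     (PPut aLess (eCell (V vK) (V vL) (V vN))
        (Op And (eNot (Op Eq (V vL) (V vK))) (eNot (Get aUsed (V vL)))))))).

Definition pHasse :=
  PFor vK (V vN) (PFor vL (V vN)
    (PSeq (PAll vOk vJ (V vN) (Get aLess (eCell (V vK) (V vJ) (V vN)))
                              (eNot (Get aLess (eCell (V vJ) (V vL) (V vN)))))
    (PPut 12 (eCell (V vK) (V vL) (V vN))
       (Op And (Get aLess (eCell (V vK) (V vL) (V vN))) (V vOk))))).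

Definition pRotations :=
  PSeq pRoute
  (PSeq (PFor vK (V vN) pAvoid)
  (PSeq pHasse
  (PPut 7 z0 (V vN)))).

Lemma eval_cell s i j k : eval s (eCell i j k) = eval s i * eval s k + eval s j.
Proof. by []. Qed.

Lemma fits_cell b s i j k : fits b s i -> fits b s j -> fits b s k ->
  eval s i * eval s k < b -> eval s i * eval s k + eval s j < b ->
  fits b s (eCell i j k).
Proof. by move=> /= -> -> -> -> ->. Qed.

Section RouteFacts.

Variables (M : market) (ax : market_axioms M) (gl : gapless M) (xmin : vec M).
Hypothesis xmin_min : is_min_stable xmin.
Variables (rs : seq (dcycle M * nat)) (y : vec M).
Hypotheses (r : route xmin rs y) (ny : blocked (fun=> True) y).

Implicit Types (L K : dcycle M) (x : vec M).

Let d0 : dcycle M * nat := ([::], 0).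
Let Lk k := (nth d0 rs k).1.

Lemma listed_full : full_route rs.
Proof. by apply/(full_routeP ax xmin_min); exists y. Qed.

(** Extend the route to a full one and use confluence. *)
Lemma applicable_used s' x L t : route xmin s' x -> rotation x L ->
  max_feasible x L t -> used_in L t rs.
Proof.
move=> r' rL mt.
have [s2 [y2 [rin2 ny2]]] := route_in_extend ax gl (fun=> True)
  (route_end (route_rcons ax r' rL mt)).
have r2 : route_in (fun=> True) xmin (rcons s' (L, t) ++ s2) y2.
  by split=> //; apply: (route_cat (route_rcons ax r' rL mt)); case: rin2.
have rin : route_in (fun=> True) xmin rs y by [].
apply/(route_in_confluent ax gl rin ny r2 ny2).
apply/used_in_cat; left; exists (L, t); first by rewrite mem_rcons mem_head.
by split=> //; apply: same_cycle_refl.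
Qed.

Lemma listed_uniq k l : k < size rs -> l < size rs -> same_cycle (Lk k) (Lk l) -> k = l.
Proof.
move=> lt_k lt_l sc; apply: (route_used_once ax gl r lt_k lt_l (d := d0) _ sc).
exact: same_cycle_refl.
Qed.

Lemma used_in_listed L t : used_in L t rs <->
  exists2 k, k < size rs & same_cycle L (Lk k) /\ t = (nth d0 rs k).2.
Proof.
split=> [/(used_inP _ _ _ d0)[k [lt_k sc E]]|[k lt_k [sc E]]].
  by exists k.
by apply/(used_inP _ _ _ d0); exists k.
Qed.

Lemma listed_used k : k < size rs -> used_in (Lk k) (nth d0 rs k).2 rs.
Proof.
by move=> lt_k; apply/used_in_listed; exists k => //; split=> //; apply: same_cycle_refl.
Qed.

(** A rotation has the same maximal weight wherever it applies, so the stored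
    weight can be used on other routes. *)
Lemma listed_weight s' x k : k < size rs -> route xmin s' x -> rotation x (Lk k) ->
  max_feasible x (Lk k) (nth d0 rs k).2.
Proof.
move=> lt_k r' rL; have [t mt] := max_feasible_exists ax rL.
have /used_in_listed[l lt_l [sc E]] := applicable_used r' rL mt.
by rewrite (listed_uniq lt_k lt_l sc) -E -(listed_uniq lt_k lt_l sc).
Qed.

Lemma listed_rotation k : k < size rs -> exists x, stable x /\ rotation x (Lk k).
Proof.
move=> lt_k; have [s1 [y1 [r1 rot _]]] := route_used ax r (mem_nth d0 lt_k).
by exists y1; split=> //; apply: route_end r1.
Qed.

(** Being a simple closed sequence does not depend on the allocation. *)
Lemma rotation_tandems x0 x L : rotation x0 L ->
  rotation x L = all (fun p => tandem x p.1 p.2) L.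
Proof.
by case/andP=> /and3P[L0 _ cL] uL; rewrite /rotation /tandem_cycle L0 cL uL !andbT.
Qed.

Lemma rot_lt_same K K' L L' : same_cycle K K' -> same_cycle L L' ->
  rot_lt K L -> rot_lt K' L'.
Proof.
move=> sK sL [[tK [s1 f1 u1]] [tL [s2 f2 u2]] all_e]; split.
- by exists tK, s1 => //; apply: used_in_same u1.
- by exists tL, s2 => //; apply: used_in_same u2.
move=> s /all_e[i [j [h hK hL]]]; exists i, j; split=> //.
  exact: same_cycle_trans (same_cycle_sym sK) hK.
exact: same_cycle_trans (same_cycle_sym sL) hL.
Qed.

Lemma hasse_listed k l : k < size rs -> l < size rs ->
  hasse (Lk k) (Lk l) <-> rot_lt (Lk k) (Lk l) /\
    forall j, j < size rs -> rot_lt (Lk k) (Lk j) -> ~ rot_lt (Lk j) (Lk l).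
Proof.
move=> lt_k lt_l; split=> [[lt no]|[lt no]]; split=> //.
  by move=> j lt_j kj jl; apply: no; exists (Lk j).
case=> K [kK Kl]; have [_ [t wK] _] := kK.
have /used_in_listed[j lt_j [sc _]] : used_in K t rs.
  exact/(rotation_weightP ax gl xmin_min _ _ listed_full).
apply: (no j lt_j).
  exact: rot_lt_same (same_cycle_refl _) sc kK.
exact: rot_lt_same sc (same_cycle_refl _) Kl.
Qed.

Lemma rot_lt_avoid k l s' y' : k < size rs -> l < size rs ->
    route_in (other (Lk k)) xmin s' y' -> blocked (other (Lk k)) y' ->
  rot_lt (Lk k) (Lk l) <-> l <> k /\ ~ exists t, used_in (Lk l) t s'.
Proof.
move=> lt_k lt_l rin' ny'.
have uk : exists t, used_in (Lk k) t rs by eexists; apply: listed_used.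
have ul : exists t, used_in (Lk l) t rs by eexists; apply: listed_used.
rewrite (rot_ltP ax gl xmin_min listed_full uk ul rin' ny'); split=> -[h nu]; split=> //.
  by move=> E; apply: h; rewrite E; apply: same_cycle_refl.
by move/(listed_uniq lt_l lt_k).
Qed.

End RouteFacts.

Section Spec.

Variables (M : market) (ax : market_axioms M) (gl : gapless M) (xmin : vec M).
Variables (bnd N g B : nat).
Notation m := #|edge M|.
Hypothesis le_N : m * m + m + 2 <= N.
Hypothesis big_bnd : m.+2 ^ 5 * (2 * B + 4) <= bnd.
Hypothesis cap_B : forall e : edge M, cap e <= B.
Hypothesis B_log : B <= 2 ^ g.
Hypothesis xmin_min : is_min_stable xmin.

Implicit Types (e d a c : edge M) (x y z : vec M) (w : worker M).
Implicit Types (s : state) (L K : dcycle M) (rs : seq (dcycle M * nat)).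

Notation runs := (runs (market_oracle M) bnd N g).
Notation inp := (inp xmin).

Let bndb := bnd_bool le_N big_bnd.
Let inp_m := @inp_m M xmin.
Let inp_frame := @inp_frame M xmin.

Section Listed.

Variables (rs : seq (dcycle M * nat)) (y : vec M).
Hypotheses (r : route xmin rs y) (ny : blocked (fun=> True) y).
Notation n := (size rs).
Let d0 : dcycle M * nat := ([::], 0).
Let Lk k := (nth d0 rs k).1.
Let tk k := (nth d0 rs k).2.

Let le_n : n <= m * m := route_bound ax gl r.
Let loop_n : n <= N /\ n < bnd.
Proof.
split; first by apply: leq_trans le_N; rewrite -addnA (leq_trans le_n) // leq_addr.
by apply: (bnd_poly le_N big_bnd); move: le_n; move: (m * m) => q; clear; nia.
Qed.

Lemma listed_nth s k : listed s rs -> k < n ->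
  [/\ stored_rotation s k (Lk k), s 9 k = tk k & size (Lk k) <= m].
Proof.
move=> li lt_k; apply: li; rewrite onthE (nth_map d0) // /Lk /tk.
by case: (nth d0 rs k).
Qed.

Definition avoiding k s q x := [/\ route_in (other (Lk k)) xmin q x, rep s aX x &
  forall l, l < n -> s aUsed l != 0 <-> exists t, used_in (Lk l) t q].

Lemma pTry_spec s k l q x : inp s -> listed s rs -> k < n -> l < n -> l != k ->
    s vL 0 = l -> avoiding k s q x ->
  runs pTry s (fun s1 => (avoiding k s1 q x /\ ~ rotation x (Lk l)) \/
    (rotation x (Lk l) /\ exists q2 x2, avoiding k s1 q2 x2 /\ size q2 = (size q).+1)).
Proof.
move=> si li lt_k lt_l nlk sl [rin sx used].
have r' := proj1 rin; have stx := route_end r'; have gx := stable_g stx.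
have [loopN loopb] := loop_edge le_N big_bnd.
have [st w szL] := listed_nth li lt_l.
have [x0 [_ rot0]] := listed_rotation ax r lt_l; rewrite -/(Lk l) in rot0.
apply: runs_seq; apply: runs_conseq (pTandems_spec ax g le_N big_bnd cap_B si sx gx) _.
move=> s1 fr1 [s1x _ s1t]; have s1i := inp_frame fr1 si isT.
apply: runs_seq; apply: runs_put => //= s2 [u2 u2r _].
have fr2 : frame [:: vRow] s1 s2 by move=> b; rewrite inE; apply: u2.
have s2i := inp_frame fr2 s1i isT.
rewrite fr1 // sl in u2r.
have le_l : l <= m * m by apply: leq_trans (ltnW lt_l) le_n.
have s2L : stored_rotation s2 l (Lk l).
  by apply: stored_frame fr2 _ _ _ _ => //; apply: stored_frame fr1 _ _ _ _.
have s2t : tanrep s2 x by move=> a c; rewrite u2.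
have s2x : rep s2 aX x by move=> d; rewrite u2.
pose A j := if onth (Lk l) j is Some p then tandem x p.1 p.2 else true.
apply: runs_seq; apply: (runs_all (size (Lk l)) A) => //.
- exact: leq_trans szL loopN.
- exact: leq_ltn_trans szL loopb.
- move=> s3 fr3; rewrite /= !fr3 // u2r; split=> //; by case: s2L.
- move=> j s3 lt_j fr3 Ej; have s3i := inp_frame fr3 s2i isT.
  have [p Ep] := onth_lt lt_j.
  have s3L : stored_rotation s3 l (Lk l) by apply: stored_frame fr3 _ _ _ _.
  have s3R : s3 vRow 0 = l by rewrite fr3.
  have [f1 f2 e1 e2] := row_pair le_N big_bnd le_l szL s3i s3R Ej s3L Ep.
  have [b1 b2] := bnd_tan le_N big_bnd (num_lt p.1) (num_lt p.2).
  have s3m : s3 0 2 = m by rewrite inp_m.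
  have ecell : eval s3 (eCell rowA rowC nE) = num p.1 * m + num p.2.
    by rewrite eval_cell e1 e2 [eval s3 nE]s3m.
  split=> // [_|].
    by apply: fits_cell => //; rewrite e1 ?e2 [eval s3 nE]s3m.
  rewrite -[eval s3 (Get _ _)]/(s3 aTan (eval s3 (eCell rowA rowC nE))) ecell.
  by rewrite fr3 // s2t eqb0 negbK /A Ep.
move=> s3 fr3 ok3; have s3i := inp_frame fr3 s2i isT.
have s3L : stored_rotation s3 l (Lk l) by apply: stored_frame fr3 _ _ _ _.
have allE : all A (iota 0 (size (Lk l))) = rotation x (Lk l).
  rewrite (rotation_tandems x rot0); apply/allP/allP => h.
    by move=> p /onthP[j Ej]; have := h j; rewrite mem_iota add0n -onthTE /A Ej; apply.
  by move=> j _; rewrite /A; case Ej: (onth _ j) => [p|//]; apply: h; apply/onthP; exists j.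
rewrite allE in ok3.
have s3x : rep s3 aX x by move=> d; rewrite fr3.
have s3used j : s3 aUsed j = s aUsed j by rewrite fr3 // u2 // fr1.
apply: runs_if => // [c4|c4]; rewrite /= ok3 eqb0 negbK in c4; last first.
  apply: runs_skip; left; split; last exact/negP.
  by split=> // j lt_j; rewrite s3used; apply: used.
have mt := listed_weight ax gl r ny lt_l r' c4; rewrite -/(Lk l) -/(tk l) in mt.
have [ft _] := mt.
have s3R : s3 vRow 0 = l by rewrite fr3.
have s3w : s3 9 l = tk l by rewrite fr3 // u2 // fr1.
apply: runs_seq.
apply: runs_conseq (pApply_spec g le_N big_bnd cap_B le_l szL s3i s3x gx s3L s3R s3w ft _) _.
  exact: (rotation_pairing ax gx c4).
move=> s4 fr4 s4x; have s4l : s4 vL 0 = l by rewrite fr4 // fr3 // u2 // fr1.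
apply: runs_put => //= s5 [u5 u5u u5o]; rewrite s4l in u5u u5o.
right; split=> //; exists (rcons q (Lk l, tk l)), (shift x (Lk l) (tk l)).
rewrite size_rcons; split=> //; split.
- split; first exact: route_rcons.
  move=> p; rewrite mem_rcons inE => /orP[/eqP->|]; last by case: rin => _; apply.
  by move=> /(listed_uniq ax gl r lt_l lt_k) E; rewrite E eqxx in nlk.
- by move=> d; rewrite u5.
move=> j lt_j; rewrite -cats1; split=> [h|[t /used_in_cat[h|/used_in_cons[[h _]|[]]]]] //.
- have [Ej|nj] := eqVneq j l.
    exists (tk l); apply/used_in_cat; right; apply/used_in_cons; left.
    by rewrite Ej; split=> //; apply: same_cycle_refl.
  have [|t ht] := proj1 (used j lt_j); last by exists t; apply/used_in_cat; left.
  by move: h; rewrite u5o // fr4 // s3used.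
- have [->|nj] := eqVneq j l; first by rewrite u5u.
  by rewrite u5o // fr4 // s3used; apply/(used j lt_j); exists t.
- by rewrite (listed_uniq ax gl r lt_j lt_l h) u5u.
Qed.

Lemma blocked_listed k q x : k < n -> route xmin q x ->
  (forall l, l < n -> l != k -> ~ rotation x (Lk l)) -> blocked (other (Lk k)) x.
Proof.
move=> lt_k r' no L rL oL; have [t mt] := max_feasible_exists ax rL.
have /used_in_listed[l lt_l [sc _]] := applicable_used ax gl r ny r' rL mt.
apply: (no l lt_l); last exact: rotation_same_cycle sc rL.
by apply: contra_notN oL => /eqP <-.
Qed.

Definition less_row s k := forall l, l < n ->
  s aLess (k * n + l) != 0 <-> rot_lt (Lk k) (Lk l).

Lemma pAvoid_spec s k : inp s -> listed s rs -> s vN 0 = n -> s vM2 0 = (m * m).+1 ->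
    k < n -> s vK 0 = k ->
  runs pAvoid s (fun s' => less_row s' k /\
    forall j, j < k * n -> s' aLess j = s aLess j).
Proof.
move=> si li sN sM lt_k sk; have [loopN loopb] := loop_n.
have bp := bnd_poly le_N big_bnd.
apply: runs_seq; apply: runs_conseq (pReset_spec g le_N big_bnd si) _ => s1 fr1 s1x.
have s1i := inp_frame fr1 si isT.
apply: runs_seq; apply: (runs_for (n := n) (I := fun i s' =>
  forall l, l < i -> s' aUsed l = 0)) => //.
- by move=> s' fr; rewrite /= !fr // fr1.
- by move=> i s2 s3 h u l; rewrite u //; apply: h.
- move=> i s2 lt_i fr2 Ei I2; apply: runs_put => //= s3 [_ u3u u3o] l.
  rewrite Ei in u3u u3o; rewrite ltnS leq_eqVlt => /orP[/eqP->//|lt_l].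
  by rewrite u3o ?I2 // neq_ltn lt_l.
move=> s2 fr2 used2; have s2i := inp_frame fr2 s1i isT.
have s2N : s2 vN 0 = n by rewrite fr2 // fr1.
have s2M : s2 vM2 0 = (m * m).+1 by rewrite fr2 // fr1.
have s2K : s2 vK 0 = k by rewrite fr2 // fr1.
have li2 : listed s2 rs.
  by apply: listed_frame fr2 _ _ _ _ _ => //; apply: listed_frame fr1 _ _ _ _ _.
have avoid_irr v s3 s4 q x : v != aX -> v != aUsed ->
    (forall b, b != v -> s4 b = s3 b) -> avoiding k s3 q x -> avoiding k s4 q x.
  move=> n1 n2 u [h1 h2 h3]; split=> //.
    by move=> d; rewrite u // eq_sym.
  by move=> l lt_l; rewrite u ?h3 // eq_sym.
apply: runs_seq; apply: (runs_for (n := (m * m).+1) (I := fun i s3 =>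
  exists q x, avoiding k s3 q x /\ (blocked (other (Lk k)) x \/ i <= size q))) => //.
- by apply: leq_trans le_N; move: (m * m) => q; clear; lia.
- by apply: bp; move: (m * m) => q; clear; nia.
- by move=> s' fr; rewrite /= !fr // s2M.
- move=> i s3 s4 [s' [x [av h]]] u; exists s', x; split=> //.
  exact: avoid_irr u av.
- exists [::], xmin; split; last by right.
  split.
  + by split=> //; apply: route_nil; case: xmin_min.
  + by move=> d; rewrite fr2.
  + by move=> l lt_l; rewrite used2 //; split=> // -[t []].
- move=> i s3 lt_i fr3 Ei [s' [x [av3 h3]]].
  have s3i := inp_frame fr3 s2i isT.
  have li3 : listed s3 rs by apply: listed_frame fr3 _ _ _ _ _.
  have s3N : s3 vN 0 = n by rewrite fr3.
  have s3K : s3 vK 0 = k by rewrite fr3.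
  apply: (runs_for (n := n) (I := fun l s4 => exists q x, avoiding k s4 q x /\
    [\/ blocked (other (Lk k)) x, i < size q |
        i <= size q /\ forall l', l' < l -> l' != k -> ~ rotation x (Lk l')])) => //.
  + by move=> s4 fr; rewrite /= !fr // s3N.
  + move=> l s4 s5 [s4' [x4 [av h]]] u; exists s4', x4; split=> //.
    exact: avoid_irr u av.
  + exists s', x; split=> //; case: h3 => [b|le_i]; [by apply: Or31|].
    by apply: Or33; split.
  + move=> l s4 lt_l fr4 El [s4' [x4 [av4 h4]]].
    have s4i := inp_frame fr4 s3i isT.
    have li4 : listed s4 rs by apply: listed_frame fr4 _ _ _ _ _.
    apply: runs_if => [|c|c].
    * by rewrite /= bndb.
    * rewrite evalEq /= El fr4 // s3K in c; apply: runs_skip.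
      exists s4', x4; split=> //; case: h4 => [b|lt|[le no]]; [by apply: Or31|by apply: Or32|].
      apply: Or33; split=> // l'; rewrite ltnS leq_eqVlt => /orP[/eqP->|]; last exact: no.
      by rewrite c.
    rewrite evalEq /= El fr4 // s3K in c.
    apply: runs_conseq (pTry_spec s4i li4 lt_k lt_l c El av4) _ => s5 fr5.
    case=> [[av5 nrot]|[rot [s5' [x5 [av5 sz]]]]].
      exists s4', x4; split=> //; case: h4 => [b|lt|[le no]]; [by apply: Or31|by apply: Or32|].
      apply: Or33; split=> // l'; rewrite ltnS leq_eqVlt => /orP[/eqP->//|]; exact: no.
    exists s5', x5; split=> //; apply: Or32; rewrite sz ltnS.
    case: h4 => [b|lt|[le _]] //; last exact: ltnW.
    case: (b _ rot) => sc.
    by move: c; rewrite (listed_uniq ax gl r lt_l lt_k sc) eqxx.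
  move=> s4 fr4 [s4' [x4 [av4 h4]]]; exists s4', x4; split=> //.
  case: h4 => [b|lt|[_ no]]; [by left|by right|left].
  have [rin4 _ _] := av4.
  exact: blocked_listed lt_k (proj1 rin4) no.
move=> s3 fr3 [s' [x [[rin sx used] h]]].
have bl : blocked (other (Lk k)) x.
  case: h => // le_s; have := leq_trans le_s (route_bound ax gl (proj1 rin)).
  by rewrite ltnn.
have s3N : s3 vN 0 = n by rewrite fr3.
have s3K : s3 vK 0 = k by rewrite fr3.
have s3L j : s3 aLess j = s aLess j by rewrite fr3 // fr2 // fr1.
apply: (runs_for (n := n) (I := fun i s4 =>
  (forall l, l < i -> s4 aLess (k * n + l) = (l != k) && ~~ (s3 aUsed l != 0)) /\
  forall j, j < k * n -> s4 aLess j = s aLess j)) => //.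
- by move=> s4 fr; rewrite /= !fr // s3N.
- by move=> i s4 s5 [h1 h2] u; split=> j h'; rewrite u //; [apply: h1|apply: h2].
- move=> i s4 lt_i fr4 Ei [I1 I2].
  have s4K : s4 vK 0 = k by rewrite fr4.
  have s4N : s4 vN 0 = n by rewrite fr4.
  have lt_idx : k * n + i < n * n by apply: idx_lt.
  have le_nn : n * n <= (m * m) * (m * m) by apply: leq_mul.
  apply: runs_put => //=.
  + rewrite s4K s4N Ei; apply/andP; split; apply: bp;
      move: lt_idx le_nn; move: (m * m) => q; clear; nia.
  + by rewrite !bndb.
  rewrite s4K s4N Ei fr4 // => s5 [u5 u5l u5o]; split.
    move=> l; rewrite ltnS leq_eqVlt => /orP[/eqP->|lt_l].
      by rewrite u5l; case: (i == k); case: (s3 aUsed i).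
    by rewrite u5o ?I1 // eqn_add2l neq_ltn lt_l.
  move=> j lt_j; rewrite u5o ?I2 // neq_ltn (leq_trans lt_j) ?leq_addr //.
move=> s4 fr4 [I1 I2]; split=> // l lt_l; rewrite I1 // eqb0 negbK.
rewrite (rot_lt_avoid ax gl xmin_min r ny lt_k lt_l rin bl) -(used l lt_l).
split=> [/andP[/eqP nlk /negP nu]|[/eqP nlk /negP nu]]; first by split.
by rewrite nlk.
Qed.

Lemma pHasse_spec s : listed s rs -> s vN 0 = n ->
    (forall k, k < n -> less_row s k) ->
  runs pHasse s (fun s' => forall k l, k < n -> l < n ->
    (s' 12 (k * n + l) != 0 <-> hasse (Lk k) (Lk l))).
Proof.
move=> li sN rows; have [loopN loopb] := loop_n.
have bp := bnd_poly le_N big_bnd.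
have le_nn : n * n <= (m * m) * (m * m) by apply: leq_mul.
have bidx k l : k < n -> l < n -> k * n + l < bnd /\ k * n < bnd.
  move=> lt_k lt_l; have := idx_lt lt_k lt_l => lt_idx.
  split; apply: bp; move: lt_idx le_nn; move: (m * m) => q; clear; nia.
apply: (runs_for (n := n) (I := fun i s' => forall k l, k < i -> l < n ->
    (s' 12 (k * n + l) != 0 <-> hasse (Lk k) (Lk l)))) => //.
- by move=> s' fr; rewrite /= !fr // sN.
- by move=> i s1 s2 h u k l; rewrite u //; apply: h.
- move=> k s1 lt_k fr1 Ek I1.
  apply: (runs_for (n := n) (I := fun i s' =>
    (forall l, l < i -> (s' 12 (k * n + l) != 0 <-> hasse (Lk k) (Lk l))) /\
    forall j, j < k * n -> s' 12 j = s1 12 j)) => //.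
  + by move=> s' fr; rewrite /= !fr // fr1 // sN.
  + by move=> i s2 s3 [h1 h2] u; split=> j h'; rewrite u //; [apply: h1|apply: h2].
  + move=> l s2 lt_l fr2 El [I21 I22].
    have s2K : s2 vK 0 = k by rewrite fr2.
    have s2N : s2 vN 0 = n by rewrite fr2 // fr1.
    have s2L j : s2 aLess j = s aLess j by rewrite fr2 // fr1.
    have [b1 b2] := bidx k l lt_k lt_l.
    apply: runs_seq; apply: (runs_all n (fun j =>
      (s aLess (k * n + j) != 0) ==> ~~ (s aLess (j * n + l) != 0))) => //.
    * by move=> s3 fr3; rewrite /= fr3 // s2N.
    * move=> j s3 lt_j fr3 Ej.
      have [s3K s3N s3L] : [/\ s3 vK 0 = k, s3 vN 0 = n & s3 vL 0 = l] by rewrite !fr3.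
      have s3l i : s3 aLess i = s aLess i by rewrite fr3 // s2L.
      have [b3 b4] := bidx k j lt_k lt_j; have [b5 b6] := bidx j l lt_j lt_l.
      rewrite !evalE /= s3K s3N s3L Ej !s3l b3 b4 b5 b6 bndb; split=> //.
    move=> s3 fr3 ok3.
    have [s3K s3N s3L] : [/\ s3 vK 0 = k, s3 vN 0 = n & s3 vL 0 = l] by rewrite !fr3.
    have s3l i : s3 aLess i = s aLess i by rewrite fr3 // s2L.
    apply: runs_put => //=; first by rewrite s3K s3N s3L b1 b2.
      by rewrite s3K s3N s3L b1 b2 bndb.
    rewrite s3K s3N s3L s3l ok3 => s4 [u4 u4h u4o]; split.
      move=> l'; rewrite ltnS leq_eqVlt => /orP[/eqP->|lt_l'].
        rewrite u4h eqb0 negbK (hasse_listed ax gl xmin_min r ny lt_k lt_l).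
        rewrite eqb0 negbK; split=> [/andP[h /allP no]|[h no]].
          split; first exact/(rows k lt_k l lt_l).
          move=> j lt_j /(rows k lt_k j lt_j) kj /(rows j lt_j l lt_l) jl.
          by have := no j; rewrite mem_iota add0n lt_j kj jl => /(_ isT).
        apply/andP; split; first exact/(rows k lt_k l lt_l).
        apply/allP => j; rewrite mem_iota add0n => lt_j; apply/implyP => kj.
        apply/negP => jl; apply: (no j lt_j); first exact/(rows k lt_k j lt_j).
        exact/(rows j lt_j l lt_l).
      by rewrite u4o ?fr3 //; [apply: I21|rewrite eqn_add2l neq_ltn lt_l'].
    move=> j lt_j; rewrite u4o ?fr3 ?I22 // neq_ltn (leq_trans lt_j) ?leq_addr //.
  move=> s2 fr2 [h1 h2] k' l; rewrite ltnS leq_eqVlt => /orP[/eqP->|lt_k'] lt_l.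
    exact: h1.
  by rewrite h2 ?idx_lt //; apply: I1.
Qed.

End Listed.

Theorem pRotations_spec s : inp s -> runs pRotations s (@correct_output M).
Proof.
move=> si.
apply: runs_seq; apply: runs_conseq (pRoute_spec ax gl le_N big_bnd cap_B B_log xmin_min si) _.
move=> s1 fr1 [rs [y [r ny s1N li1 s1M]]]; have s1i := inp_frame fr1 si isT.
have le_n := route_bound ax gl r; set n := size rs in s1N le_n.
have loopN : n <= N by apply: leq_trans le_N; rewrite -addnA (leq_trans le_n) // leq_addr.
have loopb : n < bnd.
  by apply: (bnd_poly le_N big_bnd); move: le_n; move: (m * m) => q; clear; nia.
apply: runs_seq; apply: (runs_for (n := n) (I := fun i s' =>
  forall k, k < i -> less_row rs s' k)) => //.
- by move=> s' fr; rewrite /= !fr // s1N.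
- by move=> i s2 s3 h u k lt_k l; rewrite u //; apply: h.
- move=> k s2 lt_k fr2 Ek I2; have s2i := inp_frame fr2 s1i isT.
  have li2 : listed s2 rs by apply: listed_frame fr2 _ _ _ _ _.
  apply: runs_conseq (pAvoid_spec r ny s2i li2 _ _ lt_k Ek) _.
  + by rewrite fr2.
  + by rewrite fr2.
  move=> s3 fr3 [row old] k'; rewrite ltnS leq_eqVlt => /orP[/eqP->//|lt_k'] l lt_l.
  by rewrite old; [apply: I2|apply: idx_lt].
move=> s2 fr2 rows; have s2i := inp_frame fr2 s1i isT.
have li2 : listed s2 rs by apply: listed_frame fr2 _ _ _ _ _.
apply: runs_seq; apply: runs_conseq (pHasse_spec r ny li2 _ rows) _; first by rewrite fr2.
move=> s3 fr3 hs.
have li3 : listed s3 rs by apply: listed_frame fr3 _ _ _ _ _.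
apply: runs_put => //= s4 [u4 u4n _].
pose d0 : dcycle M * nat := ([::], 0).
have nthE k : k < n -> nth [::] (map fst rs) k = (nth d0 rs k).1.
  by move=> lt_k; rewrite (nth_map d0).
exists (map fst rs); rewrite size_map -/n; split.
- by rewrite u4n fr3 // fr2 // s1N.
- move=> k lt_k; rewrite nthE //; have [[E c] _ _] := listed_nth li3 lt_k.
  by split=> [|i p /c]; rewrite !u4.
- move=> k l lt_k lt_l; rewrite !nthE //; exact: (listed_uniq ax gl r lt_k lt_l).
- move=> L t; rewrite (rotation_weightP ax gl xmin_min _ _ (listed_full ax xmin_min r ny)).
  rewrite used_in_listed; split=> -[k lt_k [sc E]]; exists k => //.
    by rewrite nthE // u4 //; have [_ -> _] := listed_nth li3 lt_k.
  by rewrite nthE // in sc; rewrite u4 // in E; have [_ w _] := listed_nth li3 lt_k;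
    rewrite E w.
- by move=> k l lt_k lt_l; rewrite !nthE // u4 //; apply: hs.
Qed.

End Spec.

(** * Bounds on time and numbers *)

Section Bounds.

Variable M : market.
Notation m := #|edge M|.

Lemma cap_le_log (e : edge M) : cap e <= \max_(d : edge M) cap d.
Proof. exact: leq_bigmax. Qed.

(** The factor 2 absorbs the rounding of the logarithm. *)
Lemma max_cap_lt : \max_(e : edge M) cap e < 2 ^ (2 * log_bmax M).
Proof.
apply: leq_trans (trunc_log_ltn _ (ltnSn 1)) _; rewrite leq_exp2l // /log_bmax.
by move: (trunc_log _ _) => t; lia.
Qed.

Lemma size_bound_large K : 14 <= K ->
  m.+2 ^ 5 * (2 * (\max_(e : edge M) cap e) + 4) <= size_bound K M.
Proof.
move=> le_K; have lt_B := max_cap_lt; have := trunc_log_ltn m (ltnSn 1).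
rewrite /size_bound; set t := trunc_log 2 m; set B := \max_(e : edge M) cap e in lt_B *.
have g_gt0 : 0 < log_bmax M by rewrite /log_bmax leq_maxl.
set g := log_bmax M in lt_B g_gt0 * => lt_m.
(* 5 (t + 2) + 2 g + 2 <= 14 (t + g) because g >= 1 *)
apply: (@leq_trans (2 ^ (5 * t.+2 + (2 * g + 2)))); last first.
  by rewrite leq_exp2l //; nia.
rewrite expnD leq_mul //.
  rewrite mulnC expnM leq_exp2r //; move: lt_m.
  have : 0 < 2 ^ t by rewrite expn_gt0.
  by rewrite !expnS; move: (2 ^ t) => q; lia.
have le4 : 2 ^ 2 <= 2 ^ (2 * g) by rewrite leq_exp2l //; lia.
by rewrite expnD; move: le4 lt_B; move: (2 ^ (2 * g)) => q; lia.
Qed.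

Lemma duration_bound K1 N S g : N <= 3 * S ^ 2 -> 0 < S ->
  K1 * N ^ K1 * (2 * g) <=
  (2 * K1 * 3 ^ K1 + 2 * K1 + 14) * S ^ (2 * K1 * 3 ^ K1 + 2 * K1 + 14) * g.
Proof.
move=> le_N S_gt0; have le1 : N ^ K1 <= 3 ^ K1 * S ^ (2 * K1).
  case: K1 => // k; apply: leq_trans (_ : (3 * S ^ 2) ^ k.+1 <= _).
    by rewrite leq_exp2r.
  by rewrite expnMn -expnM.
have le2 : S ^ (2 * K1) <= S ^ (2 * K1 * 3 ^ K1 + 2 * K1 + 14).
  by rewrite leq_pexp2l // -addnA addnCA leq_addr.
rewrite mulnA leq_mul2r; apply/orP; right.
apply: leq_trans (_ : 2 * K1 * 3 ^ K1 * S ^ (2 * K1) <= _); last first.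
  by rewrite leq_mul // -addnA leq_addr.
by rewrite mulnC -!mulnA !leq_mul.
Qed.

End Bounds.

Theorem proposition6p2 :
  exists (P : cmd) (K : nat),
    forall (M : market) (xmin : vec M),
      market_axioms M -> gapless M -> is_min_stable xmin ->
      exists (s : state) (t : nat),
        [/\ exec (market_oracle M) (size_bound K M) P (input xmin) s t,
            t <= poly_bound K M * log_bmax M &
            correct_output M s].
Proof.
have [K1 dur] := duration_poly pRotations.
pose K := 2 * K1 * 3 ^ K1 + 2 * K1 + 14.
exists (compile pRotations), K => M xmin ax gl xmin_min.
pose m := #|edge M|; pose B := \max_(e : edge M) cap e; pose g := 2 * log_bmax M.
have big : m.+2 ^ 5 * (2 * B + 4) <= size_bound K M.
  by apply: size_bound_large; rewrite /K leq_addl.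
have capB (e : edge M) : cap e <= B := cap_le_log e.
have [] := pRotations_spec ax gl (leqnn (m * m + m + 2)) big capB
  (ltnW (max_cap_lt M)) xmin_min (s := input xmin).
  by [].
move=> s [t [ex le_t ok]]; exists s, t; split=> //.
have g_gt0 : 0 < g by rewrite /g muln_gt0 /= /log_bmax leq_maxl.
apply: leq_trans le_t _; apply: leq_trans (dur _ _ g_gt0) _.
have -> : while_depth pRotations = 1 by [].
rewrite expn1 /g; apply: duration_bound => //.
(* m^2 + m + 3 <= 3 (|V| + |E| + 1)^2 *)
rewrite -/m; move: (#|vertex M|) => v; nia.
Qed.
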